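(* Let $\Lambda\in(-\Lambda_0,0)$ and $\delta>0$. For $\varepsilon>0$ sufficiently small, there exists a function $U_\varepsilon:\mathbb R\times\Sigma_{\Lambda,\delta}\to\mathrm{Mat}_{2n\times2m}(\mathbb C)$ such that for all $\lambda\in\Sigma_{\Lambda,\delta}$ and $\gamma\in\mathbb C$ we have the factorization $$\mathcal E_\varepsilon(\lambda,\gamma)=\mathcal E_{s,\varepsilon}(\lambda,\gamma)\,\mathcal E_{f,\varepsilon}(\lambda,\gamma),$$ with $\mathcal E_{s,\varepsilon},\mathcal E_{f,\varepsilon}:\Sigma_{\Lambda,\delta}\times\mathbb C\to\mathbb C$ given by $$\mathcal E_{s,\varepsilon}(\lambda,\gamma):=\det(\mathcal T_{sd,\varepsilon}(0,-L_\varepsilon,\lambda)-\gamma\mathcal T_{sd,\varepsilon}(0,L_\varepsilon,\lambda)),\qquad \mathcal E_{f,\varepsilon}(\lambda,\gamma):=\det(\mathcal T_{fd,\varepsilon}(0,-L_\varepsilon,\lambda)-\gamma\mathcal T_{fd,\varepsilon}(0,L_\varepsilon,\lambda)).$$ Here $\mathcal T_{sd,\varepsilon}(x,y,\lambda)$ is the evolution of $\partial_x\chi=\sqrt\varepsilon(\mathcal A_{11,\varepsilon}(x,\lambda)+\mathcal A_{12,\varepsilon}(x)U_\varepsilon(x,\lambda))\chi$, $\chi\in\mathbb C^{2m}$, and $\mathcal T_{fd,\varepsilon}(x,y,\lambda)$ is the evolution of $\partial_x\omega=(\mathcal A_{22,\varepsilon}(x,\lambda)-\sqrt\varepsilon U_\varepsilon(x,\lambda)\mathcal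 A_{12,\varepsilon}(x))\omega$, $\omega\in\mathbb C^{2n}$. With $\beta_f,\rho>0$ the constants described in the context, the function $U_\varepsilon$ has the following properties: 1. $U_\varepsilon(\cdot,\lambda)$ is bounded on $\mathbb R$ uniformly in $\varepsilon$ and $\lambda$; 2. $U_\varepsilon(\cdot,\lambda)$ is $2L_\varepsilon$-periodic for each $\lambda\in\Sigma_{\Lambda,\delta}$; 3. for all $x\in[-L_\varepsilon,L_\varepsilon]$, uniformly in $\lambda\in\Sigma_{\Lambda,\delta}$, $\|U_\varepsilon(x,\lambda)-\mathcal X_{in}(x,\lambda)\|=O(\varepsilon^{\beta_f})$; 4. for all $x\in[-L_\varepsilon,L_\varepsilon]\setminus[-\varepsilon^{-\rho},\varepsilon^{-\rho}]$, $\|U_\varepsilon(x,\lambda)\|=O(\varepsilon^3)$, uniformly in $\lambda\in\Sigma_{\Lambda,\delta}$.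
   Context: Setting. $m,n\ge1$ are integers; $D_1\in\mathbb R^{m\times m}$, $D_2\in\mathbb R^{n\times n}$ are diagonal with strictly positive diagonal entries; $\varepsilon>0$ is a small parameter. Consider $\partial_tu=D_1\partial_{\check x\check x}u-H_1(u,v,\varepsilon)-\varepsilon^{-1}H_2(u,v)$, $\partial_tv=\varepsilon^2D_2\partial_{\check x\check x}v-G(u,v,\varepsilon)$, $u\in\mathbb R^m$, $v\in\mathbb R^n$; put $x=\varepsilon^{-1}\check x$. Standing assumptions: (S1) There are open connected sets $U\subset\mathbb R^m$, $V\subset\mathbb R^n$, $I\subset\mathbb R$ with $0\in V$, $0\in I$ such that $H_1,G$ are $C^2$ on $U\times V\times I$, $H_2$ is $C^2$ on $U\times V$, and $H_2(u,0)=0$, $G(u,0,\varepsilon)=0$ for all $u\in U,\varepsilon\in I$. (S2) For each $u\in U$ the matrix $\frac12(\partial_vG(u,0,0)+\partial_vG(u,0,0)^* )$ is positive definite. (S3) For $\varepsilon>0$ sufficiently small there is a $2L_\varepsilon$-periodic solution $\phi_{p,\varepsilon}:\mathbb R\to U\times\mathbb R^m\times V\times\mathbb R^n$ to $D_1\partial_xu=\varepsilon p$, $\partial_xp=\varepsilon H_1(u,v,\varepsilon)+H_2(u,v)$, $D_2\partial_xv=q$, $\partial_xq=G(u,v,\varepsilon)$ such that: (1) $L_\varepsilon=\varepsilon^{-1}\check L_\varepsilon$, $\check L_\varepsilon\to\check L_0>0$ as $\varepsilon\to0$; (2) there are $u_0\in U$, $p_0\in\mathbb R^m$ and a solution $(v_h,q_h)$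 to $D_2\partial_xv=q$, $\partial_xq=G(u_0,v,0)$ homoclinic to $(0,0)$ with $\|\phi_{p,\varepsilon}(0)-(u_0,p_0,v_h(0),q_h(0))\|=O(\varepsilon)$; (3) there are $L_s,\beta_s>0$ and a solution $(u_s(\check x),p_s(\check x))$ to $D_1\partial_{\check x}u=p$, $\partial_{\check x}p=H_1(u,0,0)$ such that for $x\in[0,2L_\varepsilon]$: $d(\phi_{p,\varepsilon}(x),\mathcal M)\le L_se^{-\beta_s\min\{x,2L_\varepsilon-x\}}$ and $\|\phi_{p,\varepsilon}(x)-(u_s(\varepsilon x),p_s(\varepsilon x),0,0)\|\le L_s\max\{\varepsilon,e^{-\beta_s\min\{x,2L_\varepsilon-x\}}\}$, where $\mathcal M=\{(u,p,0,0):u\in U,p\in\mathbb R^m\}$. Write $u_{p,\varepsilon},v_{p,\varepsilon}$ for the $u$- and $v$-components of $\phi_{p,\varepsilon}$. Constants $\beta_f,\rho$. Let $\phi_h(x)=(u_0,p_0+\int_0^xH_2(u_0,v_h(z))dz,v_h(x),q_h(x))$. There exist $\beta_f,\rho>0$ such that $\|\phi_{p,\varepsilon}(x)-\phi_h(x)\|=O(\varepsilon^{\beta_f})$ for $x\in[-\varepsilon^{-\rho},\varepsilon^{-\rho}]$; $\beta_f$ and $\rho$ denote these constants. Linear stability problem. $\mathcal L_\varepsilon:C^2_{ub}(\mathbb R,\mathbb R^{m+n})\subset C_{ub}(\mathbb R,\mathbb R^{m+n})\to C_{ub}(\mathbb R,\mathbb R^{m+n})$ ($C^k_{ub}$: derivatives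 up to order $k$ bounded and uniformly continuous) is the linearization of the reaction-diffusion system about $(u_{p,\varepsilon}(\varepsilon^{-1}\check x),v_{p,\varepsilon}(\varepsilon^{-1}\check x))$. Its eigenvalue problem in the variable $x$ reads $$\partial_x\phi=\begin{pmatrix}\sqrt\varepsilon\mathcal A_{11,\varepsilon}(x,\lambda)&\sqrt\varepsilon\mathcal A_{12,\varepsilon}(x)\\ \mathcal A_{21,\varepsilon}(x)&\mathcal A_{22,\varepsilon}(x,\lambda)\end{pmatrix}\phi,\quad\phi=(u,p,v,q)\in\mathbb C^{2(m+n)},$$ with $\mathcal A_{11,\varepsilon}=\begin{pmatrix}0&D_1^{-1}\\ \varepsilon(\partial_uH_1+\lambda)+\partial_uH_2&0\end{pmatrix}$, $\mathcal A_{12,\varepsilon}=\begin{pmatrix}0&0\\ \varepsilon\partial_vH_1+\partial_vH_2&0\end{pmatrix}$, $\mathcal A_{21,\varepsilon}=\begin{pmatrix}0&0\\ \partial_uG&0\end{pmatrix}$, $\mathcal A_{22,\varepsilon}=\begin{pmatrix}0&D_2^{-1}\\ \partial_vG+\lambda&0\end{pmatrix}$, all derivatives evaluated at $(u_{p,\varepsilon}(x),v_{p,\varepsilon}(x),\varepsilon)$ (resp. $(u_{p,\varepsilon}(x),v_{p,\varepsilon}(x))$ for $H_2$). With $\mathcal T_\varepsilon(x,y,\lambda)$ its evolution operator, the Evans function is $\mathcal E_\varepsilon(\lambda,\gamma)=\det(\mathcal T_\varepsilon(0,-L_\varepsilon,\lambda)-\gamma\mathcal T_\varepsilon(0,L_\varepsilon,\lambda))$.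 Sector. There are $\varepsilon$-independent constants $\omega>0$, $\varpi\in(\pi/2,\pi)$ such that for $\varepsilon$ small $\{\lambda\neq\omega:|\arg(\lambda-\omega)|\le\varpi\}\cup\{\omega\}$ lies in the resolvent set of $\mathcal L_\varepsilon$; fix these. For $\Lambda<0$ put $\Sigma_{\Lambda,0}=\{\lambda\in\mathbb C:\mathrm{Re}\,\lambda\in(\Lambda,\omega),\ |\arg(\omega-\lambda)|<\pi-\varpi\}$. Fast limit problems. $\mathcal C_\Lambda=\{\lambda\in\mathbb C:\mathrm{Re}\,\lambda>\Lambda\}$. There is an $\varepsilon$-independent compact $\mathcal K\subset U\times\mathbb R^m\times V\times\mathbb R^n$ containing all $\phi_{p,\varepsilon}(x)$, whose projection $\mathcal K_U$ onto the $u$-component contains $u_0$. $\Lambda_0>0$ is a constant such that for all $\Lambda\in(-\Lambda_0,0)$ the spectrum of $\begin{pmatrix}0&D_2^{-1}\\ \partial_vG(u,0,0)+\lambda&0\end{pmatrix}$ is uniformly bounded away from the imaginary axis for $(u,\lambda)\in\mathcal K_U\times\mathcal C_\Lambda$. Let $\mathcal A_{22,0}(x,\lambda)=\begin{pmatrix}0&D_2^{-1}\\ \partial_vG(u_0,v_h(x),0)+\lambda&0\end{pmatrix}$, $\mathcal A_{21,0}(x)=\begin{pmatrix}0&0\\ \partial_uG(u_0,v_h(x),0)&0\end{pmatrix}$. For $\lambda\in\mathcal C_\Lambda$ choose analytic $2n\times n$ matrices $B^s(\lambda),B^u(\lambda)$ whose columns are bases of the ($n$-dimensional) spaces of values at $x=0$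 of solutions to $\partial_x\phi=\mathcal A_{22,0}(x,\lambda)\phi$ bounded on $[0,\infty)$, resp. $(-\infty,0]$; $\mathcal E_{f,0}(\lambda)=\det(B^u(\lambda),B^s(\lambda))$, with zero set $\mathcal N(\mathcal E_{f,0})\subset\mathcal C_\Lambda$. For $\lambda\in\mathcal C_\Lambda\setminus\mathcal N(\mathcal E_{f,0})$, $\mathcal X_{in}(x,\lambda)\in\mathrm{Mat}_{2n\times2m}(\mathbb C)$ is the unique bounded solution on $\mathbb R$ of $\partial_x\mathcal X=\mathcal A_{22,0}(x,\lambda)\mathcal X+\mathcal A_{21,0}(x)$. For $\delta>0$, $\Sigma_{\Lambda,\delta}=\Sigma_{\Lambda,0}\setminus\bigcup_{\lambda\in\mathcal N(\mathcal E_{f,0})}B(\lambda,\delta)$, where $B(\lambda,\delta)$ is the disc of radius $\delta$ about $\lambda$.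
   Formalization: In Σ_{Λ,δ} discs of radius δ are also removed around zeros of E_{f,0} lying exactly on Re λ = Λ, where X_in may have a pole and items 1 and 3 would conflict; β_f, ρ are some constants with the stated approximation property. *)

(* Defs.v *)
From HB Require Import structures.
From mathcomp Require Import all_boot all_order all_algebra.
From mathcomp Require Import all_classical all_reals all_analysis.
From mathcomp Require Export complex.
Set Implicit Arguments.
Unset Strict Implicit.
Unset Printing Implicit Defensive.
Import Order.TTheory GRing.Theory Num.Theory.
Import numFieldNormedType.Exports.
Local Open Scope classical_set_scope.
Local Open Scope complex_scope.
Local Open Scope ring_scope.

Local Notation Re := complex.Re.
Local Notation Im := complex.Im.

(* Differentiability class C^k on an open set of a finite-dimensional space:
   all iterated directional derivatives up to order k exist and are
   continuous. *)
Fixpoint Ck_on (R : realType) (E F : normedModType R) (k : nat) (O : set E)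
    (f : E -> F) : Prop :=
  if k is k'.+1 then
    (forall x, O x -> differentiable f x) /\
    (forall v, Ck_on k' O (fun x => 'D_v f x))
  else forall x, O x -> {for x, continuous f}.

(* Jacobian acting on column vectors (the library's [jacobian] acts on rows). *)
Definition jac (R : realType) (p q : nat) (f : 'cV[R]_q -> 'cV[R]_p)
    (x : 'cV[R]_q) : 'M[R]_(p, q) :=
  \matrix_(i < p, j < q) ('D_(delta_mx j 0) f x) i 0.

Definition posdef (R : realType) (n : nat) (A : 'M[R]_n) : Prop :=
  A^T = A /\ forall w : 'cV[R]_n, w != 0 -> 0 < (w^T *m A *m w) 0 0.

Definition diag_pos (R : realType) (n : nat) (D : 'M[R]_n) : Prop :=
  is_diag_mx D /\ forall i, 0 < D i i.

(* The oriented integral from 0 to x. *)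
Definition int0 (R : realType) (f : R -> R) (x : R) : R :=
  Rintegral (@lebesgue_measure R) `[0, x] f
  - Rintegral (@lebesgue_measure R) `[x, 0] f.

Definition cmx (R : realType) (p q : nat) (A : 'M[R]_(p, q)) : 'M[R[i]]_(p, q) :=
  map_mx (real_complex R) A.

(* R[i] carries no normed module structure over R, hence derivatives with
   respect to a real variable are taken on real and imaginary parts. *)
Definition cderivable (R : realType) (p q : nat) (X : R -> 'M[R[i]]_(p, q))
    (x : R) : Prop :=
  forall i j, derivable (fun t => Re (X t i j)) x 1 /\
              derivable (fun t => Im (X t i j)) x 1.

Definition cderive (R : realType) (p q : nat) (X : R -> 'M[R[i]]_(p, q))
    (x : R) : 'M[R[i]]_(p, q) :=
  \matrix_(i < p, j < q) (derive1 (fun t => Re (X t i j)) x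
                          +i* derive1 (fun t => Im (X t i j)) x).

Definition lin_ode (R : realType) (p q : nat) (A : R -> 'M[R[i]]_p)
    (B X : R -> 'M[R[i]]_(p, q)) : Prop :=
  forall x, cderivable X x /\ cderive X x = A x *m X x + B x.

Definition is_evolution (R : realType) (p : nat) (A : R -> 'M[R[i]]_p)
    (T : R -> R -> 'M[R[i]]_p) : Prop :=
  forall y, T y y = 1%:M /\ lin_ode A (fun=> 0) (fun x => T x y).

(* The norm of a complex matrix is valued in R[i], as a nonnegative real. *)
Definition cbounded_on (R : realType) (p q : nat) (J : set R)
    (X : R -> 'M[R[i]]_(p, q)) : Prop :=
  exists M : R, forall x, J x -> `|X x| <= M%:C.

Definition evans (R : realType) (p : nat) (T : R -> R -> 'M[R[i]]_p) (L : R)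
    (g : R[i]) : R[i] :=
  \det (T 0 (- L) - g *: T 0 L).

Definition Cub (R : realType) (p : nat) (f : R -> 'cV[R[i]]_p) : Prop :=
  cbounded_on setT f /\
  forall i, unif_continuous (fun x : R => Re (f x i 0)) /\
            unif_continuous (fun x : R => Im (f x i 0)).

Definition C2ub (R : realType) (p : nat) (f : R -> 'cV[R[i]]_p) : Prop :=
  [/\ Cub f,
      (forall x, cderivable f x) /\ Cub (cderive f) &
      (forall x, cderivable (cderive f) x) /\ Cub (cderive (cderive f))].

(* Resolvent set of an unbounded operator L : D c X -> X, where X is a space of
   bounded functions with the supremum norm. *)
Definition resolvent_set (R : realType) (p : nat)
    (D X : set (R -> 'cV[R[i]]_p))
    (L : (R -> 'cV[R[i]]_p) -> (R -> 'cV[R[i]]_p)) : set R[i] :=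
  [set lam |
    (forall g, X g -> exists! f, D f /\ forall x, L f x - lam *: f x = g x) /\
    exists C : R, forall f, D f -> forall M : R,
      (forall x, `|L f x - lam *: f x| <= M%:C) ->
      forall x, `|f x| <= (C * M)%:C].

(* Principal argument, in ]-pi, pi], of a nonzero complex number. *)
Definition carg (R : realType) (z : R[i]) : R :=
  let a := acos (Re z / Normc.normc z) in if 0 <= Im z then a else - a.

Record rd_system (R : realType) (m n : nat) := RdSystem {
  D1 : 'M[R]_m;
  D2 : 'M[R]_n;
  H1 : 'cV[R]_m -> 'cV[R]_n -> R -> 'cV[R]_m;
  H2 : 'cV[R]_m -> 'cV[R]_n -> 'cV[R]_m;
  G : 'cV[R]_m -> 'cV[R]_n -> R -> 'cV[R]_n }.

Definition duH1 R m n (S : @rd_system R m n) u v e := jac (fun w => H1 S w v e) u.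
Definition dvH1 R m n (S : @rd_system R m n) u v e := jac (fun w => H1 S u w e) v.
Definition duH2 R m n (S : @rd_system R m n) u v := jac (fun w => H2 S w v) u.
Definition dvH2 R m n (S : @rd_system R m n) u v := jac (fun w => H2 S u w) v.
Definition duG R m n (S : @rd_system R m n) u v e := jac (fun w => G S w v e) u.
Definition dvG R m n (S : @rd_system R m n) u v e := jac (fun w => G S u w e) v.

Definition state (R : realType) (m n : nat) : Type :=
  ('cV[R]_m * 'cV[R]_m * 'cV[R]_n * 'cV[R]_n)%type.

Notation uof z := (z.1.1.1).
Notation pof z := (z.1.1.2).
Notation vof z := (z.1.2).
Notation qof z := (z.2).

Record assumption_S1 (R : realType) (m n : nat) (S : rd_system R m n)
    (U : set 'cV[R]_m) (V : set 'cV[R]_n) (I : set R) : Prop := {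
  S1_U : open U /\ connected U;
  S1_V : open V /\ connected V;
  S1_I : open I /\ connected I;
  S1_0V : V 0;
  S1_0I : I 0;
  S1_H1 : Ck_on 2 (U `*` V `*` I)
            (fun z : 'cV[R]_m * 'cV[R]_n * R => H1 S z.1.1 z.1.2 z.2);
  S1_G : Ck_on 2 (U `*` V `*` I)
            (fun z : 'cV[R]_m * 'cV[R]_n * R => G S z.1.1 z.1.2 z.2);
  S1_H2 : Ck_on 2 (U `*` V) (fun z : 'cV[R]_m * 'cV[R]_n => H2 S z.1 z.2);
  S1_H20 : forall u, U u -> H2 S u 0 = 0;
  S1_G0 : forall u e, U u -> I e -> G S u 0 e = 0 }.

Definition assumption_S2 (R : realType) (m n : nat) (S : rd_system R m n)
    (U : set 'cV[R]_m) : Prop :=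
  forall u, U u -> posdef (2^-1 *: (dvG S u 0 0 + (dvG S u 0 0)^T)).

Definition pulse_ode (R : realType) (m n : nat) (S : rd_system R m n) (e : R)
    (f : R -> state R m n) : Prop :=
  forall x,
  [/\ derivable (fun t => uof (f t)) x 1 /\
        D1 S *m derive1 (fun t => uof (f t)) x = e *: pof (f x),
      derivable (fun t => pof (f t)) x 1 /\
        derive1 (fun t => pof (f t)) x
        = e *: H1 S (uof (f x)) (vof (f x)) e + H2 S (uof (f x)) (vof (f x)),
      derivable (fun t => vof (f t)) x 1 /\
        D2 S *m derive1 (fun t => vof (f t)) x = qof (f x) &
      derivable (fun t => qof (f t)) x 1 /\
        derive1 (fun t => qof (f t)) x = G S (uof (f x)) (vof (f x)) e].

Definition homoclinic (R : realType) (m n : nat) (S : rd_system R m n)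
    (V : set 'cV[R]_n) (u0 : 'cV[R]_m) (vh qh : R -> 'cV[R]_n) : Prop :=
  [/\ forall x,
        [/\ V (vh x),
            derivable vh x 1 /\ D2 S *m derive1 vh x = qh x &
            derivable qh x 1 /\ derive1 qh x = G S u0 (vh x) 0],
      vh x @[x --> +oo] --> (0 : 'cV[R]_n) /\
        qh x @[x --> +oo] --> (0 : 'cV[R]_n),
      vh x @[x --> -oo] --> (0 : 'cV[R]_n) /\
        qh x @[x --> -oo] --> (0 : 'cV[R]_n) &
      exists x, (vh x, qh x) <> (0, 0)].

Definition slow_ode (R : realType) (m n : nat) (S : rd_system R m n)
    (U : set 'cV[R]_m) (J : set R) (us ps : R -> 'cV[R]_m) : Prop :=
  forall x, J x ->
  [/\ U (us x),
      derivable us x 1 /\ D1 S *m derive1 us x = ps x &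
      derivable ps x 1 /\ derive1 ps x = H1 S (us x) 0 0].

Definition slow_manifold (R : realType) (m n : nat) (U : set 'cV[R]_m)
    : set (state R m n) :=
  [set z | [/\ U (uof z), vof z = 0 & qof z = 0]].

Definition dist (R : realType) (W : normedModType R) (z : W) (A : set W) : R :=
  inf [set `|z - y| | y in A].

(* Half the period, in the stretched variable x. *)
Definition Leps (R : realType) (Lc : R -> R) (e : R) : R := e^-1 * Lc e.

(* The slow solution is only constrained on an interval ]a, b[ containing
   [0, 2 L0]; since Lc e --> L0 it covers e x for 0 <= x <= 2 Leps Lc e. *)
Record assumption_S3 (R : realType) (m n : nat) (S : rd_system R m n)
    (U : set 'cV[R]_m) (V : set 'cV[R]_n) (phi : R -> R -> state R m n)
    (Lc : R -> R) (L0 : R) (u0 p0 : 'cV[R]_m) (vh qh : R -> 'cV[R]_n)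
    : Prop := {
  S3_sol : \forall e \near 0^'+,
    [/\ pulse_ode S e (phi e),
        forall x, phi e (x + 2 * Leps Lc e) = phi e x &
        forall x, U (uof (phi e x)) /\ V (vof (phi e x))];
  S3_L0 : 0 < L0;
  S3_Lc : Lc e @[e --> 0^'+] --> L0;
  S3_u0 : U u0;
  S3_hom : homoclinic S V u0 vh qh;
  S3_pulse : exists C : R, \forall e \near 0^'+,
    `|phi e 0 - ((u0, p0, vh 0, qh 0) : state R m n)| <= C * e;
  S3_slow : exists (Ls bs a b : R) (us ps : R -> 'cV[R]_m),
    [/\ 0 < Ls, 0 < bs, a < 0 /\ 2 * L0 < b, slow_ode S U `]a, b[ us ps &
        \forall e \near 0^'+, forall x, 0 <= x <= 2 * Leps Lc e ->
          let E := expR (- bs * Num.min x (2 * Leps Lc e - x)) in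
          dist (phi e x) (@slow_manifold R m n U) <= Ls * E /\
          `|phi e x - ((us (e * x), ps (e * x), 0, 0) : state R m n)|
            <= Ls * Num.max e E] }.

Definition phi_h (R : realType) (m n : nat) (S : rd_system R m n)
    (u0 p0 : 'cV[R]_m) (vh qh : R -> 'cV[R]_n) (x : R) : state R m n :=
  (u0, p0 + \col_(i < m) int0 (fun z => H2 S u0 (vh z) i 0) x, vh x, qh x).

Definition fast_approximation (R : realType) (m n : nat) (S : rd_system R m n)
    (phi : R -> R -> state R m n) (u0 p0 : 'cV[R]_m) (vh qh : R -> 'cV[R]_n)
    (bf rho : R) : Prop :=
  exists C : R, \forall e \near 0^'+, forall x : R, `|x| <= e `^ (- rho) ->
    `|phi e x - phi_h S u0 p0 vh qh x| <= C * e `^ bf.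

(* The argument y is the unstretched space variable e * x. *)
Definition linearization (R : realType) (m n : nat) (S : rd_system R m n)
    (e : R) (f : R -> state R m n) (w : R -> 'cV[R[i]]_(m + n)) (y : R)
    : 'cV[R[i]]_(m + n) :=
  let u := uof (f (e^-1 * y)) in
  let v := vof (f (e^-1 * y)) in
  cmx (block_mx (D1 S) 0 0 (e ^+ 2 *: D2 S)) *m cderive (cderive w) y
  - cmx (block_mx (duH1 S u v e + e^-1 *: duH2 S u v)
                  (dvH1 S u v e + e^-1 *: dvH2 S u v)
                  (duG S u v e) (dvG S u v e)) *m w y.

Definition A11 (R : realType) (m n : nat) (S : rd_system R m n) (e : R)
    (f : R -> state R m n) (x : R) (lam : R[i]) : 'M[R[i]]_(m + m) :=
  let u := uof (f x) in let v := vof (f x) in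
  block_mx 0 (cmx (invmx (D1 S)))
           (e%:C *: (cmx (duH1 S u v e) + lam%:M) + cmx (duH2 S u v)) 0.

Definition A12 (R : realType) (m n : nat) (S : rd_system R m n) (e : R)
    (f : R -> state R m n) (x : R) : 'M[R[i]]_(m + m, n + n) :=
  let u := uof (f x) in let v := vof (f x) in
  block_mx 0 0 (cmx (e *: dvH1 S u v e + dvH2 S u v)) 0.

Definition fast21 (R : realType) (m n : nat) (S : rd_system R m n)
    (u : 'cV[R]_m) (v : 'cV[R]_n) (e : R) : 'M[R[i]]_(n + n, m + m) :=
  block_mx 0 0 (cmx (duG S u v e)) 0.

Definition fast22 (R : realType) (m n : nat) (S : rd_system R m n)
    (u : 'cV[R]_m) (v : 'cV[R]_n) (e : R) (lam : R[i]) : 'M[R[i]]_(n + n) :=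
  block_mx 0 (cmx (invmx (D2 S))) (cmx (dvG S u v e) + lam%:M) 0.

Definition A21 (R : realType) (m n : nat) (S : rd_system R m n) (e : R)
    (f : R -> state R m n) (x : R) : 'M[R[i]]_(n + n, m + m) :=
  fast21 S (uof (f x)) (vof (f x)) e.

Definition A22 (R : realType) (m n : nat) (S : rd_system R m n) (e : R)
    (f : R -> state R m n) (x : R) (lam : R[i]) : 'M[R[i]]_(n + n) :=
  fast22 S (uof (f x)) (vof (f x)) e lam.

Definition eigenvalue_matrix (R : realType) (m n : nat) (S : rd_system R m n)
    (e : R) (f : R -> state R m n) (lam : R[i]) (x : R)
    : 'M[R[i]]_((m + m) + (n + n)) :=
  block_mx ((Num.sqrt e)%:C *: A11 S e f x lam) ((Num.sqrt e)%:C *: A12 S e f x)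
           (A21 S e f x) (A22 S e f x lam).

Definition A21_0 (R : realType) (m n : nat) (S : rd_system R m n)
    (u0 : 'cV[R]_m) (vh : R -> 'cV[R]_n) (x : R) : 'M[R[i]]_(n + n, m + m) :=
  fast21 S u0 (vh x) 0.

Definition A22_0 (R : realType) (m n : nat) (S : rd_system R m n)
    (u0 : 'cV[R]_m) (vh : R -> 'cV[R]_n) (lam : R[i]) (x : R)
    : 'M[R[i]]_(n + n) :=
  fast22 S u0 (vh x) 0 lam.

Definition half_plane (R : realType) (Lam : R) : set R[i] :=
  [set lam | Lam < Re lam].

Definition sector_in_resolvent (R : realType) (m n : nat)
    (S : rd_system R m n) (phi : R -> R -> state R m n) (om varpi : R) : Prop :=
  [/\ 0 < om, pi / 2 < varpi < pi &
      \forall e \near 0^'+, forall lam : R[i],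
        (lam <> om%:C /\ `|carg (lam - om%:C)| <= varpi) \/ lam = om%:C ->
        resolvent_set (@C2ub R (m + n)) (@Cub R (m + n))
          (linearization S e (phi e)) lam].

Record compact_enclosure (R : realType) (m n : nat) (U : set 'cV[R]_m)
    (V : set 'cV[R]_n) (phi : R -> R -> state R m n) (u0 : 'cV[R]_m)
    (K : set (state R m n)) : Prop := {
  K_compact : compact K;
  K_sub : forall z, K z -> U (uof z) /\ V (vof z);
  K_phi : \forall e \near 0^'+, forall x, K (phi e x);
  K_u0 : exists2 z, K z & uof z = u0 }.

Definition uniformly_hyperbolic (R : realType) (m n : nat)
    (S : rd_system R m n) (K : set (state R m n)) (Lam0 : R) : Prop :=
  forall Lam, - Lam0 < Lam < 0 -> exists2 mu : R, 0 < mu &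
    forall z lam nu, K z -> half_plane Lam lam ->
      eigenvalue (fast22 S (uof z) 0 0 lam) nu -> mu <= `|Re nu|.

Definition bounded_values (R : realType) (p : nat) (A : R -> 'M[R[i]]_p)
    (J : set R) : set 'cV[R[i]]_p :=
  [set w | exists f : R -> 'cV[R[i]]_p,
     [/\ lin_ode A (fun=> 0) f, f 0 = w & cbounded_on J f]].

Definition column_basis (R : realType) (p q : nat) (B : 'M[R[i]]_(p, q))
    (W : set 'cV[R[i]]_p) : Prop :=
  \rank B = q /\ forall w, W w <-> exists c : 'cV[R[i]]_q, w = B *m c.

Definition analytic_mx (R : realType) (p q : nat) (O : set R[i])
    (B : R[i] -> 'M[R[i]]_(p, q)) : Prop :=
  forall i j lam, O lam -> derivable ((fun z => B z i j) : (R[i])^o -> (R[i])^o) lam 1.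

Record fast_bases (R : realType) (m n : nat) (S : rd_system R m n)
    (u0 : 'cV[R]_m) (vh : R -> 'cV[R]_n) (O : set R[i])
    (Bu Bs : R[i] -> 'M[R[i]]_(n + n, n)) : Prop := {
  Bu_analytic : analytic_mx O Bu;
  Bs_analytic : analytic_mx O Bs;
  Bu_basis : forall lam, O lam ->
    column_basis (Bu lam) (bounded_values (A22_0 S u0 vh lam) [set x | x <= 0]);
  Bs_basis : forall lam, O lam ->
    column_basis (Bs lam) (bounded_values (A22_0 S u0 vh lam) [set x | 0 <= x]) }.

Definition Ef0 (R : realType) (n : nat) (Bu Bs : R[i] -> 'M[R[i]]_(n + n, n))
    (lam : R[i]) : R[i] :=
  \det (row_mx (Bu lam) (Bs lam)).

Definition inhom_solution (R : realType) (m n : nat) (S : rd_system R m n)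
    (u0 : 'cV[R]_m) (vh : R -> 'cV[R]_n) (lam : R[i])
    : set (R -> 'M[R[i]]_(n + n, m + m)) :=
  [set X | lin_ode (A22_0 S u0 vh lam) (A21_0 S u0 vh) X /\
           cbounded_on setT X].

Definition Sigma0 (R : realType) (om varpi Lam : R) : set R[i] :=
  [set lam | Lam < Re lam < om /\ `|carg (om%:C - lam)| < pi - varpi].

(* The zeros are taken in the closed half-plane Re mu >= Lam. A zero on the line
   Re mu = Lam lies outside half_plane Lam, but the bounded solution of the
   inhomogeneous fast problem may have a pole there, so that no bound uniform in
   lam can hold unless a neighbourhood of it is removed as well. *)
Definition Sigmad (R : realType) (n : nat) (om varpi : R)
    (Bu Bs : R[i] -> 'M[R[i]]_(n + n, n)) (Lam delta : R) : set R[i] :=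
  [set lam | Sigma0 om varpi Lam lam /\
     forall mu : R[i], Lam <= Re mu -> Ef0 Bu Bs mu = 0 ->
       ~ (Normc.normc (lam - mu) < delta)].

(* Main.v *)
(* The graph of U is invariant under the eigenvalue problem iff U solves the
   Riccati equation U' = A22 U + A21 - sqrt e (U A11 + U A12 U). A periodic U
   makes the evolution block triangular, and U(-L) = U(L) cancels from the Evans
   determinant. For small e such a U is the limit of an iteration based on the
   estimate sup |w| <= C sup |w' - A22 w| for bounded w. Compactness makes this
   estimate uniform in e and lambda: a sequence of counterexamples, normalized and
   translated to its maximum, converges along an ultrafilter to a nonzero bounded
   solution either of w' = A22_0 w, which uniqueness of Xin excludes away from
   the zeros of Ef0, or of an equation with a constant hyperbolic matrix.
   The weight 1 / cosh (kappa (x - x0)) localizes the estimate. Applied to U, it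
   gives exponential decay, inherited from A21, hence property 4; applied to
   U - Xin, whose defect is O(e^bf) for |x| <= e^(-rho), it gives property 3. *)
Require Import Defs.
From HB Require Import structures.
From mathcomp Require Import all_boot all_order all_algebra.
From mathcomp Require Import all_classical all_reals all_analysis.
From mathcomp Require Import complex ring lra.
Set Implicit Arguments.
Unset Strict Implicit.
Unset Printing Implicit Defensive.
Import Order.TTheory GRing.Theory Num.Theory.
Import numFieldNormedType.Exports.
Local Open Scope classical_set_scope.
Local Open Scope complex_scope.
Local Open Scope ring_scope.

(** No exponential dichotomy is constructed; the estimate for bounded functions does its work. For a
    zero right-hand side it makes the identity minus the monodromy matrix injective, so every linear
    step of the iteration has a periodic solution, bounded with the same constant. Uniformity has to
    reach the boundary of the spectral region, because limits of parameters need not stay inside;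
    there one still has Re lambda >= Lambda > -Lambda_0, and no zero of [Ef0] is met. The constants
    [bf] and [rho] come from two competing bounds on the error in v and q: Gronwall gives e exp (c
    |x|), decay gives exp (-b |x|), and up to a constant the smaller one is at most e^th with th = b
    / (b + c). A difficulty in property 3 is that U is periodic while Xin is not, although the
    localized estimate needs their difference on the whole line. Far from 0 the two are not compared
    with each other: each is exponentially small up to the growth of the weight, which beats every
    power of e. *)

Local Notation Re := complex.Re.
Local Notation Im := complex.Im.

(** * Norm of complex matrices *)

Section ComplexMatrixNorm.
Variable R : realType.
Implicit Types (z w : R[i]).

Lemma Re_add z w : Re (z + w) = Re z + Re w. Proof. by case: z; case: w. Qed.
Lemma Im_add z w : Im (z + w) = Im z + Im w. Proof. by case: z; case: w. Qed.
Lemma Re_opp z : Re (- z) = - Re z. Proof. by case: z. Qed.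
Lemma Im_opp z : Im (- z) = - Im z. Proof. by case: z. Qed.
Lemma Re_mul z w : Re (z * w) = Re z * Re w - Im z * Im w.
Proof. by case: z; case: w. Qed.
Lemma Im_mul z w : Im (z * w) = Re z * Im w + Im z * Re w.
Proof. by case: z => a b; case: w => c d /=; rewrite addrC. Qed.
Lemma Re_sum (I : Type) (r : seq I) (P : pred I) (F : I -> R[i]) :
  Re (\sum_(i <- r | P i) F i) = \sum_(i <- r | P i) Re (F i).
Proof. by elim/big_rec2: _ => [//|i x y _ <-]; rewrite Re_add. Qed.
Lemma Im_sum (I : Type) (r : seq I) (P : pred I) (F : I -> R[i]) :
  Im (\sum_(i <- r | P i) F i) = \sum_(i <- r | P i) Im (F i).
Proof. by elim/big_rec2: _ => [//|i x y _ <-]; rewrite Im_add. Qed.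
Lemma complex_ext z w : Re z = Re w -> Im z = Im w -> z = w.
Proof. by case: z; case: w => a b c d /= -> ->. Qed.

(* The l^1 norm over all real and imaginary parts is submultiplicative and
   takes values in R, unlike the library norm. *)
Definition cn z : R := `|Re z| + `|Im z|.

Lemma cn_ge0 z : 0 <= cn z. Proof. by rewrite addr_ge0. Qed.
Lemma cn0 : cn 0 = 0. Proof. by rewrite /cn /= normr0 addr0. Qed.
Lemma cnN z : cn (- z) = cn z.
Proof. by rewrite /cn Re_opp Im_opp !normrN. Qed.
Lemma cnD z w : cn (z + w) <= cn z + cn w.
Proof.
rewrite /cn Re_add Im_add.
have := ler_normD (Re z) (Re w); have := ler_normD (Im z) (Im w); lra.
Qed.
Lemma cnM z w : cn (z * w) <= cn z * cn w.
Proof.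
rewrite /cn Re_mul Im_mul mulrDl !mulrDr -!normrM.
have := ler_normB (Re z * Re w) (Im z * Im w).
have := ler_normD (Re z * Im w) (Im z * Re w); lra.
Qed.
Lemma cnR (x : R) : cn x%:C = `|x|.
Proof. by rewrite /cn /= normr0 addr0. Qed.
Lemma cn_eq0 z : cn z = 0 -> z = 0.
Proof.
move=> z0; have := normr_ge0 (Re z); have := normr_ge0 (Im z).
move: z0; rewrite /cn => z0 h1 h2.
have h3 : `|Re z| = 0 by lra.
have h4 : `|Im z| = 0 by lra.
by apply: complex_ext; apply/eqP; rewrite -normr_eq0 ?h3 ?h4.
Qed.
Lemma Re_le_cn z : `|Re z| <= cn z. Proof. by rewrite /cn lerDl. Qed.
Lemma Im_le_cn z : `|Im z| <= cn z. Proof. by rewrite /cn lerDr. Qed.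

Lemma normc_le_cn z : Normc.normc z <= cn z.
Proof.
case: z => a b; rewrite /cn /=.
have h : 0 <= `|a| + `|b| by rewrite addr_ge0.
rewrite -(ger0_norm h) -sqrtr_sqr ler_wsqrtr //.
rewrite sqrrD !real_normK ?num_real //.
have : 0 <= `|a| * `|b| by rewrite mulr_ge0.
by rewrite mulr2n; lra.
Qed.

Lemma cn_le_normc z : cn z <= 2 * Normc.normc z.
Proof.
case: z => a b; rewrite /cn /=.
have hl (x y : R) : `|x| <= Num.sqrt (x ^+ 2 + y ^+ 2).
  by rewrite -sqrtr_sqr ler_wsqrtr // lerDl sqr_ge0.
have := hl a b; have := hl b a; rewrite [b ^+ 2 + _]addrC; lra.
Qed.

Definition nm p q (X : 'M[R[i]]_(p, q)) : R := \sum_i \sum_j cn (X i j).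

Lemma nm_ge0 p q (X : 'M[R[i]]_(p, q)) : 0 <= nm X.
Proof. by do 2!(apply: sumr_ge0 => ? _); exact: cn_ge0. Qed.
Lemma nm0 p q : nm (0 : 'M[R[i]]_(p, q)) = 0.
Proof. by rewrite /nm big1 // => i _; rewrite big1 // => j _; rewrite mxE cn0. Qed.
Lemma nmN p q (X : 'M[R[i]]_(p, q)) : nm (- X) = nm X.
Proof. by do 2!(apply: eq_bigr => ? _); rewrite mxE cnN. Qed.
Lemma nmD p q (X Y : 'M[R[i]]_(p, q)) : nm (X + Y) <= nm X + nm Y.
Proof.
rewrite /nm -big_split /=; apply: ler_sum => i _.
by rewrite -big_split /=; apply: ler_sum => j _; rewrite mxE cnD.
Qed.
Lemma nmB p q (X Y : 'M[R[i]]_(p, q)) : nm (X - Y) <= nm X + nm Y.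
Proof. by rewrite -(nmN Y) nmD. Qed.
Lemma nmBC p q (X Y : 'M[R[i]]_(p, q)) : nm (X - Y) = nm (Y - X).
Proof. by rewrite -nmN opprB. Qed.
Lemma nm_tri p q (Y X Z : 'M[R[i]]_(p, q)) : nm (X - Z) <= nm (X - Y) + nm (Y - Z).
Proof. by apply: le_trans (nmD _ _); rewrite addrA subrK. Qed.
Lemma nm_entry p q (X : 'M[R[i]]_(p, q)) i j : cn (X i j) <= nm X.
Proof.
rewrite /nm (bigD1 i) //= (bigD1 j) //= -addrA lerDl addr_ge0 //.
  by apply: sumr_ge0 => ? _; exact: cn_ge0.
by do 2!(apply: sumr_ge0 => ? _); exact: cn_ge0.
Qed.
Lemma nm_eq0 p q (X : 'M[R[i]]_(p, q)) : nm X = 0 -> X = 0.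
Proof.
move=> X0; apply/matrixP => i j; rewrite mxE; apply: cn_eq0.
by apply/eqP; rewrite eq_le cn_ge0 andbT -X0 nm_entry.
Qed.
Lemma nmM p q r (X : 'M[R[i]]_(p, q)) (Y : 'M[R[i]]_(q, r)) : nm (X *m Y) <= nm X * nm Y.
Proof.
have cns (I : finType) (F : I -> R[i]) : cn (\sum_i F i) <= \sum_i cn (F i).
  elim/big_rec2: _ => [|i x y _ h]; first by rewrite cn0.
  by apply: le_trans (cnD _ _) _; rewrite lerD2l.
rewrite {1 2}/nm mulr_suml; apply: ler_sum => i _.
rewrite mulr_suml.
apply: (@le_trans _ _ (\sum_j \sum_k cn (X i k) * cn (Y k j))).
  apply: ler_sum => j _; rewrite mxE; apply: le_trans (cns _ _) _.
  by apply: ler_sum => k _; exact: cnM.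
rewrite exchange_big /=; apply: ler_sum => k _.
rewrite -mulr_sumr ler_wpM2l ?cn_ge0 //.
rewrite /nm (bigD1 k) //= lerDl; do 2!(apply: sumr_ge0 => ? _); exact: cn_ge0.
Qed.
Lemma cnZR z (c : R) : cn (c%:C * z) = `|c| * cn z.
Proof. by case: z => a b; rewrite /cn Re_mul Im_mul /= !mul0r subr0 addr0 !normrM mulrDr. Qed.
Lemma nmZR p q (c : R) (X : 'M[R[i]]_(p, q)) : nm (c%:C *: X) = `|c| * nm X.
Proof.
rewrite /nm mulr_sumr; apply: eq_bigr => i _; rewrite mulr_sumr.
by apply: eq_bigr => j _; rewrite mxE cnZR.
Qed.
Lemma nm_block p1 p2 q1 q2 (A : 'M[R[i]]_(p1, q1)) (B : 'M[R[i]]_(p1, q2))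
    (C : 'M[R[i]]_(p2, q1)) (D : 'M[R[i]]_(p2, q2)) :
  nm (block_mx A B C D) = nm A + nm B + (nm C + nm D).
Proof.
rewrite /nm big_split_ord /= -!big_split /=.
by congr (_ + _); apply: eq_bigr => i _; rewrite big_split_ord /=;
  congr (_ + _); apply: eq_bigr => j _;
  rewrite ?block_mxEul ?block_mxEur ?block_mxEdl ?block_mxEdr.
Qed.
Lemma nm_cmx p q (A : 'M[R]_(p, q)) : nm (cmx A) = \sum_i \sum_j `|A i j|.
Proof. by do 2!(apply: eq_bigr => ? _); rewrite mxE cnR. Qed.

(** Together with [nm_le_normc] this is the interface to the norm of the theorem; all estimates in
    between use [nm]. The converse costs the number of entries and a factor 2 per entry. *)
Lemma normc_mx_le p q (X : 'M[R[i]]_(p, q)) : `|X| <= (nm X)%:C.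
Proof.
rewrite /Num.norm /= mx_normE.
have -> : (nm X)%:C = (NngNum (etrans (lecR 0 (nm X)) (nm_ge0 X)) : {nonneg R[i]})%:num by [].
rewrite num_le; apply/bigmax_leP; split => [|[i j] _] /=.
  by rewrite -num_le /= lecR nm_ge0.
rewrite -num_le /= normc_def lecR.
have := normc_le_cn (X i j); case: (X i j) (nm_entry X i j) => a b /= h1 h2.
exact: le_trans h2 h1.
Qed.

Lemma nm_le_normc p q (X : 'M[R[i]]_(p, q)) (M : R) :
  `|X| <= M%:C -> nm X <= p%:R * q%:R * 2 * M.
Proof.
move=> XM.
have h i j : cn (X i j) <= 2 * M.
  apply: le_trans (cn_le_normc _) _; rewrite ler_pM2l //.
  rewrite -lecR; apply: le_trans XM.
  rewrite /Num.norm /= mx_normE.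
  have -> : (Normc.normc (X i j))%:C = (`|X i j|%:nng)%:num :> R[i].
    by rewrite /= normc_def; case: (X i j).
  by rewrite num_le; exact: (le_bigmax _ (fun ij : 'I_p * 'I_q => `|X ij.1 ij.2|%:nng) (i, j)).
apply: (@le_trans _ _ (\sum_(i < p) \sum_(j < q) (2 * M))).
  by do 2!(apply: ler_sum => ? _); exact: h.
by rewrite !sumr_const !card_ord -[_ *+ q]mulr_natl -[_ *+ p]mulr_natl !mulrA.
Qed.

End ComplexMatrixNorm.

(** * Calculus *)

Section RealCalculus.
Variable R : realType.

Lemma der_cst (c x : R) : is_derive x 1 (fun _ : R => c) 0.
Proof. exact: is_derive_cst. Qed.
Lemma der_id (x : R) : is_derive x 1 (fun t : R => t) 1.
Proof. exact: is_derive_id. Qed.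
Lemma der_eq (f : R -> R) (x a b : R) :
  is_derive x 1 f a -> a = b -> is_derive x 1 f b.
Proof. by move=> ? <-. Qed.
Lemma derD (f g : R -> R) (x a b : R) : is_derive x 1 f a -> is_derive x 1 g b ->
  is_derive x 1 (fun t => f t + g t) (a + b).
Proof. by move=> hf hg; exact: is_deriveD. Qed.
Lemma derN (f : R -> R) (x a : R) : is_derive x 1 f a ->
  is_derive x 1 (fun t => - f t) (- a).
Proof. by move=> hf; exact: is_deriveN. Qed.
Lemma derB (f g : R -> R) (x a b : R) : is_derive x 1 f a -> is_derive x 1 g b ->
  is_derive x 1 (fun t => f t - g t) (a - b).
Proof. by move=> hf hg; exact: is_deriveB. Qed.
Lemma derM (f g : R -> R) (x a b : R) : is_derive x 1 f a -> is_derive x 1 g b ->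
  is_derive x 1 (fun t => f t * g t) (a * g x + f x * b).
Proof.
move=> hf hg; apply: is_derive_eq (is_deriveM hf hg) _.
by rewrite addrC /GRing.scale /= mulrC.
Qed.
Lemma derZ (f : R -> R) (k x a : R) : is_derive x 1 f a ->
  is_derive x 1 (fun t => k * f t) (k * a).
Proof.
by move=> h; apply: der_eq (derM (der_cst k x) h) _; rewrite mul0r add0r.
Qed.
Lemma der_sum (J : Type) (r : seq J) (f : J -> R -> R) (x : R) (a : J -> R) :
  (forall j, is_derive x 1 (f j) (a j)) ->
  is_derive x 1 (fun t => \sum_(j <- r) f j t) (\sum_(j <- r) a j).
Proof.
move=> h; elim: r => [|j r IH].
  by under eq_fun do rewrite big_nil; rewrite big_nil; exact: der_cst.
by under eq_fun do rewrite big_cons; rewrite big_cons; exact: derD.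
Qed.

Lemma is_derive_chain (f g : R -> R) (x a b : R) :
  is_derive (g x) 1 f a -> is_derive x 1 g b ->
  is_derive x 1 (fun t => f (g t)) (a * b).
Proof. exact: is_derive1_comp. Qed.

Lemma is_derive_affine (f : R -> R) (c k x d : R) :
  is_derive (k * x + c) 1 f d -> is_derive x 1 (fun t => f (k * t + c)) (k * d).
Proof.
move=> h; rewrite mulrC; apply: is_derive_chain => //.
by apply: der_eq (derD (derZ k (der_id x)) (der_cst c x)) _; rewrite mulr1 addr0.
Qed.

Lemma is_derive_shifted (f : R -> R) (c x d : R) :
  is_derive (x + c) 1 f d -> is_derive x 1 (fun t => f (t + c)) d.
Proof.
move=> h; have := @is_derive_affine f c 1 x d; rewrite !mul1r => /(_ h).
by under eq_fun do rewrite mul1r.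
Qed.

Lemma is_derive_continuous (f : R -> R) (x d : R) :
  is_derive x 1 f d -> {for x, continuous f}.
Proof.
by move=> h; apply/differentiable_continuous/derivable1_diffP; case: h.
Qed.

(** The mean value theorem for g - f. It replaces integrating the inequality between the
    derivatives, so the growth estimates need no integrals. *)
Lemma le_increments (f g df dg : R -> R) (a b : R) : a <= b ->
  (forall x, a <= x <= b -> is_derive x 1 f (df x)) ->
  (forall x, a <= x <= b -> is_derive x 1 g (dg x)) ->
  (forall x, a <= x <= b -> df x <= dg x) ->
  f b - f a <= g b - g a.
Proof.
move=> ab hf hg hfg.
have hd (x : R) : a <= x <= b -> is_derive x 1 (g - f) (dg x - df x).
  by move=> xab; apply: is_deriveB; [exact: hg|exact: hf].
have hc : {within `[a, b], continuous (g - f)}.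
  apply: derivable_within_continuous => x; rewrite in_itv /= => xab.
  by case: (hd _ xab).
have [|c cab e] := @MVT_segment _ (g - f) (fun x => dg x - df x) a b ab _ hc.
  by move=> x; rewrite in_itv /= => /andP[/ltW ax /ltW xb]; apply: hd; rewrite ax.
have : 0 <= (g - f) b - (g - f) a.
  by rewrite e mulr_ge0 ?subr_ge0 // hfg; move: cab; rewrite in_itv.
by have E y : (g - f) y = g y - f y by []; rewrite !E; lra.
Qed.

Lemma is_derive_exp (k x : R) : is_derive x 1 (fun t => expR (k * t)) (k * expR (k * x)).
Proof.
have h := @is_derive_affine expR 0 k x (expR (k * x)).
by rewrite addr0 in h; under eq_fun do rewrite -[k * _]addr0; apply: h.
Qed.

(** The function (s + c) exp (-k x) does not increase on x >= 0; negative x follow by reflection.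
    The summand c accounts for a constant forcing term. *)
Lemma gronwall (s ds : R -> R) (k c : R) :
  (forall x : R, is_derive x 1 s (ds x)) ->
  (forall x, `|ds x| <= k * (s x + c)) ->
  forall x, s x + c <= (s 0 + c) * expR (k * `|x|).
Proof.
move=> hs hk.
have main (r dr : R -> R) : (forall x : R, is_derive x 1 r (dr x)) ->
    (forall x, `|dr x| <= k * (r x + c)) ->
    forall x, 0 <= x -> r x + c <= (r 0 + c) * expR (k * x).
  move=> hr hrk x x0.
  pose h t := (r t + c) * expR (- k * t).
  have hh (t : R) : is_derive t 1 h ((dr t - k * (r t + c)) * expR (- k * t)).
    have h1 := derM (derD (hr t) (der_cst c t)) (is_derive_exp (- k) t).
    by apply: der_eq h1 _; ring.
  have := @le_increments h (cst 0) (fun t => (dr t - k * (r t + c)) * expR (- k * t))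
    (cst 0) 0 x x0 (fun t _ => hh t) (fun t _ => is_derive_cst _ _ _).
  rewrite /= subrr subr_le0 => H.
  have {}H : h x <= h 0.
    apply: H => t _; rewrite mulr_le0_ge0 ?expR_ge0 // subr_le0.
    exact: le_trans (ler_norm _) (hrk t).
  move: H; rewrite /h mulr0 expR0 mulr1 mulNr expRN ler_pdivrMr ?expR_gt0 //.
move=> x; have [x0|x0] := leP 0 x.
  by rewrite ger0_norm //; exact: main hs hk x x0.
rewrite (ltr0_norm x0).
have h1 (t : R) : is_derive t 1 (fun t => s (- t)) (- ds (- t)).
  apply: der_eq (is_derive_chain (hs (- t)) (derN (der_id t))) _.
  by rewrite mulrN1.
have h2 (t : R) : `|- ds (- t)| <= k * (s (- t) + c) by rewrite normrN.
have := main _ _ h1 h2 (- x); rewrite oppr0 opprK; apply.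
by rewrite oppr_ge0 ltW.
Qed.

Lemma int0_derive (f : R -> R) : (forall x, {for x, continuous f}) ->
  forall x : R, is_derive x 1 (int0 f) (f x).
Proof.
move=> cf x.
(* Both 0 and x lie strictly between a and b, so near x, whatever its sign, [int0 f] is the
   primitive based at a minus a constant. *)
pose a := Num.min x 0 - 1; pose b := Num.max x 0 + 1.
have m1 : Num.min x 0 <= x by rewrite ge_min lexx.
have m2 : Num.min x 0 <= 0 by rewrite ge_min lexx orbT.
have m3 : x <= Num.max x 0 by rewrite le_max lexx.
have ax : a < x by rewrite /a; lra.
have a0 : a < 0 by rewrite /a; lra.
have xb : x < b by rewrite /b; lra.
have ci (u v : R) : (@lebesgue_measure R).-integrable `[u, v] (EFin \o f).
  apply: continuous_compact_integrable; first exact: segment_compact.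
  by apply: continuous_subspaceT.
pose F y := (\int[lebesgue_measure]_(t in `[a, y]) f t).
have [dF F'] := @continuous_FTC1_closed R f a x b xb (ci a b) ax (cf x).
have hF : is_derive x 1 F (f x) by apply: DeriveDef; [exact: dF|rewrite -derive1E; exact: F'].
have E y : a < y -> F y - F 0 = int0 f y.
  move=> ay; rewrite /int0; have [y0|y0] := leP 0 y.
    rewrite /F Rintegral_itvB ?bnd_simp ?(ltW ay) ?(ltW a0) //.
    rewrite Rintegral_itv_obnd_cbnd; last first.
      apply: integrableS (ci 0 y) => //; apply: subset_itvr; rewrite bnd_simp //.
    suff -> : \int[lebesgue_measure]_(t in `[y, 0]) f t = 0 by rewrite subr0.
    move: y0; rewrite le_eqVlt => /predU1P[<-|y0].
      by rewrite set_itv1 Rintegral_set1.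
    by rewrite set_itv_ge ?Rintegral_set0 // bnd_simp -ltNge.
  have -> : `[0, y]%classic = set0 by apply: set_itv_ge; rewrite bnd_simp -ltNge.
  rewrite Rintegral_set0 sub0r.
  rewrite -opprB; congr (- _).
  rewrite /F Rintegral_itvB ?bnd_simp ?(ltW ay) ?(ltW y0) //.
  rewrite Rintegral_itv_obnd_cbnd //.
  apply: integrableS (ci y 0) => //; apply: subset_itvr; rewrite bnd_simp //.
have h := derB hF (der_cst (F 0) x); rewrite subr0 in h.
apply: near_eq_is_derive h; near=> y; apply: E; near: y.
exact: (lt_nbhsr ax).
Unshelve. all: by end_near. Qed.

End RealCalculus.

(** * Derivatives of complex matrix functions *)

Section MatrixCalculus.
Variable R : realType.

(** One predicate that carries the value of the derivative, so that product and chain rules compose;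
    [lin_odeP] translates to the pair [cderivable], [cderive]. *)
Definition isDm p q (X : R -> 'M[R[i]]_(p, q)) (x : R) (D : 'M[R[i]]_(p, q)) :=
  forall i j, is_derive x 1 (fun t => Re (X t i j)) (Re (D i j)) /\
              is_derive x 1 (fun t => Im (X t i j)) (Im (D i j)).

Lemma lin_odeP p q (A : R -> 'M[R[i]]_p) (B X : R -> 'M[R[i]]_(p, q)) :
  lin_ode A B X <-> forall x, isDm X x (A x *m X x + B x).
Proof.
split=> h x.
  move=> i j; have [h1 h2] := h x; rewrite -h2 /cderive mxE /=.
  by have [h3 h4] := h1 i j; split; apply: DeriveDef; rewrite ?derive1E.
split; first by move=> i j; have [[? _] [? _]] := h x i j.
apply/matrixP => i j; have [h1 h2] := h x i j.
by rewrite mxE; apply: complex_ext; rewrite /= derive1E derive_val.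
Qed.

Lemma isDm_eq p q (X : R -> 'M[R[i]]_(p, q)) x D E : isDm X x D -> D = E -> isDm X x E.
Proof. by move=> ? <-. Qed.

Lemma isDm_cst p q (C : 'M[R[i]]_(p, q)) x : isDm (fun=> C) x 0.
Proof. by move=> i j; rewrite mxE; split; exact: der_cst. Qed.

Lemma isDmD p q (X Y : R -> 'M[R[i]]_(p, q)) x D E :
  isDm X x D -> isDm Y x E -> isDm (fun t => X t + Y t) x (D + E).
Proof.
move=> h k i j; have [h1 h2] := h i j; have [k1 k2] := k i j; rewrite mxE.
split; [rewrite Re_add|rewrite Im_add].
  by under eq_fun do rewrite mxE Re_add; exact: derD.
by under eq_fun do rewrite mxE Im_add; exact: derD.
Qed.

Lemma isDmN p q (X : R -> 'M[R[i]]_(p, q)) x D :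
  isDm X x D -> isDm (fun t => - X t) x (- D).
Proof.
move=> h i j; have [h1 h2] := h i j; rewrite mxE.
split; [rewrite Re_opp|rewrite Im_opp].
  by under eq_fun do rewrite mxE Re_opp; exact: derN.
by under eq_fun do rewrite mxE Im_opp; exact: derN.
Qed.

Lemma isDmB p q (X Y : R -> 'M[R[i]]_(p, q)) x D E :
  isDm X x D -> isDm Y x E -> isDm (fun t => X t - Y t) x (D - E).
Proof. by move=> h k; exact: isDmD (isDmN k). Qed.

Lemma isDmM p q r (X : R -> 'M[R[i]]_(p, q)) (Y : R -> 'M[R[i]]_(q, r)) x D E :
  isDm X x D -> isDm Y x E -> isDm (fun t => X t *m Y t) x (D *m Y x + X x *m E).
Proof.
move=> h k i j; split.
  have -> : Re ((D *m Y x + X x *m E) i j) = \sum_l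
     ((Re (D i l) * Re (Y x l j) + Re (X x i l) * Re (E l j))
    - (Im (D i l) * Im (Y x l j) + Im (X x i l) * Im (E l j))).
    rewrite !mxE Re_add !Re_sum -big_split /=; apply: eq_bigr => l _.
    by rewrite !Re_mul; ring.
  under eq_fun do rewrite mxE Re_sum.
  apply: der_sum => l; under eq_fun do rewrite Re_mul.
  by have [? ?] := h i l; have [? ?] := k l j; apply: derB; exact: derM.
have -> : Im ((D *m Y x + X x *m E) i j) = \sum_l
   ((Re (D i l) * Im (Y x l j) + Re (X x i l) * Im (E l j))
  + (Im (D i l) * Re (Y x l j) + Im (X x i l) * Re (E l j))).
  rewrite !mxE Im_add !Im_sum -big_split /=; apply: eq_bigr => l _.
  by rewrite !Im_mul; ring.
under eq_fun do rewrite mxE Im_sum.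
apply: der_sum => l; under eq_fun do rewrite Im_mul.
by have [? ?] := h i l; have [? ?] := k l j; apply: derD; exact: derM.
Qed.

Lemma isDmMl p q r (A : 'M[R[i]]_(p, q)) (Y : R -> 'M[R[i]]_(q, r)) x E :
  isDm Y x E -> isDm (fun t => A *m Y t) x (A *m E).
Proof.
by move=> h; apply: isDm_eq (isDmM (isDm_cst A x) h) _; rewrite mul0mx add0r.
Qed.

Lemma isDmMr p q r (B : 'M[R[i]]_(q, r)) (X : R -> 'M[R[i]]_(p, q)) x E :
  isDm X x E -> isDm (fun t => X t *m B) x (E *m B).
Proof.
by move=> h; apply: isDm_eq (isDmM h (isDm_cst B x)) _; rewrite mulmx0 addr0.
Qed.

Lemma isDmZ p q (g : R -> R) (X : R -> 'M[R[i]]_(p, q)) (x d : R) D :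
  is_derive x 1 g d -> isDm X x D ->
  isDm (fun t => (g t)%:C *: X t) x (d%:C *: X x + (g x)%:C *: D).
Proof.
move=> hg h i j; have [h1 h2] := h i j; rewrite !mxE; split.
  rewrite Re_add !Re_mul /= !mul0r !subr0.
  by under eq_fun do rewrite mxE Re_mul /= mul0r subr0; exact: derM.
rewrite Im_add !Im_mul /= !mul0r !addr0.
by under eq_fun do rewrite mxE Im_mul /= mul0r addr0; exact: derM.
Qed.

Lemma isDmZc p q (c : R[i]) (X : R -> 'M[R[i]]_(p, q)) x D :
  isDm X x D -> isDm (fun t => c *: X t) x (c *: D).
Proof.
move=> h; have e (Y : 'M[R[i]]_(p, q)) : c *: Y = c%:M *m Y by rewrite mul_scalar_mx.
by rewrite e; under eq_fun do rewrite e; exact: isDmMl.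
Qed.

Lemma isDm_shift p q (X : R -> 'M[R[i]]_(p, q)) x c D :
  isDm X (x + c) D -> isDm (fun t => X (t + c)) x D.
Proof.
move=> h i j; have [h1 h2] := h i j.
by split; [exact: (is_derive_shifted (f := fun t => Re (X t i j)))
          |exact: (is_derive_shifted (f := fun t => Im (X t i j)))].
Qed.

(** The functional [l] made of the signs of the entries of X b - X a attains the norm of this
    increment and is dominated by [nm] everywhere. The scalar comparison thus applies without a
    constant depending on the dimension. *)
Lemma isDm_le_increments p q (X D : R -> 'M[R[i]]_(p, q)) (g dg : R -> R) a b : a <= b ->
  (forall x : R, a <= x <= b -> isDm X x (D x)) ->
  (forall x : R, a <= x <= b -> is_derive x 1 g (dg x)) ->
  (forall x, a <= x <= b -> nm (D x) <= dg x) ->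
  nm (X b - X a) <= g b - g a.
Proof.
move=> ab hX hg hD; set Z := X b - X a.
pose l (Y : 'M[R[i]]_(p, q)) := \sum_i \sum_j
  (Num.sg (Re (Z i j)) * Re (Y i j) + Num.sg (Im (Z i j)) * Im (Y i j)).
have lZ : nm Z = l (X b) - l (X a).
  rewrite /l -sumrB; apply: eq_bigr => i _; rewrite -sumrB; apply: eq_bigr => j _.
  have -> : cn (Z i j) = Num.sg (Re (Z i j)) * Re (Z i j) + Num.sg (Im (Z i j)) * Im (Z i j).
    by rewrite /cn -!normrEsg.
  rewrite {2 4}/Z !mxE Re_add Im_add Re_opp Im_opp; ring.
have sgle (y c : R) : Num.sg y * c <= `|c|.
  by case: (sgrP y) => _; rewrite ?mul0r ?mul1r ?mulN1r ?ler_norm // -normrN ler_norm.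
have lle Y : l Y <= nm Y.
  by do 2!(apply: ler_sum => ? _); rewrite lerD // sgle.
rewrite lZ; apply: (le_increments (f := fun t => l (X t)) (df := fun t => l (D t)) ab _ hg).
  move=> x xab; apply: der_sum => i; apply: der_sum => j.
  by have [? ?] := hX x xab i j; apply: derD; exact: derZ.
by move=> x xab; exact: le_trans (lle _) (hD x xab).
Qed.

Lemma isDm_lipschitz_on p q (X D : R -> 'M[R[i]]_(p, q)) M s t :
  (forall x, isDm X x (D x)) -> (forall x, `|x - t| <= `|s - t| -> nm (D x) <= M) ->
  nm (X s - X t) <= M * `|s - t|.
Proof.
move=> hX hD.
have main a b : a <= b -> (forall x, a <= x <= b -> nm (D x) <= M) -> nm (X b - X a) <= M * (b - a).
  move=> ab h; rewrite mulrBr.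
  apply: (isDm_le_increments (D := D) (g := fun t => M * t) (dg := fun=> M)) => // x _.
  by apply: der_eq (derZ M (der_id x)) _; rewrite mulr1.
have [st|ts] := leP t s.
  rewrite ger0_norm ?subr_ge0 //; apply: main => // x /andP[x1 x2]; apply: hD.
  rewrite !ger0_norm; lra.
rewrite nmBC ltr0_norm ?subr_lt0 // opprB; apply: main => [|x /andP[x1 x2]]; first exact: ltW.
apply: hD; rewrite !ler0_norm; lra.
Qed.

Lemma isDm_lipschitz p q (X D : R -> 'M[R[i]]_(p, q)) M :
  (forall x, isDm X x (D x)) -> (forall x, nm (D x) <= M) ->
  forall s t, nm (X s - X t) <= M * `|s - t|.
Proof. by move=> hX hD s t; apply: isDm_lipschitz_on hX _ => x _. Qed.

(** A remainder bound passes to pointwise limits, which differentiability does not; this supplies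
    the hypothesis of [isDm_limit]. *)
Lemma isDm_taylor p q (X D : R -> 'M[R[i]]_(p, q)) (E : 'M[R[i]]_(p, q)) t h c :
  (forall x, isDm X x (D x)) ->
  (forall s, `|s - t| <= `|h| -> nm (D s - E) <= c) ->
  nm (X (t + h) - X t - h%:C *: E) <= c * `|h|.
Proof.
move=> hX hD.
pose Y s := X s - (s - t)%:C *: E.
have hY s : isDm Y s (D s - E).
  apply: isDmB => //; apply: isDm_eq (isDmZ (derB (der_id s) (der_cst t s)) (isDm_cst E s)) _.
  by rewrite scaler0 addr0 subr0 scale1r.
have e : X (t + h) - X t - h%:C *: E = Y (t + h) - Y t.
  have -> : Y t = X t by rewrite /Y (subrr t) (scale0r E) subr0.
  by rewrite /Y [t + h - t]addrC addKr [RHS]addrAC.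
have := isDm_lipschitz_on (s := t + h) (t := t) (M := c) hY.
by rewrite e [t + h - t]addrC addKr; apply=> x; exact: hD.
Qed.

(** Integration reproduces the weight exp (K |x|) with a factor 1 / K, which makes the Picard map a
    contraction on the whole line at once. *)
Lemma isDm_exp_growth p q (X D : R -> 'M[R[i]]_(p, q)) a K : 0 <= a ->
  (forall x, isDm X x (D x)) ->
  (forall x, nm (D x) <= a * (K * expR (K * `|x|))) ->
  forall x, nm (X x - X 0) <= a * expR (K * `|x|).
Proof.
move=> a0 hX hD x; have [x0|x0] := leP 0 x.
  apply: (@le_trans _ _ (a * expR (K * x) - a * expR (K * 0))).
    apply: (isDm_le_increments (D := D) (dg := fun t => a * (K * expR (K * t))) (g := fun t => a * expR (K * t))) => //.
      by move=> t _; exact: derZ (is_derive_exp K t).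
    by move=> t /andP[t0 _]; have := hD t; rewrite (ger0_norm t0).
  by rewrite (ger0_norm x0) gerBl mulr_ge0 ?expR_ge0.
rewrite nmBC; apply: (@le_trans _ _ (- a * expR (- K * 0) - (- a * expR (- K * x)))).
  apply: (isDm_le_increments (D := D) (dg := fun t => - a * (- K * expR (- K * t))) (g := fun t => - a * expR (- K * t))) => //.
  - exact: ltW.
  - by move=> t _; exact: derZ (is_derive_exp (- K) t).
  - move=> t /andP[_ t0]; have := hD t; rewrite (ler0_norm t0).
    by rewrite !mulNr mulrN !mulrN !opprK.
rewrite (ltr0_norm x0) mulr0 expR0 mulrN -mulNr; lra.
Qed.

End MatrixCalculus.

(** * Limits along filters and ultrafilters *)

Section Limits.
Variable R : realType.

Definition clim T (F : set_system T) p q (f : T -> 'M[R[i]]_(p, q)) l :=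
  forall e : R, 0 < e -> \forall k \near F, nm (f k - l) < e.

Lemma clim_le T (F : set_system T) {FF : ProperFilter F} p q (f : T -> 'M[R[i]]_(p, q)) l l' M :
  clim F f l -> (\forall k \near F, nm (f k - l') <= M) -> nm (l - l') <= M.
Proof.
move=> fl fM; apply/ler_addgt0Pr => e e0.
have [k [k1 k2]] := filter_ex (filterI (fl e e0) fM).
apply: le_trans (nm_tri (f k) _ _) _; rewrite addrC lerD //.
by rewrite nmBC ltW.
Qed.

Lemma clim_unique T (F : set_system T) {FF : ProperFilter F} p q (f : T -> 'M[R[i]]_(p, q)) l l' :
  clim F f l -> clim F f l' -> l = l'.
Proof.
move=> fl fl'; apply/eqP; rewrite -subr_eq0; apply/eqP/nm_eq0/eqP.
rewrite eq_le nm_ge0 andbT; apply/ler_addgt0Pr => e e0; rewrite add0r.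
apply: clim_le fl _; apply: filterS (fl' e e0) => k; exact: ltW.
Qed.

Lemma clim_squeeze T (F : set_system T) {FF : Filter F} p q (f : T -> 'M[R[i]]_(p, q)) l (g : T -> R) :
  (\forall k \near F, nm (f k - l) <= g k) ->
  (forall e : R, 0 < e -> \forall k \near F, g k < e) -> clim F f l.
Proof.
move=> h1 h2 e e0; apply: filterS2 h1 (h2 e e0) => k; exact: le_lt_trans.
Qed.

Lemma clim_bounded T (F : set_system T) {FF : Filter F} p q (f : T -> 'M[R[i]]_(p, q)) l :
  clim F f l -> \forall k \near F, nm (f k) <= nm l + 1.
Proof.
move=> /(_ 1 ltr01); apply: filterS => k h.
have -> : f k = l + (f k - l) by rewrite addrC subrK.
by apply: le_trans (nmD _ _) _; rewrite lerD2l ltW.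
Qed.

Lemma climD T (F : set_system T) {FF : Filter F} p q (f g : T -> 'M[R[i]]_(p, q)) l l' :
  clim F f l -> clim F g l' -> clim F (fun k => f k + g k) (l + l').
Proof.
move=> fl gl e e0; have e2 : 0 < e / 2 by lra.
apply: filterS2 (fl _ e2) (gl _ e2) => k h1 h2.
rewrite opprD addrACA; apply: le_lt_trans (nmD _ _) _; lra.
Qed.

Lemma climM T (F : set_system T) {FF : Filter F} p q r (f : T -> 'M[R[i]]_(p, q)) (g : T -> 'M[R[i]]_(q, r)) l l' :
  clim F f l -> clim F g l' -> clim F (fun k => f k *m g k) (l *m l').
Proof.
move=> fl gl e e0.
pose M := nm l + nm l' + 2.
have M0 : 0 < M by rewrite /M; have := nm_ge0 l; have := nm_ge0 l'; lra.
have e2 : 0 < e / (2 * M) by rewrite divr_gt0 // mulr_gt0.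
apply: filterS3 (fl _ e2) (gl _ e2) (clim_bounded gl) => k h1 h2 h3.
have -> : f k *m g k - l *m l' = (f k - l) *m g k + l *m (g k - l').
  by rewrite mulmxBl mulmxBr addrA subrK.
apply: le_lt_trans (nmD _ _) _.
have a1 : nm ((f k - l) *m g k) <= nm (f k - l) * M.
  apply: le_trans (nmM _ _) _; apply: ler_wpM2l; first exact: nm_ge0.
  by rewrite /M; have := nm_ge0 l; lra.
have a2 : nm (l *m (g k - l')) <= nm (g k - l') * M.
  apply: le_trans (nmM _ _) _; rewrite mulrC; apply: ler_wpM2l; first exact: nm_ge0.
  by rewrite /M; have := nm_ge0 l'; lra.
have a3 : nm (f k - l) * M < e / 2.
  by rewrite -ltr_pdivlMr // -mulrA -invfM.
have a4 : nm (g k - l') * M < e / 2.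
  by rewrite -ltr_pdivlMr // -mulrA -invfM.
lra.
Qed.

Lemma clim_cst T (F : set_system T) {FF : Filter F} p q (l : 'M[R[i]]_(p, q)) : clim F (fun=> l) l.
Proof. by move=> e e0; apply: nearW => k; rewrite subrr nm0. Qed.

Lemma climN T (F : set_system T) {FF : Filter F} p q (f : T -> 'M[R[i]]_(p, q)) l :
  clim F f l -> clim F (fun k => - f k) (- l).
Proof. by move=> fl e e0; apply: filterS (fl e e0) => k; rewrite -opprD nmN. Qed.

Lemma climZ T (F : set_system T) {FF : Filter F} p q (c : R[i]) (f : T -> 'M[R[i]]_(p, q)) l :
  clim F f l -> clim F (fun k => c *: f k) (c *: l).
Proof.
move=> fl; rewrite -mul_scalar_mx.
suff -> : (fun k => c *: f k) = (fun k => c%:M *m f k) by exact: climM (clim_cst _) fl.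
by apply/funext => k; rewrite mul_scalar_mx.
Qed.

Lemma ultra_fmap T T' (F : set_system T) (f : T -> T') :
  UltraFilter F -> UltraFilter (f @ F).
Proof.
move=> FU; split; first exact: fmap_proper_filter.
move=> G GF FG; apply/seteqP; split=> // A GA.
have [//|FnA] := in_ultra_setVsetC (f @^-1` A) FU.
have GnA : G (~` A) by exact: FG.
by have [x []] := filter_ex (filterI GA GnA).
Qed.

Lemma ultra_lim_compact T (F : set_system T) (W : topologicalType) (K : set W) (f : T -> W) :
  UltraFilter F -> compact K -> (\forall k \near F, K (f k)) ->
  exists2 l, K l & f k @[k --> F] --> l.
Proof.
move=> FU; rewrite compact_ultra => cK fK.
have [|l [Kl fl]] := cK (f @ F) (ultra_fmap f FU); last by exists l.
exact: fK.
Qed.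

Lemma ultra_lim_real T (F : set_system T) (f : T -> R) M :
  UltraFilter F -> (\forall k \near F, `|f k| <= M) ->
  exists2 l, `|l| <= M & f k @[k --> F] --> l.
Proof.
move=> FU fM; have [|l lM fl] := @ultra_lim_compact T F R `[- M, M]%classic f FU (@segment_compact _ _ _).
  by apply: filterS fM => k; rewrite /= in_itv /= ler_norml.
by exists l => //; rewrite ler_norml; move: lM; rewrite /= in_itv.
Qed.

Lemma clim_entries T (F : set_system T) {FF : Filter F} p q (f : T -> 'M[R[i]]_(p, q))
    (l : 'M[R[i]]_(p, q)) :
  (forall i j, Re (f k i j) @[k --> F] --> Re (l i j) /\
               Im (f k i j) @[k --> F] --> Im (l i j)) -> clim F f l.
Proof.
move=> h e e0.
pose N : R := p%:R * q%:R * 2 + 1.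
have N0 : 0 < N by rewrite /N ltr_wpDl // !mulr_ge0.
have eN : 0 < e / N by rewrite divr_gt0.
have h1 : \forall k \near F, forall ij : 'I_p * 'I_q, cn (f k ij.1 ij.2 - l ij.1 ij.2) <= 2 * (e / N).
  apply: (@filter_forall _ _ (fun (ij : 'I_p * 'I_q) k => cn (f k ij.1 ij.2 - l ij.1 ij.2) <= 2 * (e / N)) F) => -[i j] /=.
  have [/cvgrPdist_le /(_ _ eN) hr /cvgrPdist_le /(_ _ eN) hi] := h i j.
  apply: filterS2 hi hr => k hi hr.
  rewrite /cn Re_add Im_add Re_opp Im_opp /= mulr_natl mulr2n.
  by apply: lerD; rewrite distrC.
apply: filterS h1 => k h1; apply: (@le_lt_trans _ _ (\sum_(i < p) \sum_(j < q) (2 * (e / N)))).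
  by apply: ler_sum => i _; apply: ler_sum => j _; have := h1 (i, j); rewrite [(f k - l) i j]mxE [(- l) i j]mxE.
rewrite !sumr_const !card_ord -[_ *+ q]mulr_natl -[_ *+ p]mulr_natl.
have -> : p%:R * (q%:R * (2 * (e / N))) = e * ((N - 1) / N) by rewrite /N; ring.
by rewrite gtr_pMr // ltr_pdivrMr // mul1r ltrBlDr ltrDl.
Qed.

(** The substitute for extracting subsequences: along one ultrafilter a locally bounded family of
    functions converges at every point simultaneously, without Arzela-Ascoli or a diagonal
    argument. *)
Lemma ultra_clim T (F : set_system T) p q (f : T -> 'M[R[i]]_(p, q)) M :
  UltraFilter F -> (\forall k \near F, nm (f k) <= M) ->
  exists l, clim F f l.
Proof.
move=> FU fM.
have part (g : R[i] -> R) i j : (forall z, `|g z| <= cn z) -> exists x : R, g (f k i j) @[k --> F] --> x.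
  move=> hg; have [|x _ ?] := @ultra_lim_real T F (fun k => g (f k i j)) M FU; last by exists x.
  by apply: filterS fM => k; apply: le_trans; exact: le_trans (hg _) (nm_entry _ _ _).
have hre i j := part (@complex.Re R) i j (@Re_le_cn R); have him i j := part (@complex.Im R) i j (@Im_le_cn R).
exists (\matrix_(i < p, j < q) (sval (cid (hre i j)) +i* sval (cid (him i j)))).
by apply: clim_entries => i j; rewrite mxE; split; [exact: svalP (cid (hre i j))|exact: svalP (cid (him i j))].
Qed.

(* The remainder is allowed an o(1) error, so that the lemma applies to
   approximate solutions as well as to iteration schemes. *)
Lemma isDm_limit T (F : set_system T) {FF : ProperFilter F} p q
    (f : T -> R -> 'M[R[i]]_(p, q)) (d : T -> 'M[R[i]]_(p, q)) g l (eta : T -> R) t C :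
  (\forall k \near F, forall h, `|h| <= 1 ->
     nm (f k (t + h) - f k t - h%:C *: d k) <= (eta k + C * `|h|) * `|h|) ->
  (forall e, 0 < e -> \forall k \near F, eta k < e) ->
  (forall s, clim F (f^~ s) (g s)) -> clim F d l -> isDm g t l.
Proof.
move=> hf heta fg dl.
have C0 : 0 <= `|C| by [].
(* The error [eta] disappears in the limit and leaves a quadratic remainder, which determines the
   derivative. *)
have key h : `|h| <= 1 -> nm (g (t + h) - g t - h%:C *: l) <= `|C| * `|h| * `|h|.
  move=> h1; have L : clim F (fun k => f k (t + h) - f k t - h%:C *: d k) (g (t + h) - g t - h%:C *: l).
    exact: climD (climD (fg (t + h)) (climN (fg t))) (climN (climZ h%:C dl)).
  apply/ler_addgt0Pr => e e0.
  rewrite -[X in nm X]subr0; apply: clim_le L _; apply: filterS2 hf (heta e e0) => k hk he.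
  rewrite subr0; apply: le_trans (hk h h1) _.
  rewrite mulrDl addrC; apply: lerD.
    by rewrite -!mulrA; apply: ler_wpM2r; [exact: mulr_ge0|exact: ler_norm].
  apply: (@le_trans _ _ (e * `|h|)); first by apply: ler_wpM2r => //; exact: ltW.
  by rewrite ler_piMr // ltW.
have real_key (u : R -> R) (a : R) :
    (forall h, `|h| <= 1 -> `|u (t + h) - u t - h * a| <= `|C| * `|h| * `|h|) ->
    is_derive t 1 u a.
  move=> hu.
  have cv : h^-1 *: ((u \o shift t) (h *: 1) - u t) @[h --> 0^'] --> a.
    apply/cvgrPdist_le => e e0; near=> h.
    have hn0 : h != 0 by near: h; exact: nbhs_dnbhs_neq.
    have h1 : `|h| <= 1 by near: h; apply: dnbhs0_le.
    have h2 : `|h| <= e / (`|C| + 1).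
      by near: h; apply: dnbhs0_le; rewrite divr_gt0 // ltr_wpDl.
    rewrite /= /GRing.scale /= mulr1 [h + t]addrC distrC.
    have -> : h^-1 * (u (t + h) - u t) - a = h^-1 * (u (t + h) - u t - h * a).
      by rewrite [RHS]mulrBr mulKf.
    rewrite normrM normfV ler_pdivrMl ?normr_gt0 // [leRHS]mulrC.
    apply: le_trans (hu h h1) _; apply: ler_wpM2r => //.
    apply: (@le_trans _ _ ((`|C| + 1) * `|h|)); first by apply: ler_wpM2r => //; rewrite lerDl.
    by rewrite mulrC -ler_pdivlMr // ltr_wpDl.
  apply: DeriveDef; first by apply/cvg_ex; exists a.
  exact/cvg_lim.
move=> i j; split; apply: real_key => h h1; apply: le_trans (key h h1).
  apply: le_trans (nm_entry _ i j); apply: le_trans (Re_le_cn _).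
  by rewrite !mxE !Re_add !Re_opp Re_mul /= mul0r subr0.
apply: le_trans (nm_entry _ i j); apply: le_trans (Im_le_cn _).
by rewrite !mxE !Im_add !Im_opp Im_mul /= mul0r addr0.
Unshelve. all: by end_near. Qed.

End Limits.

(** * Linear differential equations *)

Section LinearODE.
Variable R : realType.

(** Gronwall for the sum of squares, since absolute values are not differentiable. Products are
    split by 2 a b <= a^2 + b^2, and adding eta^2 to the sum absorbs the forcing. *)
Lemma gronwall_family (J : finType) (y dy : J -> R -> R) (K eta : R) : 0 <= K -> 0 <= eta ->
  (forall j (x : R), is_derive x 1 (y j) (dy j x)) ->
  (forall j x, `|dy j x| <= K * \sum_k `|y k x| + eta) ->
  forall x, \sum_j y j x ^+ 2 + eta ^+ 2 <=
    (\sum_j y j 0 ^+ 2 + eta ^+ 2) * expR ((2 * K * #|J|%:R + #|J|%:R + 1) * `|x|).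
Proof.
move=> K0 eta0 hy hdy.
set N : R := #|J|%:R; have N0 : 0 <= N by [].
pose s x := \sum_j y j x * y j x.
have sE x : \sum_j y j x ^+ 2 = s x by apply: eq_bigr => j _; rewrite expr2.
have s0 x : 0 <= s x by apply: sumr_ge0 => j _; rewrite -expr2 sqr_ge0.
move=> x; rewrite !sE.
apply: (gronwall (s := s) (ds := fun x => \sum_j (dy j x * y j x + y j x * dy j x))).
  by move=> t; apply: der_sum => j; exact: derM.
move=> t; apply: le_trans (ler_norm_sum _ _ _) _.
apply: (@le_trans _ _ (\sum_j (\sum_k K * (y j t * y j t + y k t * y k t) + (y j t * y j t + eta ^+ 2)))).
  apply: ler_sum => j _.
  have -> : dy j t * y j t + y j t * dy j t = 2 * (y j t * dy j t) by ring.
  rewrite normrM (ger0_norm (ler0n _ _)) normrM.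
  apply: (@le_trans _ _ (2 * (`|y j t| * (K * \sum_k `|y k t| + eta)))).
    by apply: ler_wpM2l => //; apply: ler_wpM2l.
  have -> : 2 * (`|y j t| * (K * \sum_k `|y k t| + eta)) =
     \sum_k K * (2 * `|y j t| * `|y k t|) + 2 * `|y j t| * eta.
    rewrite mulrDr mulrDr !mulrA; congr (_ + _); rewrite mulr_sumr.
    by apply: eq_bigr => k _; ring.
  apply: lerD.
    apply: ler_sum => k _; apply: ler_wpM2l => //.
    rewrite -!expr2 -(real_normK (num_real (y j t))) -(real_normK (num_real (y k t))).
    by have := sqr_ge0 (`|y j t| - `|y k t|); rewrite sqrrB mulr2n; lra.
  rewrite -!expr2 -(real_normK (num_real (y j t))).
  by have := sqr_ge0 (`|y j t| - eta); rewrite sqrrB mulr2n; lra.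
rewrite big_split /= [X in _ + X]big_split /= sumr_const.
have -> : \sum_(i in J) \sum_k K * (y i t * y i t + y k t * y k t) = 2 * K * N * s t.
  transitivity (\sum_i K * (N * (y i t * y i t) + s t)).
    apply: eq_bigr => i _; rewrite -mulr_sumr big_split /= sumr_const -/(s t).
    by rewrite -[_ *+ _]mulr_natl.
  rewrite -mulr_sumr big_split /= -mulr_sumr sumr_const -/(s t).
  by rewrite -[_ *+ _]mulr_natl -/N; ring.
rewrite -/(s t) -[_ *+ _]mulr_natl -/N.
have := s0 t; have := sqr_ge0 eta => e1 e2.
have : 0 <= N * s t by exact: mulr_ge0.
have : 0 <= 2 * K * N * eta ^+ 2 by rewrite !mulr_ge0.
lra.
Qed.

Lemma nm_sum_family p q (X : 'M[R[i]]_(p, q)) :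
  nm X = \sum_(k : 'I_p * 'I_q * bool)
    `|if k.2 then Re (X k.1.1 k.1.2) else Im (X k.1.1 k.1.2)|.
Proof.
rewrite -(pair_bigA _ (fun (ij : 'I_p * 'I_q) (b : bool) =>
  `|if b then Re (X ij.1 ij.2) else Im (X ij.1 ij.2)|)) /=.
rewrite -(pair_bigA _ (fun i j => \sum_(b : bool) `|if b then Re (X i j) else Im (X i j)|)) /=.
by do 2!(apply: eq_bigr => ? _); rewrite big_bool.
Qed.

(** The constants are fixed before X, so they are common to all functions with the same K. The rate
    c is half of the one for the squares because a root is taken at the end. *)
Lemma gronwall_mx p q K : 0 <= K ->
  exists c N, [/\ 0 <= c, 0 <= N & forall (X D : R -> 'M[R[i]]_(p, q)) eta, 0 <= eta ->
    (forall x, isDm X x (D x)) -> (forall x, nm (D x) <= K * nm (X x) + eta) ->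
    forall x, nm (X x) <= N * (nm (X 0) + eta) * expR (c * `|x|)].
Proof.
move=> K0; pose J : finType := ('I_p * 'I_q * bool)%type.
pose c : R := (2 * K * #|J|%:R + #|J|%:R + 1) / 2.
exists c, #|J|%:R; split=> [||X D eta eta0 hX hD x].
- by rewrite /c divr_ge0 // !addr_ge0 // !mulr_ge0.
- by [].
pose part (Z : 'M[R[i]]_(p, q)) (k : J) := if k.2 then Re (Z k.1.1 k.1.2) else Im (Z k.1.1 k.1.2).
have partE Z : nm Z = \sum_k `|part Z k| by exact: nm_sum_family.
have h1 k (t : R) : is_derive t 1 (fun t => part (X t) k) (part (D t) k).
  by case: k => [[i j] []]; have [] := hX t i j.
have h2 k t : `|part (D t) k| <= K * \sum_k `|part (X t) k| + eta.
  rewrite -partE; apply: le_trans (hD t); rewrite partE (bigD1 k) //= lerDl.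
  exact: sumr_ge0.
have := gronwall_family (y := fun k t => part (X t) k) (dy := fun k t => part (D t) k) K0 eta0 h1 h2 x.
set s := (X in X * expR _) => H.
have sle : s <= (nm (X 0) + eta) ^+ 2.
  rewrite sqrrD /s; have e : 0 <= nm (X 0) * eta by rewrite mulr_ge0 // nm_ge0.
  suff : \sum_k part (X 0) k ^+ 2 <= nm (X 0) ^+ 2 by rewrite mulr2n; lra.
  rewrite expr2 {1}partE mulr_suml; apply: ler_sum => k _.
  rewrite -(real_normK (num_real _)) expr2; apply: ler_wpM2l => //.
  by rewrite partE (bigD1 k) //= lerDl; exact: sumr_ge0.
have E2 : expR ((2 * K * #|J|%:R + #|J|%:R + 1) * `|x|) = expR (c * `|x|) ^+ 2.
  by rewrite -expRM_natl /c; congr expR; field.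
rewrite E2 in H; have a0 : 0 <= nm (X 0) + eta by rewrite addr_ge0 // nm_ge0.
have each k : `|part (X x) k| <= (nm (X 0) + eta) * expR (c * `|x|).
  rewrite -(ler_pXn2r (n := 2)) ?nnegrE // ?mulr_ge0 ?expR_ge0 // exprMn.
  rewrite real_normK ?num_real //; apply: (@le_trans _ _ (s * expR (c * `|x|) ^+ 2)).
    apply: le_trans H; rewrite (bigD1 k) //= -addrA lerDl addr_ge0 ?sqr_ge0 //.
    by apply: sumr_ge0 => ? _; exact: sqr_ge0.
  by apply: ler_wpM2r => //; exact: sqr_ge0.
rewrite partE -mulrA; apply: (@le_trans _ _ (\sum_(k : J) (nm (X 0) + eta) * expR (c * `|x|))).
  by apply: ler_sum => k _.
by rewrite sumr_const mulr_natl.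
Qed.

Lemma lin_ode_unique p q (A : R -> 'M[R[i]]_p) (X : R -> 'M[R[i]]_(p, q)) M y :
  (forall x, nm (A x) <= M) -> (forall x, isDm X x (A x *m X x)) -> X y = 0 ->
  forall x, X x = 0.
Proof.
move=> hA hX Xy x; have M0 : 0 <= M := le_trans (nm_ge0 _) (hA 0).
have [c [N [_ _ h]]] := @gronwall_mx p q M M0.
have {h} := h (fun t => X (t + y)) (fun t => A (t + y) *m X (t + y)) 0 (lexx 0) _ _ (x - y).
rewrite add0r Xy nm0 addr0 mulr0 mul0r subrK => h.
apply: nm_eq0; apply/eqP; rewrite eq_le nm_ge0 andbT; apply: h => t; first exact: isDm_shift.
by rewrite addr0; apply: le_trans (nmM _ _) _; apply: ler_wpM2r; [exact: nm_ge0|exact: hA].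
Qed.

Definition ctm p q (X : R -> 'M[R[i]]_(p, q)) := forall t, clim (nbhs t) X (X t).

Lemma lip_ctm p q (X : R -> 'M[R[i]]_(p, q)) M :
  (forall s t, nm (X s - X t) <= M * `|s - t|) -> ctm X.
Proof.
move=> h t; apply: (@clim_squeeze _ _ _ _ _ _ _ _ (fun s => `|M| * `|s - t|)).
  apply: nearW => s; apply: le_trans (h s t) _.
  by apply: ler_wpM2r => //; exact: ler_norm.
move=> e e0; near=> s.
apply: (@le_lt_trans _ _ ((`|M| + 1) * `|s - t|)); first by apply: ler_wpM2r => //; rewrite lerDl.
rewrite mulrC -ltr_pdivlMr ?ltr_wpDl // distrC.
near: s; apply: cvgr_dist_lt; first exact: cvg_id.
by rewrite divr_gt0 // ltr_wpDl.
Unshelve. all: by end_near. Qed.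

Lemma ctm_entry p q (X : R -> 'M[R[i]]_(p, q)) i j : ctm X ->
  forall t, {for t, continuous (fun s => Re (X s i j))} /\
            {for t, continuous (fun s => Im (X s i j))}.
Proof.
move=> h t; split; apply/cvgrPdist_lt => e e0; apply: filterS (h t e e0) => s H;
  rewrite distrC; apply: le_lt_trans H; apply: le_trans (nm_entry _ i j).
  by apply: le_trans (Re_le_cn _); rewrite !mxE Re_add Re_opp.
by apply: le_trans (Im_le_cn _); rewrite !mxE Im_add Im_opp.
Qed.

Lemma isDm_ctm p q (X D : R -> 'M[R[i]]_(p, q)) : (forall x, isDm X x (D x)) -> ctm X.
Proof.
move=> h t; apply: clim_entries => i j.
by have [/is_derive_continuous hr /is_derive_continuous hi] := h t i j.
Qed.

Lemma int0_0 (f : R -> R) : int0 f 0 = 0.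
Proof. by rewrite /int0 subrr. Qed.

Lemma antiderivative p q (B : R -> 'M[R[i]]_(p, q)) : ctm B ->
  exists X, X 0 = 0 /\ forall x, isDm X x (B x).
Proof.
move=> cB; exists (fun x => \matrix_(i < p, j < q)
  (int0 (fun t => Re (B t i j)) x +i* int0 (fun t => Im (B t i j)) x)); split.
  by apply/matrixP => i j; rewrite !mxE !int0_0.
move=> x i j; split; under eq_fun do rewrite mxE /=.
  by apply: int0_derive => t; have [] := ctm_entry i j cB t.
by apply: int0_derive => t; have [] := ctm_entry i j cB t.
Qed.

Lemma half_pow_small (a e : R) : 0 < e -> \forall k \near \oo, a * 2^-1 ^+ k < e.
Proof.
move=> e0.
have h : geometric a 2^-1 k @[k --> \oo] --> (0 : R).
  by apply: cvg_geometric; rewrite ger0_norm ?invf_lt1 ?ltr1n.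
move/cvgrPdist_lt : h => /(_ e e0); apply: filterS => k.
by rewrite sub0r normrN /geometric /=; apply: le_lt_trans; exact: ler_norm.
Qed.

(** One constant serves as bound and as Lipschitz constant: the class is stable under sums and
    products, and the Lipschitz half is the equicontinuity that lets equations survive limits. *)
Definition bl M p q (X : R -> 'M[R[i]]_(p, q)) :=
  (forall t, nm (X t) <= M) /\ (forall s t, nm (X s - X t) <= M * `|s - t|).

Lemma bl_ge0 M p q (X : R -> 'M[R[i]]_(p, q)) : bl M X -> 0 <= M.
Proof. by move=> [h _]; exact: le_trans (nm_ge0 _) (h 0). Qed.

Lemma bl_weaken M N p q (X : R -> 'M[R[i]]_(p, q)) : M <= N -> bl M X -> bl N X.
Proof.
move=> MN [h1 h2]; split=> [t|s t]; first exact: le_trans (h1 t) MN.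
by apply: le_trans (h2 s t) _; exact: ler_wpM2r.
Qed.

Lemma bl_ctm M p q (X : R -> 'M[R[i]]_(p, q)) : bl M X -> ctm X.
Proof. by move=> [_ h]; exact: lip_ctm h. Qed.

Lemma blD M N p q (X Y : R -> 'M[R[i]]_(p, q)) : bl M X -> bl N Y ->
  bl (M + N) (fun t => X t + Y t).
Proof.
move=> [h1 h2] [k1 k2]; split=> [t|s t].
  by apply: le_trans (nmD _ _) _; exact: lerD.
by rewrite opprD addrACA; apply: le_trans (nmD _ _) _; rewrite mulrDl lerD.
Qed.

Lemma blN M p q (X : R -> 'M[R[i]]_(p, q)) : bl M X -> bl M (fun t => - X t).
Proof. by move=> [h1 h2]; split=> [t|s t]; rewrite -?opprD nmN. Qed.

Lemma blM M N p q r (X : R -> 'M[R[i]]_(p, q)) (Y : R -> 'M[R[i]]_(q, r)) :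
  bl M X -> bl N Y -> bl (2 * (M * N)) (fun t => X t *m Y t).
Proof.
move=> hX hY; have M0 := bl_ge0 hX; have N0 := bl_ge0 hY.
have MN0 : 0 <= M * N by exact: mulr_ge0.
case: hX hY => [h1 h2] [k1 k2]; split=> [t|s t].
  apply: le_trans (nmM _ _) _; have := ler_pM (nm_ge0 (X t)) (nm_ge0 (Y t)) (h1 t) (k1 t).
  lra.
have -> : X s *m Y s - X t *m Y t = (X s - X t) *m Y s + X t *m (Y s - Y t).
  by rewrite mulmxBl mulmxBr addrA subrK.
apply: le_trans (nmD _ _) _.
have -> : 2 * (M * N) * `|s - t| = (M * `|s - t|) * N + M * (N * `|s - t|) by ring.
apply: lerD; apply: le_trans (nmM _ _) _; apply: ler_pM => //; exact: nm_ge0.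
Qed.

Lemma blZ M p q (c : R) (X : R -> 'M[R[i]]_(p, q)) : bl M X -> bl (`|c| * M) (fun t => c%:C *: X t).
Proof.
move=> [h1 h2]; split=> [t|s t].
  by rewrite nmZR; exact: ler_wpM2l.
by rewrite -scalerBr nmZR -mulrA; exact: ler_wpM2l.
Qed.

Lemma isDm_bl M N p q (X D : R -> 'M[R[i]]_(p, q)) :
  (forall x, isDm X x (D x)) -> (forall x, nm (X x) <= M) -> (forall x, nm (D x) <= N) ->
  bl (Num.max M N) X.
Proof.
move=> hX hM hN; split=> [t|s t]; first by rewrite le_max hM.
apply: le_trans (isDm_lipschitz hX hN s t) _; apply: ler_wpM2r => //.
by rewrite le_max lexx orbT.
Qed.

Lemma lin_ode_exists p q (A : R -> 'M[R[i]]_p) (B : R -> 'M[R[i]]_(p, q)) M X0 :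
  bl M A -> bl M B ->
  exists X, [/\ X 0 = X0, forall x, isDm X x (A x *m X x + B x) &
    exists c K, 0 <= c /\ 0 <= K /\ forall x, nm (X x) <= c * expR (K * `|x|)].
Proof.
wlog M1 : M / 1 <= M.
  move=> H hA hB; apply: (H (Num.max M 1)).
  - by rewrite le_max lexx orbT.
  - by apply: bl_weaken hA; rewrite le_max lexx.
  - by apply: bl_weaken hB; rewrite le_max lexx.
move=> hA hB; have cA := bl_ctm hA; have cB := bl_ctm hB.
have M0 : 0 < M by exact: lt_le_trans ltr01 M1.
have next Y : exists X, ctm Y -> X 0 = X0 /\ forall x, isDm X x (A x *m Y x + B x).
  have [cY|nY] := pselect (ctm Y); last by exists (fun=> 0).
  have cAY : ctm (fun x => A x *m Y x + B x).
    by move=> t; apply: climD; [exact: climM|exact: cB].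
  have [X [X00 hX]] := antiderivative cAY.
  exists (fun x => X0 + X x) => _; split; first by rewrite X00 addr0.
  by move=> x; apply: isDm_eq (isDmD (isDm_cst X0 x) (hX x)) _; rewrite add0r.
have [P hP] := choice next.
pose X k := iter k P (fun=> X0).
pose D k x := A x *m X k x + B x.
have cX k : ctm (X k).
  elim: k => [|k IH]; first by move=> t; exact: clim_cst.
  exact: isDm_ctm (hP _ IH).2.
have hX k x : isDm (X k.+1) x (D k x) by exact: (hP _ (cX k)).2.
have X00 k : X k 0 = X0 by case: k => [//|k]; exact: (hP _ (cX k)).1.
pose c := nm X0 + 1; have c0 : 0 < c by rewrite /c ltr_wpDl ?nm_ge0.
(* With the weight exp (2 M |x|) each Picard step gains a factor 1/2. *)
pose K := 2 * M.
have hd k x : nm (X k.+1 x - X k x) <= c * 2^-1 ^+ k * expR (K * `|x|).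
  elim: k x => [|k IH] x.
    rewrite expr0 mulr1 -[X 0 x](X00 1%N).
    apply: (isDm_exp_growth (X := X 1%N) (D := D 0) (ltW c0)) => // t.
    have h1 : nm (D 0 t) <= M * c.
      apply: le_trans (nmD _ _) _; rewrite /c mulrDr mulr1; apply: lerD; last exact: hB.1.
      apply: le_trans (nmM _ _) _; apply: ler_wpM2r; [exact: nm_ge0|exact: hA.1].
    apply: le_trans h1 _; rewrite mulrC ler_pM2l // -[leLHS]mulr1; apply: ler_pM => //.
    - exact: ltW.
    - by rewrite /K; lra.
    - by rewrite -expR0 ler_expR mulr_ge0 // mulr_ge0 // ltW.
  have hc : 0 <= c * 2^-1 ^+ k.+1 by rewrite mulr_ge0 ?exprn_ge0 ?invr_ge0 ?(ltW c0).
  have e0 : X k.+2 x - X k.+1 x = (X k.+2 x - X k.+1 x) - (X k.+2 0 - X k.+1 0).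
    by rewrite !X00 subrr subr0.
  rewrite e0; apply: (isDm_exp_growth (X := fun x => X k.+2 x - X k.+1 x)
     (D := fun x => D k.+1 x - D k x)) => // t.
    exact: isDmB.
  have -> : D k.+1 t - D k t = A t *m (X k.+1 t - X k t).
    by rewrite /D opprD addrACA subrr addr0 mulmxBr.
  apply: le_trans (nmM _ _) _.
  apply: (@le_trans _ _ (M * (c * 2^-1 ^+ k * expR (K * `|t|)))).
    apply: ler_pM => //; [exact: nm_ge0|exact: nm_ge0|exact: hA.1].
  rewrite exprS /K; lra.
pose W (x : R) := 3 * c * expR (K * `|x|).
have hW k x : nm (X k x) <= W x.
  have E1 : 1 <= expR (K * `|x|).
    by rewrite -expR0 ler_expR mulr_ge0 // mulr_ge0 // ltW.
  have : nm (X k x - X0) <= c * (2 - 2 * 2^-1 ^+ k) * expR (K * `|x|).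
    elim: k => [|k IH]; first by rewrite subrr nm0 expr0 mulr1 subrr mulr0 mul0r.
    apply: le_trans (nm_tri (X k x) _ _) _; apply: le_trans (lerD (hd k x) IH) _.
    rewrite exprS; lra.
  have h2 : c * (2 - 2 * 2^-1 ^+ k) * expR (K * `|x|) <= c * 2 * expR (K * `|x|).
    apply: ler_wpM2r; first exact: expR_ge0.
    by apply: ler_wpM2l; [exact: ltW|rewrite gerBl mulr_ge0 // exprn_ge0 // invr_ge0].
  move=> h1; have := nmD (X k x - X0) X0; rewrite subrK => h3.
  have h4 : nm X0 <= c * expR (K * `|x|).
    by rewrite -[leLHS]mulr1; apply: ler_pM => //; [exact: nm_ge0|rewrite /c lerDl].
  rewrite /W; lra.
have [G [GU oG]] := ultraFilterLemma (F := \oo) _.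
have hlim x : exists l, clim G (fun k => X k x) l.
  by apply: (@ultra_clim _ _ _ _ _ _ (W x)); apply: nearW => k; exact: hW.
have [g hg] := choice hlim.
(* G need not be invariant under shifts of the index; the shifted sequences have the same limit
   because consecutive iterates approach each other. *)
have hgS x k0 : clim G (fun k => X (k0 + k)%N x) (g x).
  elim: k0 => [|k0 IH]; first exact: hg.
  have h : clim G (fun k => X (k0.+1 + k)%N x - X (k0 + k)%N x) 0.
    apply: (clim_squeeze (g := fun k => c * 2^-1 ^+ k0 * expR (K * `|x|) * 2^-1 ^+ k)).
      apply: nearW => k; rewrite subr0 addSn; apply: le_trans (hd _ x) _.
      by rewrite exprD le_eqVlt; apply/orP; left; apply/eqP; ring.
    by move=> e e0; apply: oG; exact: half_pow_small.
  have -> : (fun k => X (k0.+1 + k)%N x) =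
      (fun k => X (k0.+1 + k)%N x - X (k0 + k)%N x + X (k0 + k)%N x).
    by apply/funext => k; rewrite subrK.
  by rewrite -[g x]add0r; exact: climD.
suff hD t : isDm g t (A t *m g t + B t).
  exists g; split=> //.
    by apply: clim_unique (hg 0) _; move=> e e0; apply: nearW => k; rewrite X00 subrr nm0.
  exists (3 * c), K; split; first by rewrite mulr_ge0 // ltW.
  split=> [|x]; first by rewrite mulr_ge0 // ltW.
  rewrite -[g x]subr0; apply: (clim_le (hg x)); apply: nearW => k.
  by rewrite subr0; exact: hW.
pose W1 : R := 3 * c * expR (K * (`|t| + 1)).
have hW1 k s : `|s - t| <= 1 -> nm (X k s) <= W1.
  move=> st; apply: le_trans (hW k s) _; apply: ler_wpM2l; first by rewrite mulr_ge0 // ltW.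
  rewrite ler_expR; apply: ler_wpM2l; first by rewrite mulr_ge0 // ltW.
  have -> : s = t + (s - t) by rewrite addrC subrK.
  by apply: le_trans (ler_normD _ _) _; rewrite lerD2l.
have hD1 k s : `|s - t| <= 1 -> nm (D k s) <= M * W1 + M.
  move=> st; apply: le_trans (nmD _ _) _; apply: lerD; last exact: hB.1.
  apply: le_trans (nmM _ _) _; apply: ler_pM (nm_ge0 _) (nm_ge0 _) (hA.1 _) _; exact: hW1.
have hL k s : `|s - t| <= 1 -> nm (X k.+1 s - X k.+1 t) <= (M * W1 + M) * `|s - t|.
  move=> st; have := @isDm_taylor R p q (X k.+1) (D k) 0 t (s - t) (M * W1 + M) (hX k).
  rewrite scaler0 subr0 [t + _]addrC subrK; apply => r rs; rewrite subr0; apply: hD1.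
  exact: le_trans st.
pose C := M * W1 + M * (M * W1 + M) + M.
have hDL k s : `|s - t| <= 1 -> nm (D k.+1 s - D k.+1 t) <= C * `|s - t|.
  move=> st.
  have -> : D k.+1 s - D k.+1 t = (A s - A t) *m X k.+1 s + A t *m (X k.+1 s - X k.+1 t) + (B s - B t).
    by rewrite /D opprD addrACA mulmxBl mulmxBr; congr (_ + _); rewrite addrA subrK.
  rewrite /C 2!mulrDl; apply: le_trans (nmD _ _) _; apply: lerD; last exact: hB.2.
  apply: le_trans (nmD _ _) _; apply: lerD; apply: le_trans (nmM _ _) _.
    rewrite -mulrA [W1 * _]mulrC mulrA.
    by apply: ler_pM (nm_ge0 _) (nm_ge0 _) (hA.2 _ _) (hW1 _ _ st).
  rewrite -mulrA; apply: ler_pM (nm_ge0 _) (nm_ge0 _) (hA.1 _) (hL _ _ st).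
have C0 : 0 <= C.
  have w0 : 0 <= W1 := le_trans (nm_ge0 _) (hW1 0 t _).
  by rewrite /C; have := mulr_ge0 (ltW M0) (w0 _); rewrite subrr normr0 => /(_ ler01) h;
    have := mulr_ge0 (ltW M0) h; have := mulr_ge0 (ltW M0) (ltW M0); lra.
(* From the second iterate on, the derivatives are Lipschitz near t with a constant independent of
   k, which gives the quadratic remainder. *)
apply: (isDm_limit (F := G) (f := fun k => X k.+2) (d := fun k => D k.+1 t) (eta := fun=> 0) (C := C)).
- apply: nearW => k h h1; rewrite add0r; apply: isDm_taylor (hX k.+1) _ => s sh.
  apply: le_trans (hDL k s (le_trans sh h1)) _; exact: ler_wpM2l.
- by move=> e e0; apply: nearW.
- move=> s; exact: (hgS s 2%N).
- apply: climD; last exact: clim_cst.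
  by apply: climM; [exact: clim_cst|exact: (hgS t 1%N)].
Qed.

End LinearODE.

(** * A priori estimates for bounded solutions *)

Section BoundedSolutions.
Variable R : realType.

Definition no_bounded_solution q p (A : R -> 'M[R[i]]_p) :=
  forall w : R -> 'M[R[i]]_(p, q), (forall x, isDm w x (A x *m w x)) ->
    (exists M, forall x, nm (w x) <= M) -> forall x, w x = 0.

(** A bounded inverse of d/dx - A on its range. Boundedness of [w] enters qualitatively only: its
    bound does not appear in the conclusion. *)
Definition apriori q p (A : R -> 'M[R[i]]_p) (C : R) :=
  forall (w D : R -> 'M[R[i]]_(p, q)) N, (forall x, isDm w x (D x)) ->
    (exists B, forall x, nm (w x) <= B) ->
    (forall x, nm (D x - A x *m w x) <= N) -> forall x, nm (w x) <= C * N.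

(** The squared modulus of an entry is its value at 0 times exp (2 Re z t), which is unbounded in
    one direction unless that value is 0. *)
Lemma scalar_bounded_solution p q (z : R[i]) (w : R -> 'M[R[i]]_(p, q)) :
  Re z != 0 -> (forall x, isDm w x (z *: w x)) ->
  (exists M, forall x, nm (w x) <= M) -> forall x, w x = 0.
Proof.
move=> z0 hw [M hM] x; apply/matrixP => i j; rewrite mxE.
pose s t := Re (w t i j) * Re (w t i j) + Im (w t i j) * Im (w t i j).
pose h t := expR (- (2 * Re z) * t) * s t.
have hd (t : R) : is_derive t 1 h 0.
  have [h1 h2] := hw t i j.
  have := derM (is_derive_exp (- (2 * Re z)) t) (derD (derM h1 h1) (derM h2 h2)).
  move=> H; apply: der_eq H _; rewrite !mxE Re_mul Im_mul; ring.
have M0 : 0 <= M := le_trans (nm_ge0 _) (hM 0).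
have sM t : s t <= 2 * M ^+ 2.
  have h1 : `|Re (w t i j)| <= M by exact: le_trans (Re_le_cn _) (le_trans (nm_entry _ _ _) (hM t)).
  have h2 : `|Im (w t i j)| <= M by exact: le_trans (Im_le_cn _) (le_trans (nm_entry _ _ _) (hM t)).
  rewrite /s -!expr2 -(real_normK (num_real (Re _))) -(real_normK (num_real (Im _))).
  have := lerXn2r 2 (normr_ge0 _) M0 h1; have := lerXn2r 2 (normr_ge0 _) M0 h2; lra.
have hs t : expR (2 * Re z * t) * s 0 = s t.
  have : h 0 = h t by exact: is_derive_0_is_cst.
  rewrite /h mulr0 expR0 mul1r => ->; rewrite mulrA -expRD mulNr subrr expR0 mul1r //.
have s00 : s 0 = 0.
  apply/eqP; rewrite eq_le; apply/andP; split; last by rewrite /s -!expr2 addr_ge0 ?sqr_ge0.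
  rewrite leNgt; apply/negP => s0.
  (* At this time the exponent equals 2 M^2 / s 0, and exp y >= 1 + y already exceeds the bound on
     s. *)
  pose t := (2 * M ^+ 2 / s 0) / (2 * Re z).
  have e : 2 * Re z * t = 2 * M ^+ 2 / s 0 by rewrite /t mulrC divfK // mulf_neq0.
  have := sM t; rewrite -hs e => H.
  have := expR_ge1Dx (2 * M ^+ 2 / s 0); rewrite -(ler_pM2r s0) => H2.
  have := le_trans H2 H; rewrite mulrDl mul1r divfK ?gt_eqF //; lra.
have : s x = 0 by rewrite -hs s00 mulr0.
rewrite /s -!expr2 => /eqP; rewrite paddr_eq0 ?sqr_ge0 // !sqrf_eq0 => /andP[/eqP h1 /eqP h2].
exact: complex_ext.
Qed.

(** Cayley-Hamilton instead of a Jordan form. The characteristic polynomial is split into linear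
    factors, removed one by one: if (A - z) P(A) v = 0, then u = P(A) v solves u' = z u and is
    bounded, hence vanishes. *)
Lemma hyperbolic_no_bounded_solution q p (A : 'M[R[i]]_p) :
  (forall nu, eigenvalue A nu -> Re nu != 0) -> no_bounded_solution q (fun=> A).
Proof.
case: p A => [|p] A hA w hw [M hM] x; first by apply/matrixP => -[].
have [r hr] := closed_field_poly_normal (char_poly A).
rewrite (monicP (char_poly_monic A)) scale1r in hr.
have hre z : z \in r -> Re z != 0.
  by move=> zr; apply: hA; rewrite eigenvalue_root_char hr root_prod_XsubC.
have := Cayley_Hamilton A; rewrite {}hr => CH.
pose P s := horner_mx A (\prod_(z <- s) ('X - z%:P)).
suff main s : {subset s <= r} -> forall w : R -> 'M[R[i]]_(p.+1, q),
    (forall x, isDm w x (A *m w x)) -> (exists M, forall x, nm (w x) <= M) ->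
    (forall x, P s *m w x = 0) -> forall x, w x = 0.
  by apply: (main r) => //; [exists M|move=> t; rewrite /P CH mul0mx].
elim: s => [|z s IH] sr v hv [B hB] hP t.
  by have := hP t; rewrite /P big_nil rmorph1 mul1mx.
pose u t := P s *m v t.
have comm : P s *m A = A *m P s.
  by rewrite -{1 2}(horner_mx_X A) /P -!/(GRing.mul _ _) -!rmorphM mulrC.
have hu y : isDm u y (A *m u y).
  by apply: isDm_eq (isDmMl (P s) (hv y)) _; rewrite !mulmxA comm.
have zu y : A *m u y = z *: u y.
  have := hP y; rewrite /P big_cons rmorphM /= rmorphB /= horner_mx_X horner_mx_C -mulmxA.
  by rewrite -/(P s) -/(u y) mulmxBl mul_scalar_mx => /eqP; rewrite subr_eq0 => /eqP.
apply: (IH _ v hv _ _ t); [|by exists B|].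
  by move=> y ys; apply: sr; rewrite inE ys orbT.
apply: (@scalar_bounded_solution _ _ z u).
- by apply: hre; apply: sr; rewrite inE eqxx.
- by move=> y; rewrite -zu.
- exists (nm (P s) * B) => y; apply: le_trans (nmM _ _) _.
  by apply: ler_wpM2l; [exact: nm_ge0|exact: hB].
Qed.

(* Compactness: a sequence violating the estimate, translated to where it is
   largest and normalized, has a limit along an ultrafilter, which is a nonzero
   bounded solution of a limit equation. *)
Lemma apriori_of_limits (I : Type) (F : set_system I) {FF : Filter F} q p
    (A : I -> R -> 'M[R[i]]_p) M :
  (\forall k \near F, bl M (A k)) ->
  (forall (G : set_system (I * R)) (Ai : R -> 'M[R[i]]_p), UltraFilter G ->
     (forall P, F P -> G [set kx | P kx.1]) ->
     (forall t, clim G (fun kx => A kx.1 (kx.2 + t)) (Ai t)) ->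
     no_bounded_solution q Ai) ->
  exists C, 0 < C /\ \forall k \near F, apriori q (A k) C.
Proof.
move=> hbl hlim; apply: contrapT => nC.
have {}nC j P : F P -> exists k, [/\ P k, bl M (A k) & ~ apriori q (A k) j.+1%:R].
  move=> FP; apply: contrapT => h; apply: nC; exists j.+1%:R; split=> //.
  apply: filterS2 FP hbl => k Pk bk; apply: contrapT => na; apply: h.
  by exists k.
pose J := (I * R * ((R -> 'M[R[i]]_(p, q)) * R))%type.
(* Normalized counterexamples (k, x, (w, eta)) with k in c.1, defect eta at most 1 / (c.2 + 1), sup
   norm at most 1 and value at least 1/2 at the base point x. As F is any filter, these sets form a
   filter base in place of a sequence. *)
pose S (c : set I * nat) : set J := [set z | [/\ c.1 z.1.1, bl M (A z.1.1),
   z.2.2 <= c.2.+1%:R^-1, 2^-1 <= nm (z.2.1 z.1.2) &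
   (forall t, nm (z.2.1 t) <= 1) /\ exists D : R -> 'M[R[i]]_(p, q),
   (forall t, isDm z.2.1 t (D t)) /\
    forall t, nm (D t - A z.1.1 t *m z.2.1 t) <= z.2.2]].
pose B0 : set (set I * nat) := [set c | F c.1].
have F0 : Filter (filter_from B0 S).
  apply: filter_from_filter; first by exists (setT, 0%N); exact: filterT.
  move=> [P j] [Q l] FP FQ; exists (P `&` Q, maxn j l); first exact: filterI.
  have hm a b : (b <= a)%N -> (a.+1%:R^-1 : R) <= b.+1%:R^-1.
    by move=> ba; rewrite lef_pV2 ?posrE // ler_nat.
  move=> z [[z1 z2] z3 z4 z5 z6]; split; split=> //; apply: le_trans z4 _; apply: hm.
    exact: leq_maxl.
  exact: leq_maxr.
have {}F0 : ProperFilter (filter_from B0 S).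
  apply: filter_from_proper => -[P j] FP; have [k [Pk bk nk]] := nC j P FP.
  have [w [D [N [hw [Bw hBw] hD [x hx]]]]] : exists (w D : R -> 'M[R[i]]_(p, q)) (N : R), [/\ (forall x, isDm w x (D x)),
      (exists B, forall x, nm (w x) <= B), (forall x, nm (D x - A k x *m w x) <= N) &
      exists x, j.+1%:R * N < nm (w x)].
    apply: contrapT => h; apply: nk => w D N h1 h2 h3 x; rewrite leNgt; apply/negP => h4.
    by apply: h; exists w, D, N; split=> //; exists x.
  have N0 : 0 <= N := le_trans (nm_ge0 _) (hD 0).
  pose E := range (fun x => nm (w x)).
  have hE : has_sup E.
    by split; [exists (nm (w 0)), 0|exists Bw => _ [y _ <-]; exact: hBw].
  have sE y : nm (w y) <= sup E by apply: sup_upper_bound => //; exists y.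
  have s0 : j.+1%:R * N < sup E by exact: lt_le_trans hx (sE x).
  have sp : 0 < sup E by apply: le_lt_trans s0; rewrite mulr_ge0.
  (* The supremum need not be attained, so the base point only reaches half of it. *)
  have [_ [x0 _ <-] hx0] : exists2 y, E y & sup E - sup E / 2 < y.
    by apply: sup_adherent => //; rewrite divr_gt0.
  pose a := (sup E)^-1; have a0 : 0 < a by rewrite invr_gt0.
  exists (k, x0, (fun t => a%:C *: w t, a * N)); split=> //=.
  - by rewrite /a mulrC ler_pdivrMr // ler_pdivlMl // ltW.
  - rewrite nmZR (gtr0_norm a0) /a ler_pdivlMl // mulrC; lra.
  - split=> [t|]; first by rewrite nmZR (gtr0_norm a0) /a ler_pdivrMl // mulr1.
    exists (fun t => a%:C *: D t); split=> t; first exact: isDmZc.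
    rewrite -scalemxAr -scalerBr nmZR (gtr0_norm a0); apply: ler_wpM2l => //; exact: ltW.
have [G [GU FG]] := ultraFilterLemma F0.
have GS P j : F P -> G (S (P, j)) by move=> FP; apply: FG; exists (P, j).
have G0 : G (S (setT, 0%N)) by apply: GS; exact: filterT.
have GbM : G [set z | bl M (A z.1.1)] by apply: filterS G0 => z [].
have M0 : 0 <= M by have [z] := filter_ex GbM; exact: bl_ge0.
have hAi t : exists l, clim G (fun z => A z.1.1 (z.1.2 + t)) l.
  by apply: (ultra_clim (M := M)); apply: filterS GbM => z [].
have [Ai hA] := choice hAi.
have hwi t : exists l, clim G (fun z => z.2.1 (z.1.2 + t)) l.
  by apply: (ultra_clim (M := 1)); apply: filterS G0 => z [_ _ _ _ []].
have [wi hw] := choice hwi.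
have NB : no_bounded_solution q Ai.
  apply: (hlim ((fun z : J => z.1) @ G)).
  - exact: ultra_fmap.
  - move=> P FP; have H : G [set z | P z.1.1] by apply: filterS (GS P 0%N FP) => z [].
    exact: H.
  - exact: hA.
have small (e : R) : 0 < e -> G [set z | z.2.2 < e].
  move=> e0; have [j hj] : exists j, (j.+1%:R^-1 : R) < e.
    exact: filter_ex (near_infty_natSinv_lt (PosNum e0)).
  by apply: filterS (GS setT j filterT) => z [_ _ h _ _]; exact: le_lt_trans h hj.
have hwi' t : isDm wi t (Ai t *m wi t).
  apply: (isDm_limit (F := G) (f := fun z t => z.2.1 (z.1.2 + t))
    (d := fun z => A z.1.1 (z.1.2 + t) *m z.2.1 (z.1.2 + t)) (eta := fun z => z.2.2)
    (C := M + M * (M + 1))) => //; last exact: climM.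
  apply: filterS2 (small 1 ltr01) G0 => -[[k x] [w eta]] /= eta1 [_ /= bk _ _ [w1 [D [hD hDe]]]] h h1.
  have D1 y : nm (D y) <= M + 1.
    have -> : D y = D y - A k y *m w y + A k y *m w y by rewrite subrK.
    apply: le_trans (nmD _ _) _; rewrite addrC; apply: lerD.
      apply: le_trans (nmM _ _) _; rewrite -[leRHS]mulr1.
      apply: ler_pM (nm_ge0 _) (nm_ge0 _) (bk.1 _) (w1 _).
    exact: le_trans (hDe y) (ltW eta1).
  rewrite addrA; apply: (isDm_taylor hD) => s sh.
  have -> : D s - A k (x + t) *m w (x + t) = (D s - A k s *m w s) +
      ((A k s - A k (x + t)) *m w s + A k (x + t) *m (w s - w (x + t))).
    rewrite mulmxBl mulmxBr.
    by rewrite [A k s *m _ - _ + _]addrA subrK [RHS]addrA subrK.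
  apply: le_trans (nmD _ _) _; apply: lerD => //.
  have hM : forall c, 0 <= c -> c * `|s - (x + t)| <= c * `|h| by move=> c c0; exact: ler_wpM2l.
  apply: le_trans (nmD _ _) _; rewrite mulrDl; apply: lerD; apply: le_trans (nmM _ _) _.
    apply: le_trans (hM M M0); rewrite -[leRHS]mulr1.
    by apply: ler_pM (nm_ge0 _) (nm_ge0 _) (bk.2 _ _) (w1 _).
  rewrite -mulrA; apply: ler_pM (nm_ge0 _) (nm_ge0 _) (bk.1 _) _.
  apply: le_trans (isDm_lipschitz hD D1 _ _) (hM _ _); lra.
have w0 := NB wi hwi' _ 0.
have : wi 0 = 0.
  apply: w0; exists 1 => t; rewrite -[wi t]subr0; apply: clim_le (hw t) _.
  by apply: filterS G0 => z [_ _ _ _ []] h _; rewrite subr0.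
move=> e0; have := hw 0 2^-1; rewrite e0 invr_gt0 ltr0n => /(_ isT) h.
have [z [h1 [_ _ _ h2 _]]] := filter_ex (filterI h G0).
by move: h1; rewrite /= subr0 addr0; apply/negP; rewrite -leNgt.
Qed.

(** Absorption: as f is known to be bounded, half of its supremum can be moved to the left-hand
    side. *)
Lemma bound_halving (T : Type) (t0 : T) (f : T -> R) c :
  (exists b, forall t, f t <= b) ->
  (forall b, (forall t, f t <= b) -> forall t, f t <= b / 2 + c) ->
  forall t, f t <= 2 * c.
Proof.
move=> [b hb] h t; pose E := range f.
have hE : has_sup E by split; [exists (f t0), t0|exists b => _ [y _ <-]].
have sE y : f y <= sup E by apply: sup_upper_bound => //; exists y.
have : sup E <= sup E / 2 + c.
  by apply: ge_sup; [exact: hE.1|move=> _ [y _ <-]; exact: h].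
move=> h1; apply: le_trans (sE t) _; lra.
Qed.

(* Multiplying by the weight 1 / (2 cosh (kappa (x - x0))) turns the a priori
   estimate into a localized one. *)
Lemma apriori_pointwise q p (A : R -> 'M[R[i]]_p) C kappa eta N x0
    (w D : R -> 'M[R[i]]_(p, q)) :
  apriori q A C -> 0 < C -> 0 <= kappa -> 0 <= eta -> 0 <= N -> C * (kappa + eta) <= 2^-1 ->
  (forall x, isDm w x (D x)) -> (exists B, forall x, nm (w x) <= B) ->
  (forall x, nm (D x - A x *m w x) <= eta * nm (w x) + N * expR (kappa * `|x - x0|)) ->
  nm (w x0) <= 4 * C * N.
Proof.
move=> hA C0 k0 eta0 N0 hC hw [B hB] hD.
pose E x := expR (kappa * (x - x0)) + expR (- kappa * (x - x0)).
have Ep x : 0 < E x by rewrite addr_gt0 ?expR_gt0.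
pose g x := (E x)^-1.
have gp x : 0 < g x by rewrite invr_gt0.
pose dE x := kappa * (expR (kappa * (x - x0)) - expR (- kappa * (x - x0))).
have hE (x : R) : is_derive x 1 E (dE x).
  have h k : is_derive x 1 (fun t => expR (k * (t - x0))) (k * expR (k * (x - x0))).
    exact: (is_derive_shifted (is_derive_exp k (x - x0))).
  by apply: der_eq (derD (h kappa) (h (- kappa))) _; rewrite /dE; ring.
pose dg x := - (dE x * g x * g x).
have hg (x : R) : is_derive x 1 g (dg x).
  have := @is_deriveV R E x (dE x) 1 _ (hE x); rewrite gt_eqF // => /(_ isT).
  move=> H; apply: der_eq H _; rewrite /dg /g /GRing.scale /= mulNr expr2 invfM.
  by congr (- _); rewrite mulrC mulrA.
have hdg x : `|dg x| <= kappa * g x.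
  rewrite /dg normrN !normrM (gtr0_norm (gp x)); apply: ler_wpM2r; first exact: ltW.
  rewrite /g ler_pdivrMr // (ger0_norm k0); apply: ler_wpM2l => //.
  by apply: le_trans (ler_normB _ _) _; rewrite !ger0_norm ?expR_ge0.
have gN x : g x * expR (kappa * `|x - x0|) <= 1.
  rewrite /g ler_pdivrMl // mulr1 /E; have [h|h] := leP 0 (x - x0).
    by rewrite ger0_norm // lerDl expR_ge0.
  by rewrite ltr0_norm // mulrN -mulNr lerDr expR_ge0.
pose Y x := (g x)%:C *: w x.
pose DY x := (dg x)%:C *: w x + (g x)%:C *: D x.
have hY x : isDm Y x (DY x) by apply: isDmZ.
have nY x : nm (Y x) = g x * nm (w x) by rewrite nmZR gtr0_norm.
have g1 x : g x <= 1.
  apply: le_trans (gN x); rewrite -[leLHS]mulr1; apply: ler_wpM2l; first exact: ltW.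
  by rewrite -expR0 ler_expR mulr_ge0.
have bY : exists b, forall x, nm (Y x) <= b.
  exists B => x; rewrite nY; apply: le_trans (hB x).
  by rewrite -[leRHS]mul1r; apply: ler_wpM2r; [exact: nm_ge0|exact: g1].
(* The logarithmic derivative of the weight costs kappa and the perturbation costs eta; as C (kappa
   + eta) <= 1/2, both are absorbed. *)
have H : forall x, nm (Y x) <= 2 * (C * N).
  apply: (bound_halving x0 bY) => b hb x.
  apply: le_trans (hA Y DY ((kappa + eta) * b + N) hY bY _ x) _.
    move=> y; have -> : DY y - A y *m Y y = (dg y)%:C *: w y + (g y)%:C *: (D y - A y *m w y).
      by rewrite /DY /Y -scalemxAr -addrA -scalerBr.
    apply: le_trans (nmD _ _) _; rewrite !nmZR (gtr0_norm (gp y)).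
    rewrite mulrDl -addrA; apply: lerD.
      apply: le_trans (ler_wpM2r (nm_ge0 _) (hdg y)) _.
      by rewrite -mulrA -nY; exact: ler_wpM2l.
    apply: le_trans (ler_wpM2l (ltW (gp y)) (hD y)) _; rewrite mulrDr; apply: lerD.
      by rewrite mulrCA -nY; exact: ler_wpM2l.
    by rewrite mulrCA -[leRHS]mulr1; exact: ler_wpM2l.
  rewrite mulrDr lerD2r mulrA; have b0 : 0 <= b := le_trans (nm_ge0 _) (hb x0).
  by rewrite [b / 2]mulrC; exact: ler_wpM2r.
(* The weight at x0 is 1/2, which turns 2 C N into 4 C N. *)
have E0 : E x0 = 2 by rewrite /E subrr !mulr0 expR0.
have := H x0; rewrite nY /g E0; lra.
Qed.

End BoundedSolutions.

(** * Periodic solutions of the Riccati equation *)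

Section Riccati.
Variable R : realType.

Lemma periodic_int (T : Type) (f : R -> T) P : (forall x, f (x + P) = f x) ->
  forall (k : int) x, f (x + k%:~R * P) = f x.
Proof.
move=> fP; have nat_case (k : nat) x : f (x + k%:R * P) = f x.
  elim: k x => [|k IH] x; first by rewrite mul0r addr0.
  by rewrite -natr1 mulrDl mul1r addrA fP IH.
case=> k x; first exact: nat_case.
by rewrite NegzE mulrNz mulNr -(nat_case k.+1) subrK.
Qed.

Lemma fold_period (P x : R) : 0 < P -> exists k : int, 0 <= x + k%:~R * P <= P.
Proof.
move=> P0; exists (- Num.floor (x / P)).
have /andP[h1 h2] := floor_itv (x / P).
rewrite mulrNz mulNr; move: h1 h2; rewrite ler_pdivlMr // ltr_pdivrMr // intrD mulrDl mul1r.
lra.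
Qed.

Lemma evolution_exists p (A : R -> 'M[R[i]]_p) M : bl M A ->
  exists T, is_evolution A T.
Proof.
move=> hA; have hM := bl_ge0 hA.
have h y : exists X : R -> 'M[R[i]]_p, X y = 1%:M /\ lin_ode A (fun=> 0) X.
  have hAy : bl M (fun t => A (t + y)).
    split=> [t|s t]; first exact: hA.1.
    by apply: le_trans (hA.2 _ _) _; rewrite opprD addrACA subrr addr0.
  have h0 : bl M (fun=> 0 : 'M[R[i]]_p).
    by split=> [t|s t]; rewrite ?subrr nm0 ?mulr_ge0.
  have [X [X0 hX _]] := lin_ode_exists (1%:M) hAy h0.
  exists (fun t => X (t - y)); split; first by rewrite subrr X0.
  apply/lin_odeP => x; apply: isDm_shift.
  by have := hX (x - y); rewrite subrK.
have [T hT] := choice h.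
by exists (fun x y => T y x).
Qed.

(** Fredholm alternative: a kernel vector of the identity minus the monodromy matrix starts a
    periodic, hence bounded, homogeneous solution, and the estimate with right-hand side 0 forces it
    to vanish. The same estimate bounds the solution found. *)
Lemma periodic_exists q p (A : R -> 'M[R[i]]_p) (B : R -> 'M[R[i]]_(p, q)) M P C N :
  (0 < q)%N -> 0 < P -> bl M A -> bl M B ->
  (forall x, A (x + P) = A x) -> (forall x, B (x + P) = B x) ->
  apriori q A C -> (forall x, nm (B x) <= N) ->
  exists X : R -> 'M[R[i]]_(p, q), [/\ forall x, isDm X x (A x *m X x + B x),
    forall x, X (x + P) = X x & forall x, nm (X x) <= C * N].
Proof.
move=> q0 P0 hA hB PA PB hC hN.
have per_bounded r (X : R -> 'M[R[i]]_(p, r)) : (forall x, X (x + P) = X x) ->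
    (exists c K, 0 <= c /\ 0 <= K /\ forall x, nm (X x) <= c * expR (K * `|x|)) ->
    exists B, forall x, nm (X x) <= B.
  move=> PX [c [K [c0 [K0 hX]]]]; exists (c * expR (K * P)) => x.
  have [k /andP[k1 k2]] := fold_period x P0.
  rewrite -(periodic_int PX k x); apply: le_trans (hX _) _.
  apply: ler_wpM2l => //; rewrite ler_expR; apply: ler_wpM2l => //.
  by rewrite ger0_norm.
have per_unique r (X : R -> 'M[R[i]]_(p, r)) (E : R -> 'M[R[i]]_(p, r)) :
    (forall x, E (x + P) = E x) ->
    (forall x, isDm X x (A x *m X x + E x)) -> X P = X 0 -> forall x, X (x + P) = X x.
  move=> PE hX XP x; apply/eqP; rewrite -subr_eq0; apply/eqP.
  apply: (@lin_ode_unique R p r A (fun t => X (t + P) - X t) M 0 hA.1); last first.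
    by rewrite add0r XP subrr.
  move=> t; apply: isDm_eq (isDmB (isDm_shift (hX (t + P))) (hX t)) _.
  by rewrite PA PE opprD addrACA subrr addr0 mulmxBr.
have h0 r : bl M (fun=> 0 : 'M[R[i]]_(p, r)).
  by split=> [t|s t]; rewrite ?subrr nm0 // ?mulr_ge0 // (bl_ge0 hA).
have [Phi [Phi0 hPhi bPhi]] := lin_ode_exists (1%:M) hA (h0 p).
have [Y [Y0 hY bY]] := lin_ode_exists 0 hA hB.
pose M0 := 1%:M - Phi P.
have hU : M0 \in unitmx.
  rewrite unitmxE unitfE -det_tr; apply/negP => /det0P[v v0 vM].
  have vc : M0 *m v^T = 0 by apply: trmx_inj; rewrite trmx_mul trmxK trmx0.
  (* The kernel vector is copied into q columns because the estimate is stated for matrices with q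
     columns; a single column gives it back. *)
  pose w x := Phi x *m (v^T *m (const_mx 1 : 'M[R[i]]_(1, q))).
  have hw x : isDm w x (A x *m w x).
    by apply: isDm_eq (isDmMr _ (hPhi x)) _; rewrite addr0 /w !mulmxA.
  have Pw : forall x, w (x + P) = w x.
    apply: (per_unique _ _ (fun=> 0)) => // [x|].
      by rewrite addr0.
    have : Phi P *m v^T = v^T.
      by apply/eqP; rewrite eq_sym -subr_eq0 -{1}[v^T]mul1mx -mulmxBl vc.
    by rewrite /w !mulmxA => ->; rewrite Phi0 mul1mx.
  have bw : exists B, forall x, nm (w x) <= B.
    apply: (per_bounded _ _ Pw); case: bPhi => c [K [c0 [K0 h]]].
    exists (c * nm (v^T *m (const_mx 1 : 'M[R[i]]_(1, q)))), K.
    split; first by rewrite mulr_ge0 // nm_ge0.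
    split=> // x; apply: le_trans (nmM _ _) _; rewrite mulrAC.
    by apply: ler_wpM2r; [exact: nm_ge0|exact: h].
  have w0 : w 0 = 0.
    apply: nm_eq0; apply/eqP; rewrite eq_le nm_ge0 andbT.
    have := hC w _ 0 hw bw _ 0; rewrite mulr0; apply=> x.
    by rewrite subrr nm0.
  move/eqP: v0; apply; apply/matrixP => i j.
  have := congr1 (fun X : 'M[R[i]]_(p, q) => X j (Ordinal q0)) w0.
  rewrite /w Phi0 mul1mx !mxE big_ord1 !mxE mulr1 => <-.
  by rewrite (ord1 i).
(* The initial value for which variation of constants closes up after one period. *)
pose c0 := invmx M0 *m Y P.
pose X x := Phi x *m c0 + Y x.
have hX x : isDm X x (A x *m X x + B x).
  apply: isDm_eq (isDmD (isDmMr c0 (hPhi x)) (hY x)) _.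
  by rewrite addr0 addrA mulmxDr mulmxA.
have XP : X P = X 0.
  have : M0 *m c0 = Y P by rewrite /c0 mulmxA mulmxV // mul1mx.
  by rewrite /X Phi0 Y0 mul1mx addr0 => <-; rewrite mulmxBl mul1mx addrC subrK.
have PX := per_unique _ _ _ PB hX XP.
exists X; split=> // x.
apply: (hC X _ N hX) => [|y]; last by rewrite addrAC subrr add0r.
apply: (per_bounded _ _ PX).
case: bPhi => c [K [cp [K0 h]]]; case: bY => c' [K' [cp' [K0' h']]].
exists (c * nm c0 + c'), (K + K'); split; first by rewrite addr_ge0 // mulr_ge0 // nm_ge0.
split=> [|y]; first exact: addr_ge0.
apply: le_trans (nmD _ _) _; rewrite mulrDl; apply: lerD.
  apply: le_trans (nmM _ _) _; rewrite [c * _]mulrC -mulrA mulrC; apply: ler_wpM2l; first exact: nm_ge0.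
  apply: le_trans (h y) _; apply: ler_wpM2l => //.
  by rewrite ler_expR; apply: ler_wpM2r => //; rewrite lerDl.
apply: le_trans (h' y) _; apply: ler_wpM2l => //.
by rewrite ler_expR; apply: ler_wpM2r => //; rewrite lerDr.
Qed.

(** Iteration with the quadratic term frozen, each step being a linear periodic problem. The first
    smallness condition keeps the ball of radius r invariant, the second makes the step a
    contraction with factor 1/2. *)
Lemma riccati_exists q p (A : R -> 'M[R[i]]_p) (B : R -> 'M[R[i]]_(p, q))
    (A1 : R -> 'M[R[i]]_q) (A2 : R -> 'M[R[i]]_(q, p)) M P C s r :
  (0 < q)%N -> 0 < P -> 0 < C -> 0 <= s -> 0 <= r ->
  bl M A -> bl M B -> bl M A1 -> bl M A2 ->
  (forall x, A (x + P) = A x) -> (forall x, B (x + P) = B x) ->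
  (forall x, A1 (x + P) = A1 x) -> (forall x, A2 (x + P) = A2 x) ->
  apriori q A C ->
  C * (M + s * (M * r + M * r * r)) <= r -> C * (s * (M * (1 + 2 * r))) <= 2^-1 ->
  exists (U : R -> 'M[R[i]]_(p, q)) L, [/\ bl L U, forall x, U (x + P) = U x,
    forall x, nm (U x) <= r &
    forall x, isDm U x (A x *m U x + (B x - s%:C *: (U x *m A1 x + U x *m A2 x *m U x)))].
Proof.
move=> q0 P0 C0 s0 r0 hA hB h1 h2 PA PB P1 P2 hC hr hs.
have M0 := bl_ge0 hA.
pose Q (U : R -> 'M[R[i]]_(p, q)) x := U x *m A1 x + U x *m A2 x *m U x.
pose N (U : R -> 'M[R[i]]_(p, q)) x := B x - s%:C *: Q U x.
pose n0 := M + s * (M * r + M * r * r).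
pose L := Num.max r (M * r + n0).
pose Inv (U : R -> 'M[R[i]]_(p, q)) := [/\ bl L U, forall x, U (x + P) = U x & forall x, nm (U x) <= r].
have hNle U : (forall x, nm (U x) <= r) -> forall x, nm (N U x) <= n0.
  move=> Ur x; apply: le_trans (nmB _ _) _; apply: lerD; first exact: hB.1.
  rewrite nmZR (ger0_norm s0); apply: ler_wpM2l => //.
  apply: le_trans (nmD _ _) _; apply: lerD; apply: le_trans (nmM _ _) _.
    by rewrite mulrC; apply: ler_pM (nm_ge0 _) (nm_ge0 _) (h1.1 _) (Ur _).
  apply: ler_pM (nm_ge0 _) (nm_ge0 _) _ (Ur _); apply: le_trans (nmM _ _) _.
  by rewrite mulrC; apply: ler_pM (nm_ge0 _) (nm_ge0 _) (h2.1 _) (Ur _).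
pose K := M + `|s| * (2 * (L * M) + 2 * (2 * (L * M) * L)).
have hNbl U : bl L U -> bl K (N U).
  move=> hU; apply: blD => //; apply: blN; apply: blZ; apply: blD.
    exact: blM.
  by apply: blM => //; exact: blM.
have hNP U : (forall x, U (x + P) = U x) -> forall x, N U (x + P) = N U x.
  by move=> PU x; rewrite /N /Q PB PU P1 P2.
have next U : exists X, Inv U -> Inv X /\ forall x, isDm X x (A x *m X x + N U x).
  have [[hU PU Ur]|] := pselect (Inv U); last by exists (fun=> 0).
  have hA' : bl (M + K) A by apply: bl_weaken hA; rewrite lerDl (bl_ge0 (hNbl U hU)).
  have hN' : bl (M + K) (N U) by apply: bl_weaken (hNbl U hU); rewrite lerDr.
  have [X [hX PX nX]] := periodic_exists q0 P0 hA' hN' PA (hNP U PU) hC (hNle U Ur).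
  have Xr x : nm (X x) <= r by exact: le_trans (nX x) hr.
  exists X => _; split=> //; split=> //.
  apply: (isDm_bl hX) => // x; apply: le_trans (nmD _ _) _; apply: lerD; last exact: hNle.
  by apply: le_trans (nmM _ _) _; exact: ler_pM (nm_ge0 _) (nm_ge0 _) (hA.1 _) (Xr _).
have [S hS] := choice next.
pose U k := iter k S (fun=> 0).
have L0 : 0 <= L by rewrite le_max r0.
have hI k : Inv (U k).
  elim: k => [|k IH]; last exact: (hS _ IH).1.
  by split=> // [|x]; [split=> [x|x t]; rewrite ?subrr nm0 ?mulr_ge0|rewrite nm0].
have hU k x : isDm (U k.+1) x (A x *m U k.+1 x + N (U k) x) by exact: (hS _ (hI k)).2.
have Ur k x : nm (U k x) <= r by case: (hI k).
have hd k : forall x, nm (U k.+1 x - U k x) <= 2 * r * 2^-1 ^+ k.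
  elim: k => [|k IH] x.
    by rewrite expr0 mulr1; apply: le_trans (nmB _ _) _; have := Ur 1%N x; have := Ur 0%N x; lra.
  set b := 2 * r * 2^-1 ^+ k in IH.
  apply: le_trans (hC (fun x => U k.+2 x - U k.+1 x) _ (s * (M * (1 + 2 * r)) * b) (fun x => isDmB (hU k.+1 x) (hU k x)) _ _ x) _.
  - by exists (r + r) => y; apply: le_trans (nmB _ _) _; exact: lerD.
  - move=> y.
    have -> : A y *m U k.+2 y + N (U k.+1) y - (A y *m U k.+1 y + N (U k) y)
      - A y *m (U k.+2 y - U k.+1 y) = - (s%:C *: (Q (U k.+1) y - Q (U k) y)).
      rewrite mulmxBr /N scalerBr.
      move: (A y *m _) (A y *m _) (s%:C *: _) (s%:C *: _) (B y) => a1 a2 a3 a4 a5.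
      by apply/matrixP => i j; rewrite !mxE; ring.
    rewrite nmN nmZR (ger0_norm s0) -mulrA; apply: ler_wpM2l => //.
    have -> : Q (U k.+1) y - Q (U k) y = (U k.+1 y - U k y) *m A1 y +
       ((U k.+1 y - U k y) *m A2 y *m U k.+1 y + U k y *m A2 y *m (U k.+1 y - U k y)).
      rewrite /Q opprD addrACA !mulmxBl !mulmxBr; congr (_ + _).
      by rewrite addrA subrK.
    have -> : M * (1 + 2 * r) * b = b * M + (b * M * r + r * M * b) by ring.
    have b0 : 0 <= b := le_trans (nm_ge0 _) (IH y).
    have nM a b1 (X : 'M[R[i]]_(p, q)) (Z : 'M[R[i]]_(q, p)) : nm X <= a -> nm Z <= b1 -> nm (X *m Z) <= a * b1.
      by move=> ha hb; apply: le_trans (nmM _ _) _; exact: ler_pM (nm_ge0 _) (nm_ge0 _) ha hb.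
    apply: le_trans (nmD _ _) _; apply: lerD.
      by apply: le_trans (nmM _ _) _; exact: ler_pM (nm_ge0 _) (nm_ge0 _) (IH y) (h1.1 y).
    apply: le_trans (nmD _ _) _; apply: lerD; apply: le_trans (nmM _ _) _.
      by apply: ler_pM (nm_ge0 _) (nm_ge0 _) _ (Ur _ _); apply: nM => //; exact: h2.1.
    by apply: ler_pM (nm_ge0 _) (nm_ge0 _) _ (IH y); apply: nM => //; exact: h2.1.
  have b0 : 0 <= b := le_trans (nm_ge0 _) (IH 0).
  rewrite [C * _]mulrA; apply: le_trans (ler_wpM2r b0 hs) _.
  by rewrite /b exprS; lra.
have [G [GU oG]] := ultraFilterLemma (F := \oo) _.
have hlim x : exists l, clim G (fun k => U k x) l.
  by apply: (@ultra_clim _ _ _ _ _ _ r); apply: nearW => k; exact: Ur.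
have [g hg] := choice hlim.
have hgS x : clim G (fun k => U k.+1 x) (g x).
  have h : clim G (fun k => U k.+1 x - U k x) 0.
    apply: (clim_squeeze (g := fun k => 2 * r * 2^-1 ^+ k)).
      by apply: nearW => k; rewrite subr0; exact: hd.
    by move=> e e0; apply: oG; exact: half_pow_small.
  have -> : (fun k => U k.+1 x) = (fun k => U k.+1 x - U k x + U k x).
    by apply/funext => k; rewrite subrK.
  by rewrite -[g x]add0r; exact: climD.
have gr x : nm (g x) <= r.
  by rewrite -[g x]subr0; apply: (clim_le (hg x)); apply: nearW => k; rewrite subr0.
have Pg x : g (x + P) = g x.
  apply: (clim_unique (hg (x + P))) => e e0; apply: filterS (hg x e e0) => k.
  by case: (hI k) => _ -> _.
have Dg t : isDm g t (A t *m g t + N g t).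
  pose K2 := 2 * (M * L) + K.
  have hbl k : bl K2 (fun x => A x *m U k.+1 x + N (U k) x).
    by apply: blD; [apply: blM => //; case: (hI k.+1)|apply: hNbl; case: (hI k)].
  apply: (isDm_limit (F := G) (f := fun k => U k.+1)
    (d := fun k => A t *m U k.+1 t + N (U k) t) (eta := fun=> 0) (C := K2)) => //.
  - apply: nearW => k h _; rewrite add0r; apply: (isDm_taylor (hU k)) => x xh.
    apply: le_trans ((hbl k).2 x t) _; apply: ler_wpM2l => //; exact: bl_ge0 (hbl k).
  - by move=> e e0; apply: nearW.
  - apply: climD; first by apply: climM => //; exact: clim_cst.
    apply: climD; first exact: clim_cst.
    apply: climN; apply: climZ; apply: climD; first by apply: climM => //; exact: clim_cst.
    by apply: climM => //; apply: climM => //; exact: clim_cst.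
exists g, L; split=> //; apply: (isDm_bl Dg) => // x.
apply: le_trans (nmD _ _) _; apply: lerD; last exact: hNle.
by apply: le_trans (nmM _ _) _; exact: ler_pM (nm_ge0 _) (nm_ge0 _) (hA.1 _) (gr _).
Qed.

Lemma isDm_usubmx p1 p2 q (X : R -> 'M[R[i]]_(p1 + p2, q)) x D :
  isDm X x D -> isDm (fun t => usubmx (X t)) x (usubmx D).
Proof.
by move=> h i j; rewrite mxE; under eq_fun do rewrite mxE;
  under [X in _ /\ is_derive _ _ X _]eq_fun do rewrite mxE; exact: h.
Qed.

Lemma isDm_dsubmx p1 p2 q (X : R -> 'M[R[i]]_(p1 + p2, q)) x D :
  isDm X x D -> isDm (fun t => dsubmx (X t)) x (dsubmx D).
Proof.
by move=> h i j; rewrite mxE; under eq_fun do rewrite mxE;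
  under [X in _ /\ is_derive _ _ X _]eq_fun do rewrite mxE; exact: h.
Qed.

(** The algebra behind invariance: with U' given by the Riccati equation, all terms combine into a
    multiple of psi - U chi, so the distance to the graph obeys its own linear equation. *)
Lemma graph_derivative (K : comPzRingType) p q r (A : 'M[K]_p) (B U : 'M[K]_(p, q))
    (A1 : 'M[K]_q) (A2 : 'M[K]_(q, p)) s (chi : 'M[K]_(q, r)) (psi : 'M[K]_(p, r)) :
  B *m chi + A *m psi - ((A *m U + (B - s *: (U *m A1 + U *m A2 *m U))) *m chi
    + U *m (s *: (A1 *m chi + A2 *m psi))) = (A - s *: (U *m A2)) *m (psi - U *m chi).
Proof.
rewrite !(mulmxDl, mulmxDr, mulNmx, mulmxN) -!scalemxAr -!scalemxAl !(mulmxDl, mulmxDr) !mulmxA.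
move: (B *m chi) (A *m psi) (A *m U *m chi) (U *m A1 *m chi) (U *m A2 *m U *m chi) (U *m A2 *m psi).
by move=> a1 a2 a3 a4 a5 a6; apply/matrixP => i j; rewrite !mxE; ring.
Qed.

(* The change of variables (chi, psi) |-> (chi, psi - U chi) makes the system
   block triangular, and periodicity of U makes it drop out of the Evans
   determinant. *)
Lemma evans_factorization q p (A1 : R -> 'M[R[i]]_q) (A2 : R -> 'M[R[i]]_(q, p))
    (B : R -> 'M[R[i]]_(p, q)) (A : R -> 'M[R[i]]_p) (U : R -> 'M[R[i]]_(p, q))
    T Ts Tf (s : R[i]) M L :
  is_evolution (fun x => block_mx (s *: A1 x) (s *: A2 x) (B x) (A x)) T ->
  is_evolution (fun x => s *: (A1 x + A2 x *m U x)) Ts ->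
  is_evolution (fun x => A x - s *: (U x *m A2 x)) Tf ->
  (forall x, nm (s *: (A1 x + A2 x *m U x)) <= M) ->
  (forall x, nm (A x - s *: (U x *m A2 x)) <= M) ->
  (forall x, isDm U x (A x *m U x + (B x - s *: (U x *m A1 x + U x *m A2 x *m U x)))) ->
  U L = U (- L) ->
  forall g, evans T L g = evans Ts L g * evans Tf L g.
Proof.
move=> hT hTs hTf bs bf hU UL g.
have decouple r (Z : R -> 'M[R[i]]_(q + p, r)) :
    (forall x, isDm Z x (block_mx (s *: A1 x) (s *: A2 x) (B x) (A x) *m Z x)) ->
    let chi x := usubmx (Z x) in let w x := dsubmx (Z x) - U x *m chi x in
    (forall x, isDm chi x (s *: (A1 x + A2 x *m U x) *m chi x + s *: (A2 x *m w x))) /\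
    (forall x, isDm w x ((A x - s *: (U x *m A2 x)) *m w x)).
  move=> hZ chi w.
  have e x : block_mx (s *: A1 x) (s *: A2 x) (B x) (A x) *m Z x =
     col_mx (s *: (A1 x *m chi x + A2 x *m dsubmx (Z x))) (B x *m chi x + A x *m dsubmx (Z x)).
    by rewrite -{1}[Z x]vsubmxK mul_block_col -!scalemxAl -scalerDr.
  have dE x : dsubmx (Z x) = w x + U x *m chi x by rewrite subrK.
  have hc x : isDm chi x (s *: (A1 x *m chi x + A2 x *m dsubmx (Z x))).
    by have := isDm_usubmx (hZ x); rewrite e col_mxKu.
  have hd x : isDm (fun t => dsubmx (Z t)) x (B x *m chi x + A x *m dsubmx (Z x)).
    by have := isDm_dsubmx (hZ x); rewrite e col_mxKd.
  split=> x.
    apply: isDm_eq (hc x) _.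
    by rewrite dE mulmxDr -scalemxAl mulmxDl -scalerDr mulmxA -addrA [A2 x *m w x + _]addrC.
  apply: isDm_eq (isDmB (hd x) (isDmM (hU x) (hc x))) _.
  exact: graph_derivative.
have hTd y x : isDm (fun x => T x y) x (block_mx (s *: A1 x) (s *: A2 x) (B x) (A x) *m T x y).
  by have /lin_odeP/(_ x) := (hT y).2; rewrite addr0.
pose H y : 'M[R[i]]_(q + p) := block_mx 1%:M 0 (U y) 1%:M.
have key y : exists X, forall x, x = 0 -> T x y *m H y = H x *m block_mx (Ts x y) X 0 (Tf x y).
  (* Z1 starts on the graph and stays on it, where it follows [Ts]; Z2 starts off the graph, and its
     offset follows [Tf]. The upper part of Z2 is the coupling block X, which no determinant
     sees. *)
  pose Z1 x := T x y *m col_mx 1%:M (U y).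
  pose Z2 x := T x y *m col_mx (0 : 'M[R[i]]_(q, p)) 1%:M.
  have h1 x : isDm Z1 x (block_mx (s *: A1 x) (s *: A2 x) (B x) (A x) *m Z1 x).
    by apply: isDm_eq (isDmMr _ (hTd y x)) _; rewrite mulmxA.
  have h2 x : isDm Z2 x (block_mx (s *: A1 x) (s *: A2 x) (B x) (A x) *m Z2 x).
    by apply: isDm_eq (isDmMr _ (hTd y x)) _; rewrite mulmxA.
  have [c1 w1] := decouple _ Z1 h1; have [c2 w2] := decouple _ Z2 h2.
  set ch1 := (fun x => usubmx (Z1 x)) in c1 w1; set ch2 := (fun x => usubmx (Z2 x)) in c2 w2.
  have T1 : T y y = 1%:M by exact: (hT y).1.
  have z1 x : dsubmx (Z1 x) - U x *m ch1 x = 0.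
    apply: (lin_ode_unique bf w1 (y := y)).
    by rewrite /ch1 /Z1 T1 mul1mx col_mxKd col_mxKu mulmx1 subrr.
  have z2 x : dsubmx (Z2 x) - U x *m ch2 x = Tf x y.
    apply/eqP; rewrite -subr_eq0; apply/eqP.
    apply: (lin_ode_unique (X := fun x => dsubmx (Z2 x) - U x *m ch2 x - Tf x y) bf (y := y)).
      move=> t; have /lin_odeP/(_ t) := (hTf y).2; rewrite addr0 => hT'.
      by apply: isDm_eq (isDmB (w2 t) hT') _; rewrite [RHS]mulmxBr.
    by rewrite /ch2 /Z2 T1 mul1mx col_mxKd col_mxKu mulmx0 subr0 (hTf y).1 subrr.
  have z3 x : ch1 x = Ts x y.
    apply/eqP; rewrite -subr_eq0; apply/eqP.
    apply: (lin_ode_unique (X := fun x => ch1 x - Ts x y) bs (y := y)).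
      move=> t; have /lin_odeP/(_ t) := (hTs y).2; rewrite addr0 => hT'.
      apply: isDm_eq (isDmB (c1 t) hT') _.
      by have := z1 t; rewrite /ch1 => ->; rewrite mulmx0 scaler0 addr0 [RHS]mulmxBr.
    by rewrite /ch1 /Z1 T1 mul1mx col_mxKu (hTs y).1 subrr.
  exists (ch2 0) => x ->.
  have eH : H y = row_mx (col_mx 1%:M (U y)) (col_mx 0 1%:M) by rewrite /H block_mxEh.
  rewrite eH mul_mx_row -/(Z1 0) -/(Z2 0) -[Z1 0]vsubmxK -[Z2 0]vsubmxK.
  rewrite /H mulmx_block !mul1mx !mul0mx !addr0 block_mxEh.
  rewrite -/(ch1 0) -/(ch2 0) z3; congr (row_mx (col_mx _ _) (col_mx _ _)).
    by rewrite -z3; apply/eqP; rewrite -subr_eq0 z1.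
  by rewrite -z2 addrC subrK.
have [X1 k1] := key (- L); have [X2 k2] := key L.
have {k1} k1 := k1 0 erefl; have {k2} k2 := k2 0 erefl.
have detH y : \det (H y) = 1 by rewrite /H det_lblock !det1 mulr1.
rewrite /evans.
have e : (T 0 (- L) - g *: T 0 L) *m H L = H 0 *m
   block_mx (Ts 0 (- L) - g *: Ts 0 L) (X1 - g *: X2) 0 (Tf 0 (- L) - g *: Tf 0 L).
  rewrite mulmxBl -scalemxAl k2.
  have -> : H L = H (- L) by rewrite /H UL.
  rewrite k1 scalemxAr -mulmxBr; congr (_ *m _).
  by rewrite scale_block_mx opp_block_mx add_block_mx scaler0 oppr0 addr0.
have := congr1 determinant e.
by rewrite !det_mulmx !detH mulr1 mul1r det_ublock.
Qed.
End Riccati.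

(** * Lipschitz bounds on compact sets *)

Section Smooth.
Variable R : realType.

Lemma der_line (E : normedModType R) (f : E -> R) (y v : E) (t : R) :
  differentiable f (y + t *: v) ->
  is_derive t 1 (fun s : R => f (y + s *: v)) ('D_v f (y + t *: v)).
Proof.
move=> df; have dv : derivable f (y + t *: v) v by exact: diff_derivable.
have e : (fun h : R => h^-1 *: (((fun s : R => f (y + s *: v)) \o shift t) (h *: 1) - f (y + t *: v)))
    = (fun h : R => h^-1 *: ((f \o shift (y + t *: v)) (h *: v) - f (y + t *: v))).
  apply/funext => h /=; congr (_ *: (f _ - _)).
  by rewrite [h *: 1]mulr1 scalerDl addrCA.
by apply: DeriveDef; rewrite /derivable /derive e.
Qed.

(** Finite dimension, expressed by coordinates bounded by the norm. It lets finitely many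
    directional derivatives control all of them, and it passes to products. *)
Definition spanning (E : normedModType R) (J : finType) (b : J -> E) (c : E -> J -> R) :=
  forall v, v = \sum_j c v j *: b j /\ forall j, `|c v j| <= `|v|.

(** Balls are convex, so f can be differentiated along the segment from y to z, where each partial
    derivative exceeds its size at x by at most 1. *)
Lemma locally_lipschitz (E : normedModType R) (J : finType) (b : J -> E) c (O : set E)
    (f : E -> R) x : spanning b c -> open O -> O x ->
  (forall y, O y -> differentiable f y) ->
  (forall j, {for x, continuous (fun y => 'D_(b j) f y)}) ->
  exists L r, [/\ 0 <= L, 0 < r &
    forall y z, ball x r y -> ball x r z -> `|f z - f y| <= L * `|z - y|].
Proof.
move=> sp oO Ox df cf.
have nO : nbhs x O by exact: open_nbhs_nbhs.
have h1 : \forall y \near x, forall j, `|'D_(b j) f y| <= `|'D_(b j) f x| + 1.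
  apply: (@filter_forall _ _ (fun j y => `|'D_(b j) f y| <= `|'D_(b j) f x| + 1) (nbhs x)) => j.
  have /cvgrPdist_le /(_ 1 ltr01) := cf j; apply: filterS => y h.
  have -> : 'D_(b j) f y = 'D_(b j) f x - ('D_(b j) f x - 'D_(b j) f y) by rewrite opprB addrC subrK.
  by apply: le_trans (ler_normB _ _) _; rewrite lerD2l.
have : nbhs x [set y | O y /\ forall j, `|'D_(b j) f y| <= `|'D_(b j) f x| + 1].
  exact: filterI nO h1.
move/nbhs_ballP => [r /= r0 hr].
pose L := \sum_j (`|'D_(b j) f x| + 1).
have L0 : 0 <= L by apply: sumr_ge0 => j _; rewrite addr_ge0.
exists L, r; split=> // y z hy hz.
pose v := z - y; pose p t := y + t *: v.
have pin (t : R) : 0 <= t <= 1 -> ball x r (p t).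
  move=> /andP[t0 t1];
  have e : x - p t = (1 - t) *: (x - y) + t *: (x - z).
    have -> : x - z = (x - y) - v by rewrite /v opprB addrA subrK.
    rewrite /p opprD addrA; move: (x - y) => a.
    by rewrite scalerBl scale1r [t *: (a - v)]scalerBr [RHS]addrA subrK.
  move: hy hz; rewrite -!ball_normE /= e => hy hz.
  apply: le_lt_trans (ler_normD _ _) _; rewrite !normrZ (ger0_norm t0).
  rewrite (ger0_norm (_ : 0 <= 1 - t)) ?subr_ge0 //.
  have [t0'|t1'] := eqVneq t 0; first by rewrite t0' subr0 mul1r mul0r addr0.
  have tp : 0 < t by rewrite lt_def t1'.
  have : t * `|x - z| < t * r by rewrite ltr_pM2l.
  have : (1 - t) * `|x - y| <= (1 - t) * r by rewrite ler_wpM2l ?subr_ge0 // ltW.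
  lra.
have dp (t : R) : 0 <= t <= 1 -> is_derive t 1 (fun s : R => f (p s)) ('D_v f (p t)).
  by move=> t01; apply: der_line; apply: df; have [] := hr _ (pin t t01).
have bd (t : R) : 0 <= t <= 1 -> `|'D_v f (p t)| <= L * `|v|.
  move=> t01; have [Op hp] := hr _ (pin t t01).
  have [ev cv] := sp v.
  rewrite (deriveE _ (df _ Op)) {1}ev linear_sum /= /L mulr_suml.
  apply: le_trans (ler_norm_sum _ _ _) _; apply: ler_sum => j _.
  rewrite linearZ /= normrM mulrC -(deriveE _ (df _ Op)).
  by apply: ler_pM.
have p1 : p 1 = z by rewrite /p scale1r addrC subrK.
have p0 : p 0 = y by rewrite /p scale0r addr0.
have lin (k t : R) : is_derive t 1 (fun s : R => k * s) k.
  by apply: der_eq (derZ k (der_id t)) _; rewrite mulr1.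
rewrite -/v ler_norml; apply/andP; split.
  have H := @le_increments R (fun s => - (L * `|v|) * s) (fun s => f (p s))
    (fun=> - (L * `|v|)) (fun s => 'D_v f (p s)) 0 1 ler01 (fun t _ => lin _ t) dp.
  rewrite mulr1 mulr0 subr0 p1 p0 in H; apply: H => t t01.
  by have := bd t t01; rewrite ler_norml => /andP[].
have H := @le_increments R (fun s => f (p s)) (fun s => L * `|v| * s)
  (fun s => 'D_v f (p s)) (fun=> L * `|v|) 0 1 ler01 dp (fun t _ => lin _ t).
rewrite mulr1 mulr0 subr0 p1 p0 in H; apply: H => t t01.
by have := bd t t01; rewrite ler_norml => /andP[].
Qed.

Lemma continuous_bounded_compact (E : normedModType R) (f : E -> R) (K : set E) :
  compact K -> (forall x, K x -> {for x, continuous f}) ->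
  exists2 M, 0 <= M & forall x, K x -> `|f x| <= M.
Proof.
move=> cK cf; apply: contrapT => h.
have {}h (k : nat) : exists x, K x /\ k%:R < `|f x|.
  apply: contrapT => h'; apply: h; exists k%:R => // x Kx.
  by rewrite leNgt; apply/negP => h1; apply: h'; exists x.
have [X hX] := choice h.
have [G [GU oG]] := ultraFilterLemma (F := \oo) _.
have [x Kx Gx] : exists2 l, K l & X k @[k --> G] --> l.
  by apply: ultra_lim_compact => //; apply: nearW => k; case: (hX k).
have fG : f (X k) @[k --> G] --> f x by exact: cvg_comp Gx (cf x Kx).
move/cvgrPdist_lt : fG => /(_ 1 ltr01) hG.
have big : \forall k \near \oo, `|f x| + 1 <= k%:R by exact: nbhs_infty_ger.
have [k [h1 h2]] := filter_ex (filterI hG (oG _ big)).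
have [_ h3] := hX k.
have h4 : `|f (X k)| <= `|f x - f (X k)| + `|f x|.
  by have := ler_normB (f x) (f x - f (X k)); rewrite opprB addrC subrK addrC.
rewrite /= in h1 h2; lra.
Qed.

(** K need not be convex, so segments are of no use globally. Pairs whose difference quotients
    exceed k converge along an ultrafilter: with equal limits they contradict the local bound, with
    distinct limits the boundedness of f near them. *)
Lemma lipschitz_compact (E : normedModType R) (J : finType) (b : J -> E) c (O K : set E)
    (f : E -> R) : spanning b c -> open O -> compact K -> K `<=` O ->
  (forall y, O y -> differentiable f y) ->
  (forall j x, O x -> {for x, continuous (fun y => 'D_(b j) f y)}) ->
  exists2 L, 0 <= L & forall y z, K y -> K z -> `|f z - f y| <= L * `|z - y|.
Proof.
move=> sp oO cK KO df cf; apply: contrapT => h.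
have {}h (k : nat) : exists yz, [/\ K yz.1, K yz.2 & k%:R * `|yz.2 - yz.1| < `|f yz.2 - f yz.1|].
  apply: contrapT => h'; apply: h; exists k%:R => // y z Ky Kz.
  by rewrite leNgt; apply/negP => h1; apply: h'; exists (y, z).
have [X hX] := choice h.
have [G [GU oG]] := ultraFilterLemma (F := \oo) _.
have [y Ky Gy] : exists2 l, K l & (X k).1 @[k --> G] --> l.
  by apply: ultra_lim_compact => //; apply: nearW => k; case: (hX k).
have [z Kz Gz] : exists2 l, K l & (X k).2 @[k --> G] --> l.
  by apply: ultra_lim_compact => //; apply: nearW => k; case: (hX k).
have cont x : K x -> {for x, continuous f}.
  by move=> /KO Ox; apply: differentiable_continuous; exact: df.
have fy : f (X k).1 @[k --> G] --> f y by exact: cvg_comp Gy (cont y Ky).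
have fz : f (X k).2 @[k --> G] --> f z by exact: cvg_comp Gz (cont z Kz).
have [yz|yz] := eqVneq y z.
  have [L [r [L0 r0 hL]]] := locally_lipschitz sp oO (KO y Ky) df (fun j => cf j y (KO y Ky)).
  have b1 : \forall k \near G, ball y r (X k).1 by apply: Gy; exact: nbhsx_ballx.
  have b2 : \forall k \near G, ball y r (X k).2 by apply: Gz; rewrite -yz; exact: nbhsx_ballx.
  have big : \forall k \near \oo, L <= k%:R by exact: nbhs_infty_ger.
  have [k [[h1 h2] h3]] := filter_ex (filterI (filterI b1 b2) (oG _ big)).
  have [_ _ h4] := hX k; have h5 := hL _ _ h1 h2.
  have := lt_le_trans h4 h5; rewrite ltNge => /negP; apply.
  by apply: ler_wpM2r.
have d0 : 0 < `|z - y| by rewrite normr_gt0 subr_eq0 eq_sym.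
have dG : `|(X k).2 - (X k).1| @[k --> G] --> `|z - y| by apply: cvg_norm; exact: cvgB.
have fG : `|f (X k).2 - f (X k).1| @[k --> G] --> `|f z - f y| by apply: cvg_norm; exact: cvgB.
have e2 : 0 < `|z - y| / 2 by lra.
move/cvgrPdist_lt : dG => /(_ _ e2) h1.
move/cvgrPdist_lt : fG => /(_ 1 ltr01) h2.
have big : \forall k \near \oo, (`|f z - f y| + 1) / (`|z - y| / 2) <= k%:R by exact: nbhs_infty_ger.
have [k [[h3 h4] h5]] := filter_ex (filterI (filterI h1 h2) (oG _ big)).
have [_ _ h6] := hX k.
rewrite /= in h3 h4 h5.
have h7 : `|z - y| / 2 < `|(X k).2 - (X k).1|.
  move: h3; set a := `|z - y|; set b' := `|_ - (X k).1| => h3.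
  have := ler_norm (a - b'); lra.
have h8 : `|f (X k).2 - f (X k).1| < `|f z - f y| + 1.
  move: h4; set a := `|f z - f y|; set b' := `|_ - f (X k).1| => h4.
  have := ler_norm (b' - a); rewrite distrC; lra.
rewrite ler_pdivrMr // in h5.
have : k%:R * (`|z - y| / 2) <= k%:R * `|(X k).2 - (X k).1| by apply: ler_wpM2l => //; exact: ltW.
lra.
Qed.

Lemma spanning_cV n : spanning (fun j : 'I_n => delta_mx j 0 : 'cV[R]_n) (fun v j => v j 0).
Proof.
move=> v; split.
  apply/matrixP => i k; rewrite (ord1 k) summxE (bigD1 i) //= big1 => [|j ji].
    by rewrite !mxE !eqxx mulr1 addr0.
  by rewrite !mxE eq_sym (negbTE ji) mulr0.
by move=> j; rewrite [leRHS]/Num.norm /= mx_normrE; exact: (le_bigmax _ (fun ij : 'I_n * 'I_1 => `|v ij.1 ij.2|) (j, 0)).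
Qed.

Lemma spanning_R : spanning (fun _ : unit => 1 : R) (fun (v : R) _ => v).
Proof.
by move=> v; split => //; rewrite (bigD1 tt) //= big1 => [|[]//]; rewrite addr0 [RHS]mulr1.
Qed.

Lemma spanning_prod (E F : normedModType R) (J L : finType) (b : J -> E) c (b' : L -> F) c' :
  spanning b c -> spanning b' c' ->
  spanning (E := (E * F)%type) (fun j : J + L => match j with inl k => (b k, 0) | inr k => (0, b' k) end)
    (fun v j => match j with inl k => c v.1 k | inr k => c' v.2 k end).
Proof.
move=> h h' [v w]; have [e1 n1] := h v; have [e2 n2] := h' w; split; last first.
  case=> k /=; rewrite prod_normE /= le_max; [rewrite n1|rewrite n2] => //; exact: orbT.
rewrite big_sumType /=.
have fstE (I : finType) (g : I -> E * F) : (\sum_i g i) = (\sum_i (g i).1, \sum_i (g i).2).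
  rewrite [LHS]surjective_pairing; congr pair.
    exact: (big_morph fst (fun _ _ => erefl) erefl).
  exact: (big_morph snd (fun _ _ => erefl) erefl).
rewrite !fstE /=; congr pair; rewrite /=.
  by rewrite [X in _ + X]big1 ?addr0 => // i _; rewrite scaler0.
by rewrite [X in X + _]big1 ?add0r => // i _; rewrite scaler0.
Qed.

End Smooth.

(** * Vector-valued maps, their derivatives and compact orbits *)

Section Uniform.
Variable R : realType.

Lemma cV_norm_nm n (x : 'cV[R]_n) : `|x| <= nm (cmx x).
Proof.
rewrite /Num.norm /= mx_normrE; apply/bigmax_leP; split => [|[i j] _]; first exact: nm_ge0.
by rewrite /= -cnR; have := nm_entry (cmx x) i j; rewrite mxE.
Qed.

Lemma nm_cV_norm n (x : 'cV[R]_n) : nm (cmx x) <= n%:R * `|x|.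
Proof.
rewrite nm_cmx; apply: (@le_trans _ _ (\sum_(i < n) `|x|)).
  apply: ler_sum => i _; rewrite big_ord1.
  by rewrite [leRHS]/Num.norm /= mx_normrE; exact: (le_bigmax _ (fun ij : 'I_n * 'I_1 => `|x ij.1 ij.2|) (i, 0)).
by rewrite sumr_const card_ord mulr_natl.
Qed.

Lemma cmxB p q (A B : 'M[R]_(p, q)) : cmx A - cmx B = cmx (A - B).
Proof. by rewrite /cmx map_mxB. Qed.

Lemma cmxD p q (A B : 'M[R]_(p, q)) : cmx (A + B) = cmx A + cmx B.
Proof. by rewrite /cmx map_mxD. Qed.

Lemma cmxM p q r (A : 'M[R]_(p, q)) (B : 'M[R]_(q, r)) : cmx (A *m B) = cmx A *m cmx B.
Proof. by rewrite /cmx map_mxM. Qed.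

Lemma cmxZ p q (a : R) (A : 'M[R]_(p, q)) : cmx (a *: A) = a%:C *: cmx A.
Proof. by apply/matrixP => i j; rewrite !mxE rmorphM. Qed.

Definition lip_on (E : normedModType R) (K : set E) p q (f : E -> 'M[R]_(p, q)) (L : R) :=
  forall y z, K y -> K z -> nm (cmx (f z)) <= L /\ nm (cmx (f z) - cmx (f y)) <= L * `|z - y|.

Lemma derive_congr (E E' F : normedModType R) (f : E -> F) (f' : E' -> F) x x' v v' :
  (forall h : R, f (h *: v + x) = f' (h *: v' + x')) -> 'D_v f x = 'D_v' f' x'.
Proof.
move=> e; have e0 : f x = f' x' by have := e 0; rewrite !scale0r !add0r.
rewrite /derive; set a := (fun h : R => _); set b := (fun h : R => _).
by have -> : a = b by apply/funext => h; rewrite /a /b /= e e0.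
Qed.

Lemma openX (T T' : topologicalType) (A : set T) (B : set T') :
  open A -> open B -> open (A `*` B).
Proof.
rewrite !openE => oA oB [x y] [/= Ax By]; exists (A, B); last by [].
by split; [exact: oA|exact: oB].
Qed.

Lemma differentiable_entry (E : normedModType R) p q (f : E -> 'M[R]_(p, q)) i j y :
  differentiable f y -> differentiable (fun x => f x i j) y.
Proof.
move=> df; apply: (@differentiable_comp _ _ _ _ f (fun M : 'M[R]_(p, q) => M i j)) => //.
exact: differentiable_coord.
Qed.

Lemma derive_entry (E : normedModType R) p q (f : E -> 'M[R]_(p, q)) i j y v :
  differentiable f y -> 'D_v (fun x => f x i j) y = ('D_v f y) i j.
Proof. by move=> df; rewrite (derive_mx (diff_derivable df)) mxE. Qed.

Lemma C1_lip_on (E : normedModType R) (J : finType) (b : J -> E) c (O K : set E) k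
    (f : E -> 'cV[R]_k) : spanning b c -> open O -> compact K -> K `<=` O ->
  Ck_on 1 O f -> exists2 L, 0 <= L & lip_on K f L.
Proof.
move=> sp oO cK KO [df cf].
have hi (i : 'I_k) : exists L, 0 <= L /\ forall y z, K y -> K z ->
    `|f z i 0| <= L /\ `|f z i 0 - f y i 0| <= L * `|z - y|.
  have dfi y : O y -> differentiable (fun x => f x i 0) y.
    by move=> Oy; apply: differentiable_entry; exact: df.
  have [|L1 L10 h1] := @lipschitz_compact R E J b c O K (fun x => f x i 0) sp oO cK KO dfi.
    move=> j x Ox; apply/cvgrPdist_lt => e e0.
    have /cvgrPdist_lt /(_ e e0) h := cf (b j) x Ox.
    apply: filterS2 h (open_nbhs_nbhs (conj oO Ox)) => y hy Oy.
    rewrite !derive_entry //; [|exact: df|exact: df].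
    apply: le_lt_trans hy; rewrite [leRHS]/Num.norm /= mx_normrE.
    have := le_bigmax 0 (fun ij : 'I_k * 'I_1 => `|('D_(b j) f x - 'D_(b j) f y) ij.1 ij.2|) (i, 0).
    by rewrite /= !mxE.
  have [|M M0 h2] := @continuous_bounded_compact R E (fun x => f x i 0) K cK.
    by move=> x /KO Ox; apply: differentiable_continuous; exact: dfi.
  exists (L1 + M); split=> [|y z Ky Kz]; first exact: addr_ge0.
  split; first by apply: le_trans (h2 z Kz) _; rewrite lerDr.
  by apply: le_trans (h1 y z Ky Kz) _; apply: ler_wpM2r => //; rewrite lerDl.
have [L hL] := choice hi.
exists (\sum_i L i); first by apply: sumr_ge0 => i _; case: (hL i).
move=> y z Ky Kz; rewrite cmxB !nm_cmx mulr_suml; split; apply: ler_sum => i _;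
  rewrite big_ord1; have [_ /(_ y z Ky Kz) [h1 h2]] := hL i => //.
by rewrite !mxE.
Qed.

Lemma columns_lip_on (E : normedModType R) (K : set E) k q (g : 'I_q -> E -> 'cV[R]_k) :
  (forall j, exists2 L, 0 <= L & lip_on K (g j) L) ->
  exists2 L, 0 <= L & lip_on K (fun z => \matrix_(i < k, j < q) g j z i 0) L.
Proof.
move=> h; have {}h j : exists L, 0 <= L /\ lip_on K (g j) L by have [L] := h j; exists L.
have [L hL] := choice h.
exists (\sum_j L j); first by apply: sumr_ge0 => j _; case: (hL j).
move=> y z Ky Kz; rewrite cmxB !nm_cmx mulr_suml; split; rewrite exchange_big /=;
  apply: ler_sum => j _; have [_ /(_ y z Ky Kz) []] := hL j; rewrite cmxB !nm_cmx => h1 h2.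
  apply: le_trans h1; apply: ler_sum => i _; by rewrite big_ord1 mxE.
by apply: le_trans h2; apply: ler_sum => i _; rewrite big_ord1 !mxE.
Qed.

(** An ultrafilter on the range either contains the image of a compact segment or leaves all of
    them, and then it converges to 0. This puts the whole homoclinic orbit into a compact set. *)
Lemma compact_range_vanishing n (v : R -> 'cV[R]_n) : continuous v ->
  v x @[x --> +oo] --> (0 : 'cV[R]_n) -> v x @[x --> -oo] --> (0 : 'cV[R]_n) ->
  compact (range v `|` [set 0]).
Proof.
move=> cv vp vm; rewrite compact_ultra => F FU Fv.
have [[M hM]|nM] := pselect (exists M, F (v @` `[- M, M])).
  have : compact (v @` `[- M, M]%classic).
    apply: continuous_compact; last exact: segment_compact.
    exact: continuous_subspaceT.
  rewrite compact_ultra => /(_ F FU hM) [l [[x _ <-] Fl]].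
  by exists (v x); split=> //; left; exists x.
exists 0; split; first by right.
apply/cvgrPdist_lt => e e0.
move/cvgrPdist_lt : vp => /(_ e e0) [M1 [_ h1]].
move/cvgrPdist_lt : vm => /(_ e e0) [M2 [_ h2]].
pose M := Num.max `|M1| `|M2|.
have FnM : F (~` (v @` `[- M, M]%classic)).
  have [h|//] := in_ultra_setVsetC (v @` `[- M, M]%classic) FU.
  by case: nM; exists M.
apply: filterS2 Fv FnM => _ [[x _ <-]|->] hx; last by rewrite subrr normr0.
have : M < `|x|.
  rewrite ltNge; apply/negP => h; apply: hx; exists x => //.
  by rewrite /= in_itv /= -ler_norml.
rewrite /M gt_max => /andP[a1 a2].
have [x0|x0] := leP 0 x.
  by apply: h1; apply: le_lt_trans (ler_norm _) _; rewrite -(ger0_norm x0).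
apply: h2; move: a2; rewrite (ltr0_norm x0) => a2.
by have := ler_norm (- M2); rewrite normrN; lra.
Qed.

End Uniform.

(** * Uniform constants for the nonlinearities *)

Section SystemBounds.
Variables (R : realType) (m n : nat) (S : rd_system R m n).

(** The value e = 0 is included so that coefficients along the pulse can be compared with those of
    the limit problems. *)
Definition lipb p q (KU : set 'cV[R]_m) (KV : set 'cV[R]_n) (e0 : R)
    (g : 'cV[R]_m -> 'cV[R]_n -> R -> 'M[R]_(p, q)) (L : R) :=
  forall u u' v v' e e', KU u -> KU u' -> KV v -> KV v' -> 0 <= e <= e0 -> 0 <= e' <= e0 ->
    nm (cmx (g u v e)) <= L /\
    nm (cmx (g u v e) - cmx (g u' v' e')) <= L * (`|u - u'| + `|v - v'| + `|e - e'|).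

Record system_bounds (KU : set 'cV[R]_m) (KV : set 'cV[R]_n) (e0 L : R) : Prop := {
  sb_L : 0 <= L;
  sb_G : lipb KU KV e0 (G S) L;
  sb_H1 : lipb KU KV e0 (H1 S) L;
  sb_H2 : lipb KU KV e0 (fun u v _ => H2 S u v) L;
  sb_duG : lipb KU KV e0 (duG S) L;
  sb_dvG : lipb KU KV e0 (dvG S) L;
  sb_duH1 : lipb KU KV e0 (duH1 S) L;
  sb_dvH1 : lipb KU KV e0 (dvH1 S) L;
  sb_duH2 : lipb KU KV e0 (fun u v _ => duH2 S u v) L;
  sb_dvH2 : lipb KU KV e0 (fun u v _ => dvH2 S u v) L }.

Lemma lipb_weaken p q KU KV e0 (g : 'cV[R]_m -> 'cV[R]_n -> R -> 'M[R]_(p, q)) L L' :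
  L <= L' -> lipb KU KV e0 g L -> lipb KU KV e0 g L'.
Proof.
move=> LL h u u' v v' e e' h1 h2 h3 h4 h5 h6.
have [a1 a2] := h u u' v v' e e' h1 h2 h3 h4 h5 h6.
split; first exact: le_trans LL.
by apply: le_trans a2 _; apply: ler_wpM2r => //; rewrite !addr_ge0.
Qed.

Lemma jac_lip_on (E : normedModType R) (J : finType) (b : J -> E) c (O K : set E) k q
    (f : E -> 'cV[R]_k) (d : 'cV[R]_q -> E) :
  spanning b c -> open O -> compact K -> K `<=` O -> Ck_on 2 O f ->
  exists2 L, 0 <= L & lip_on K (fun z => \matrix_(i < k, j < q) 'D_(d (delta_mx j 0)) f z i 0) L.
Proof.
move=> sp oO cK KO [_ cf]; apply: (columns_lip_on (g := fun j => 'D_(d (delta_mx j 0)) f)) => j.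
exact: (C1_lip_on sp oO cK KO (cf _)).
Qed.

(** The embedding z, with its lifts du and dv of directions, covers maps of (u, v, e) and of (u, v)
    by one proof: a partial derivative is a directional derivative on the product space with zeros
    in the other slots. *)
Lemma C2_bounds (E : normedModType R) (J : finType) (b : J -> E) c (O K : set E) k
    (f : E -> 'cV[R]_k) (z : 'cV[R]_m -> 'cV[R]_n -> R -> E) du dv KU KV e0 :
  spanning b c -> open O -> compact K -> K `<=` O -> Ck_on 2 O f ->
  (forall u v e, KU u -> KV v -> 0 <= e <= e0 -> K (z u v e)) ->
  (forall u v e u' v' e', `|z u v e - z u' v' e'| <= `|u - u'| + `|v - v'| + `|e - e'|) ->
  (forall h d u v e, z (h *: d + u) v e = h *: du d + z u v e) ->
  (forall h d u v e, z u (h *: d + v) e = h *: dv d + z u v e) ->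
  let g u v e := f (z u v e) in
  exists2 L, 0 <= L & [/\ lipb KU KV e0 g L,
    lipb KU KV e0 (fun u v e => jac (fun w => g w v e) u) L &
    lipb KU KV e0 (fun u v e => jac (fun w => g u w e) v) L].
Proof.
move=> sp oO cK KO cf zK zd zu zv g; have [df cdf] := cf.
have c1 : Ck_on 1 O f.
  by split=> // v x Ox; apply: differentiable_continuous; have [h _] := cdf v; exact: h.
have [L1 L10 h1] := C1_lip_on sp oO cK KO c1.
have [L2 L20 h2] := jac_lip_on du sp oO cK KO cf.
have [L3 L30 h3] := jac_lip_on dv sp oO cK KO cf.
have pull p q (F : E -> 'M[R]_(p, q)) L g' : (forall u v e, g' u v e = F (z u v e)) ->
    0 <= L -> lip_on K F L -> lipb KU KV e0 g' L.
  move=> Eg L0 h u u' v v' e e' k1 k2 k3 k4 k5 k6.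
  have [||a1 a2] := h (z u' v' e') (z u v e); [exact: zK..|].
  by rewrite !Eg; split=> //; apply: le_trans a2 _; exact: ler_wpM2l.
have jacE q (F : 'cV[R]_q -> 'cV[R]_k) (d : 'cV[R]_q -> E) w x :
    (forall h j, F (h *: delta_mx j 0 + w) = f (h *: d (delta_mx j 0) + x)) ->
    jac F w = \matrix_(i < k, j < q) 'D_(d (delta_mx j 0)) f x i 0.
  move=> h; apply/matrixP => i j; rewrite !mxE.
  by congr (fun_of_matrix _ i 0); apply: derive_congr => t; exact: h.
exists (L1 + L2 + L3); first by rewrite !addr_ge0.
split.
- by apply: (lipb_weaken (L := L1)); [lra|exact: pull].
- apply: (lipb_weaken (L := L2)); first by lra.
  by apply: pull L20 h2 => u v e; apply: jacE => h j; rewrite /g zu.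
- apply: (lipb_weaken (L := L3)); first by lra.
  by apply: pull L30 h3 => u v e; apply: jacE => h j; rewrite /g zv.
Qed.

Lemma C2_bounds3 (k : nat) (g : 'cV[R]_m -> 'cV[R]_n -> R -> 'cV[R]_k) (U KU : set 'cV[R]_m)
    (V KV : set 'cV[R]_n) (I : set R) e0 :
  open U -> open V -> open I -> compact KU -> compact KV -> KU `<=` U -> KV `<=` V ->
  `[0, e0]%classic `<=` I ->
  Ck_on 2 (U `*` V `*` I) (fun z : 'cV[R]_m * 'cV[R]_n * R => g z.1.1 z.1.2 z.2) ->
  exists2 L, 0 <= L & [/\ lipb KU KV e0 g L,
    lipb KU KV e0 (fun u v e => jac (fun w => g w v e) u) L &
    lipb KU KV e0 (fun u v e => jac (fun w => g u w e) v) L].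
Proof.
move=> oU oV oI cU cV KUU KVV hI cg.
apply: (C2_bounds (K := KU `*` KV `*` `[0, e0]%classic) (z := fun u v e => (u, v, e))
  (du := fun d => (d, 0, 0)) (dv := fun d => (0, d, 0))
  (spanning_prod (spanning_prod (@spanning_cV R m) (@spanning_cV R n)) (@spanning_R R)) _ _ _ cg).
- by apply: openX => //; exact: openX.
- by apply: compact_setX; [exact: compact_setX|exact: segment_compact].
- by move=> [[u v] e] [[/= /KUU a /KVV b] /hI d].
- by move=> u v e Ku Kv he; split; rewrite /= ?in_itv.
- move=> u v e u' v' e'; rewrite prod_normE /= prod_normE /= !ge_max.
  have := normr_ge0 (u - u'); have := normr_ge0 (v - v'); have := normr_ge0 (e - e').
  by move=> *; apply/andP; split; [apply/andP; split|]; lra.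
- by move=> h d u v e; rewrite -[RHS]/(h *: d + u, h *: 0 + v, h *: 0 + e) !scaler0 !add0r.
- by move=> h d u v e; rewrite -[RHS]/(h *: 0 + u, h *: d + v, h *: 0 + e) !scaler0 !add0r.
Qed.

Lemma C2_bounds2 (k : nat) (g : 'cV[R]_m -> 'cV[R]_n -> 'cV[R]_k) (U KU : set 'cV[R]_m)
    (V KV : set 'cV[R]_n) e0 :
  open U -> open V -> compact KU -> compact KV -> KU `<=` U -> KV `<=` V ->
  Ck_on 2 (U `*` V) (fun z : 'cV[R]_m * 'cV[R]_n => g z.1 z.2) ->
  exists2 L, 0 <= L & [/\ lipb KU KV e0 (fun u v _ => g u v) L,
    lipb KU KV e0 (fun u v _ => jac (fun w => g w v) u) L &
    lipb KU KV e0 (fun u v _ => jac (fun w => g u w) v) L].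
Proof.
move=> oU oV cU cV KUU KVV cg.
apply: (C2_bounds (K := KU `*` KV) (z := fun u v _ => (u, v))
  (du := fun d => (d, 0)) (dv := fun d => (0, d))
  (spanning_prod (@spanning_cV R m) (@spanning_cV R n)) _ _ _ cg).
- exact: openX.
- exact: compact_setX.
- by move=> [u v] [/= /KUU a /KVV b].
- by [].
- move=> u v e u' v' e'; rewrite prod_normE /= ge_max.
  have := normr_ge0 (u - u'); have := normr_ge0 (v - v'); have := normr_ge0 (e - e').
  by move=> *; apply/andP; split; lra.
- by move=> h d u v e; rewrite -[RHS]/(h *: d + u, h *: 0 + v) !scaler0 !add0r.
- by move=> h d u v e; rewrite -[RHS]/(h *: 0 + u, h *: d + v) !scaler0 !add0r.
Qed.

Lemma system_bounds_exist (U KU : set 'cV[R]_m) (V KV : set 'cV[R]_n) (I : set R) :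
  assumption_S1 S U V I -> compact KU -> compact KV -> KU `<=` U -> KV `<=` V ->
  exists e0 L, [/\ 0 < e0, `[0, e0]%classic `<=` I & system_bounds KU KV e0 L].
Proof.
move=> [[oU _] [oV _] [oI _] V0 I0 cH1 cG cH2 _ _] cU cV KUU KVV.
have /nbhs_ballP[r /= r0 hr] : nbhs (0 : R) I by exact: open_nbhs_nbhs.
have hI : `[0, r / 2]%classic `<=` I.
  move=> x; rewrite /= in_itv /= => /andP[x0 xr]; apply: hr.
  by rewrite -ball_normE /= sub0r normrN ger0_norm //; lra.
have [L1 L10 [a1 a2 a3]] := C2_bounds3 oU oV oI cU cV KUU KVV hI cH1.
have [L2 L20 [b1 b2 b3]] := C2_bounds3 oU oV oI cU cV KUU KVV hI cG.
have [L3 L30 [c1 c2 c3]] := C2_bounds2 (r / 2) oU oV cU cV KUU KVV cH2.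
exists (r / 2), (L1 + L2 + L3); split => //; first by lra.
have [l1 l2 l3] : [/\ L1 <= L1 + L2 + L3, L2 <= L1 + L2 + L3 & L3 <= L1 + L2 + L3].
  by split; lra.
split; first by rewrite !addr_ge0.
- exact: lipb_weaken l2 b1.
- exact: lipb_weaken l1 a1.
- exact: lipb_weaken l3 c1.
- exact: lipb_weaken l2 b2.
- exact: lipb_weaken l2 b3.
- exact: lipb_weaken l1 a2.
- exact: lipb_weaken l1 a3.
- exact: lipb_weaken l3 c2.
- exact: lipb_weaken l3 c3.
Qed.

End SystemBounds.

(** * The pulse *)

Section PulsePrelim.
Variable R : realType.

Lemma diag_pos_unit p (D : 'M[R]_p) : diag_pos D -> D \in unitmx.
Proof.
move=> [dD Dp]; rewrite unitmxE unitfE (det_trig (is_diag_mx_is_trig dD)).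
by apply/prodf_neq0 => i _; rewrite gt_eqF.
Qed.

Lemma isDm_cmx p q (f : R -> 'M[R]_(p, q)) (x : R) : derivable f x 1 ->
  isDm (fun t => cmx (f t)) x (cmx (derive1 f x)).
Proof.
move=> df i j; split.
  under eq_fun do rewrite mxE /=; rewrite mxE /= derive1E (derive_mx df) mxE.
  by apply: derivableP; move/derivable_mxP : df; exact.
by under eq_fun do rewrite mxE /=; rewrite mxE /=; exact: der_cst.
Qed.

Lemma isDm_col_mx p1 p2 q (X : R -> 'M[R[i]]_(p1, q)) (Y : R -> 'M[R[i]]_(p2, q)) x D E :
  isDm X x D -> isDm Y x E -> isDm (fun t => col_mx (X t) (Y t)) x (col_mx D E).
Proof.
move=> hX hY i j; case: (split_ordP i) => k ->.
  have [h1 h2] := hX k j; rewrite col_mxEu.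
  by split; under eq_fun do rewrite col_mxEu.
have [h1 h2] := hY k j; rewrite col_mxEd.
by split; under eq_fun do rewrite col_mxEd.
Qed.

Lemma nm_col_mx p1 p2 q (X : 'M[R[i]]_(p1, q)) (Y : 'M[R[i]]_(p2, q)) :
  nm (col_mx X Y) = nm X + nm Y.
Proof.
rewrite /nm big_split_ord /=; congr (_ + _); apply: eq_bigr => i _; apply: eq_bigr => j _.
  by rewrite col_mxEu.
by rewrite col_mxEd.
Qed.

Lemma state_norm_ge m n (z : state R m n) :
  [/\ `|uof z| <= `|z|, `|pof z| <= `|z|, `|vof z| <= `|z| & `|qof z| <= `|z|].
Proof. by case: z => [[[u p] v] q]; rewrite !prod_normE /= !le_max !lexx !orbT. Qed.

Lemma state_norm_le m n (z : state R m n) M : `|uof z| <= M -> `|pof z| <= M ->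
  `|vof z| <= M -> `|qof z| <= M -> `|z| <= M.
Proof.
case: z => [[[u p] v] q] /= h1 h2 h3 h4.
by rewrite !prod_normE /= !ge_max h1 h2 h3 h4.
Qed.

(** The components v and q vanish on the manifold, hence are bounded by the distance to it. The
    point of U ensures that the infimum is not over the empty set. *)
Lemma dist_slow_manifold m n (U : set 'cV[R]_m) u (z : state R m n) r : U u ->
  dist z (slow_manifold U) <= r -> `|vof z| <= r /\ `|qof z| <= r.
Proof.
move=> Uu hr.
have ne : [set `|z - y| | y in @slow_manifold R m n U] !=set0.
  by exists `|z - ((u, 0, 0, 0) : state R m n)|, (u, 0, 0, 0).
split; apply: le_trans hr; apply: lb_le_inf => // _ [y [_ v0 q0] <-].
  by have [_ _ + _] := state_norm_ge (z - y); rewrite /= v0 subr0.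
by have [_ _ _] := state_norm_ge (z - y); rewrite /= q0 subr0.
Qed.

Lemma continuous_uof m n : continuous (fun z : state R m n => uof z).
Proof.
move=> z; apply: (@continuous_comp _ _ _ (fun z : state R m n => z.1.1) fst); last exact: cvg_fst.
by apply: (@continuous_comp _ _ _ fst fst); exact: cvg_fst.
Qed.

Lemma continuous_vof m n : continuous (fun z : state R m n => vof z).
Proof.
by move=> z; apply: (@continuous_comp _ _ _ fst snd); [exact: cvg_fst|exact: cvg_snd].
Qed.

End PulsePrelim.

(* The constants are independent of e, and all later bounds depend on them only. *)
Record good_parameter (R : realType) (m n : nat) (S : rd_system R m n)
    (KU : set 'cV[R]_m) (KV : set 'cV[R]_n) (phi : R -> R -> state R m n) (Lc : R -> R)
    (L0 : R) (u0 p0 : 'cV[R]_m) (vh qh : R -> 'cV[R]_n) (e0 B Ls b : R) (K : set (state R m n)) (e : R)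
    : Prop := {
  gp_pos : 0 < e;
  gp_le1 : e <= 1;
  gp_le : e <= e0;
  gp_ode : pulse_ode S e (phi e);
  gp_per : forall x, phi e (x + 2 * Leps Lc e) = phi e x;
  gp_K : forall x, K (phi e x);
  gp_B : forall x, `|phi e x| <= B;
  gp_0 : `|phi e 0 - ((u0, p0, vh 0, qh 0) : state R m n)| <= B * e;
  gp_decay : forall x, 0 <= x <= 2 * Leps Lc e ->
    `|vof (phi e x)| <= Ls * expR (- b * Num.min x (2 * Leps Lc e - x)) /\
    `|qof (phi e x)| <= Ls * expR (- b * Num.min x (2 * Leps Lc e - x));
  gp_L : L0 / 2 <= Lc e }.

(** The facts about the system and its pulse from which the estimates start. The vanishing of [duG]
    at v = 0 is what makes the forcing A21 decay with v. *)
Record pulse_data (R : realType) (m n : nat) (S : rd_system R m n)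
    (KU : set 'cV[R]_m) (KV : set 'cV[R]_n) (phi : R -> R -> state R m n)
    (Lc : R -> R) (L0 : R) (u0 p0 : 'cV[R]_m) (vh qh : R -> 'cV[R]_n)
    (e0 L B Ls b : R) (K : set (state R m n)) : Prop := {
  pd_D1 : D1 S \in unitmx;
  pd_D2 : D2 S \in unitmx;
  pd_sb : system_bounds S KU KV e0 L;
  pd_B : 0 <= B;
  pd_Ls : 0 < Ls;
  pd_b : 0 < b;
  pd_e0 : 0 < e0;
  pd_compact : compact K;
  pd_K : forall z, K z -> KU (uof z) /\ KV (vof z);
  pd_u0 : exists2 z, K z & uof z = u0;
  pd_KV0 : KV 0;
  pd_KVh : forall x, KV (vh x);
  pd_hom : forall x, (derivable vh x 1 /\ D2 S *m derive1 vh x = qh x) /\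
    (derivable qh x 1 /\ derive1 qh x = G S u0 (vh x) 0);
  pd_duG0 : forall u e, KU u -> 0 <= e <= e0 -> duG S u 0 e = 0;
  pd_L0 : 0 < L0;
  pd_near : \forall e \near 0^'+, good_parameter S KU KV phi Lc L0 u0 p0 vh qh e0 B Ls b K e }.

Lemma pulse_data_exist (R : realType) (m n : nat) (S : rd_system R m n)
    (U : set 'cV[R]_m) (V : set 'cV[R]_n) (I : set R) phi Lc L0 u0 p0 vh qh K :
  diag_pos (D1 S) -> diag_pos (D2 S) ->
  assumption_S1 S U V I -> assumption_S3 S U V phi Lc L0 u0 p0 vh qh ->
  compact_enclosure U V phi u0 K ->
  exists KU KV e0 L B Ls b, pulse_data S KU KV phi Lc L0 u0 p0 vh qh e0 L B Ls b K.
Proof.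
move=> hD1 hD2 hS1 hS3 hK.
have [hs [vp qp] [vm qm] _] := S3_hom hS3.
pose KU := (fun z : state R m n => uof z) @` K.
(* The homoclinic orbit and 0 are added because the limit matrices are evaluated there. *)
pose KV := (fun z : state R m n => vof z) @` K `|` (range vh `|` [set 0]).
have cu : compact KU.
  apply: continuous_compact; last exact: K_compact hK.
  by apply: continuous_subspaceT; exact: continuous_uof.
have cvh : continuous vh.
  move=> x; apply: differentiable_continuous; apply/derivable1_diffP.
  by have [_ [d _] _] := hs x.
have cv : compact KV.
  apply: compactU.
    apply: continuous_compact; last exact: K_compact hK.
    by apply: continuous_subspaceT; exact: continuous_vof.
  exact: compact_range_vanishing.
have KUU : KU `<=` U by move=> _ [z Kz <-]; have [] := K_sub hK Kz.
have KVV : KV `<=` V.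
  move=> v [[z Kz <-]|[[x _ <-]|->]].
  - by have [] := K_sub hK Kz.
  - by have [] := hs x.
  - exact: S1_0V hS1.
have [e0 [L [e0p hI hsb]]] := system_bounds_exist hS1 cu cv KUU KVV.
have [B B0 hB] : exists2 B, 0 <= B & forall z, K z -> `|z| <= B.
  have [M [_ hM]] := compact_bounded (K_compact hK).
  exists (`|M| + 1); first by rewrite addr_ge0.
  by move=> z Kz; apply: hM => //; rewrite (le_lt_trans (ler_norm _)) // ltrDl.
have [C1 hC1] := S3_pulse hS3.
have [Ls [b [a1 [a2 [us [ps [Ls0 b0 _ _ hdec]]]]]]] := S3_slow hS3.
(* One constant bounds the pulse and its initial error; the absolute value is taken since C1 may be
   negative. *)
exists KU, KV, e0, L, (B + `|C1|), Ls, b.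
split=> //.
- exact: diag_pos_unit.
- exact: diag_pos_unit.
- by rewrite addr_ge0.
- exact: K_compact hK.
- by move=> z Kz; split; [exists z|left; exists z].
- exact: K_u0 hK.
- by right; right.
- by move=> x; right; left; exists x.
- by move=> x; have [_] := hs x.
- move=> u e KUu he; apply/matrixP => i j; rewrite !mxE.
  have [oU _] := S1_U hS1.
  have E : \forall w \near u, G S w 0 e = cst 0 w.
    have := open_nbhs_nbhs (conj oU (KUU _ KUu)); apply: filterS => w Uw.
    by rewrite (S1_G0 hS1 Uw) //; apply: hI; rewrite /= in_itv.
  by rewrite (near_eq_derive _ E) derive_cst mxE.
- exact: S3_L0 hS3.
have hL : \forall e \near 0^'+, L0 / 2 <= Lc e.
  have L0p := S3_L0 hS3.
  have l2 : 0 < L0 / 2 by rewrite divr_gt0.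
  have /cvgrPdist_le /(_ _ l2) := S3_Lc hS3; apply: filterS => e h.
  have := ler_norm (L0 - Lc e); lra.
near=> e.
have ep : 0 < e by near: e; exact: nbhs_right_gt.
have [h1 h2 h3] : [/\ pulse_ode S e (phi e),
  (forall x, phi e (x + 2 * Leps Lc e) = phi e x) &
  (forall x, U (uof (phi e x)) /\ V (vof (phi e x)))] by near: e; exact: S3_sol hS3.
have h4 : forall x, K (phi e x) by near: e; exact: K_phi hK.
have h5 : `|phi e 0 - ((u0, p0, vh 0, qh 0) : state R m n)| <= C1 * e by near: e.
split=> //.
- by near: e; exact: nbhs_right_le.
- by near: e; exact: nbhs_right_le.
- by move=> x; apply: le_trans (hB _ (h4 x)) _; rewrite lerDl.
- apply: le_trans h5 _; apply: ler_wpM2r; first exact: ltW.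
  by apply: le_trans (ler_norm _) _; rewrite lerDr.
- have h6 : forall x, 0 <= x <= 2 * Leps Lc e ->
     let E := expR (- b * Num.min x (2 * Leps Lc e - x)) in
     dist (phi e x) (@slow_manifold R m n U) <= Ls * E /\
     `|phi e x - ((us (e * x), ps (e * x), 0, 0) : state R m n)| <= Ls * Num.max e E by near: e.
  by move=> x hx; have [h7 _] := h6 x hx; exact: (dist_slow_manifold (S3_u0 hS3) h7).
- by near: e.
Unshelve. all: by end_near. Qed.

(** * Powers and exponentials of a small parameter *)

Section SmallParameters.
Variable R : realType.
Implicit Types a k e rho : R.

Lemma powR_small a d : 0 < a -> 0 < d -> \forall e \near (0 : R)^'+, e `^ a <= d.
Proof.
move=> a0 d0; near=> e.
have ep : 0 < e by near: e; exact: nbhs_right_gt.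
have -> : d = (d `^ a^-1) `^ a by rewrite -powRrM mulVf ?gt_eqF // powRr1 // ltW.
rewrite ge0_ler_powR ?nnegrE ?powR_ge0 ?(ltW a0) ?(ltW ep) //.
near: e; apply: nbhs_right_le; exact: powR_gt0.
Unshelve. all: by end_near. Qed.

Lemma powR_exp e a : 0 < e -> e `^ a = expR (a * ln e).
Proof. by move=> e0; rewrite /powR gt_eqF. Qed.

(** From (y / j)^j <= exp y with y = k e^(-rho): the reciprocal is a constant times e^(rho j), and j
    is chosen with rho j >= N. *)
Lemma exp_small k rho N : 0 < k -> 0 < rho ->
  exists2 C, 0 <= C & forall e, 0 < e -> e <= 1 -> expR (- k * e `^ (- rho)) <= C * e `^ N.
Proof.
move=> k0 rho0; pose j := (Num.truncn (`|N| / rho)).+1.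
have hj : N <= rho * j%:R.
  apply: le_trans (ler_norm _) _; rewrite -ler_pdivrMl // mulrC.
  by have := @truncnS_gt R (`|N| / rho); rewrite -/j => /ltW.
have jp : 0 < j%:R :> R by [].
exists ((j%:R / k) ^+ j); first by rewrite exprn_ge0 // divr_ge0 // ltW.
move=> e ep e1.
pose y := k * e `^ (- rho); have yp : 0 < y by rewrite mulr_gt0 // powR_gt0.
have h1 : (y / j%:R) ^+ j <= expR y.
  have -> : expR y = expR (y / j%:R) ^+ j by rewrite -expRM_natl mulrC divfK // gt_eqF.
  apply: lerXn2r; rewrite ?nnegrE ?expR_ge0 ?divr_ge0 // ?(ltW yp) //.
  by apply: le_trans (expR_ge1Dx _); rewrite lerDr.
rewrite mulNr expRN -/y.
have yj : 0 < (y / j%:R) ^+ j by rewrite exprn_gt0 // divr_gt0.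
apply: (@le_trans _ _ ((y / j%:R) ^+ j)^-1); first by rewrite lef_pV2 ?posrE ?expR_gt0.
have -> : ((y / j%:R) ^+ j)^-1 = (j%:R / k) ^+ j * e `^ (rho * j%:R).
  rewrite -exprVn invf_div /y powRN invfM invrK mulrA exprMn; congr (_ * _).
  by rewrite powRrM -powR_mulrn ?powR_ge0.
apply: ler_wpM2l; first by rewrite exprn_ge0 // divr_ge0 // ltW.
rewrite !powR_exp // ler_expR; apply: ler_wnM2r => //.
by rewrite ln_le0.
Qed.

End SmallParameters.

(** * Coefficient classes, vanishing majorants and folding by a period *)

Section BoundedLipschitz.
Variable R : realType.

Lemma bl_cst p q (C : 'M[R[i]]_(p, q)) : bl (nm C) (fun=> C).
Proof. by split=> [//|s t]; rewrite subrr nm0 mulr_ge0 // nm_ge0. Qed.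

Lemma bl_antidiag p q r s (C : 'M[R[i]]_(p, s)) (F : R -> 'M[R[i]]_(q, r)) M :
  bl M F -> bl (nm C + M) (fun x => block_mx 0 C (F x) 0).
Proof.
move=> [h1 h2]; split=> [t|x y].
  by rewrite nm_block !nm0 add0r addr0 lerD2l.
rewrite opp_block_mx add_block_mx !subrr nm_block !nm0 !add0r addr0.
by apply: le_trans (h2 x y) _; apply: ler_wpM2r => //; rewrite lerDr nm_ge0.
Qed.

Lemma nm_scalar_mx p (l : R[i]) : nm (l%:M : 'M[R[i]]_p) <= p%:R * p%:R * cn l.
Proof.
apply: (@le_trans _ _ (\sum_(i < p) \sum_(j < p) cn l)).
  apply: ler_sum => i _; apply: ler_sum => j _; rewrite mxE.
  by case: (_ == _); rewrite ?mulr1n ?mulr0n ?cn0 ?cn_ge0.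
by rewrite !sumr_const !card_ord -[cn l *+ p]mulr_natl -[(_ * cn l) *+ p]mulr_natl mulrA.
Qed.

(** A one-sided condition suffices because the f are majorants of norms. *)
Definition vanish T (G : set_system T) (f : T -> R) :=
  forall a, 0 < a -> G [set k | f k < a].

Lemma vanishD T (G : set_system T) {GF : Filter G} f g :
  vanish G f -> vanish G g -> vanish G (fun k => f k + g k).
Proof.
move=> hf hg a a0; have a2 : 0 < a / 2 by lra.
by apply: filterS2 (hf _ a2) (hg _ a2) => k /= h1 h2; lra.
Qed.

Lemma vanishZ T (G : set_system T) {GF : Filter G} c f : 0 <= c ->
  vanish G f -> vanish G (fun k => c * f k).
Proof.
move=> c0 hf a a0; have a2 : 0 < a / (c + 1) by rewrite divr_gt0 // ltr_wpDl.
apply: filterS (hf _ a2) => k /= h; have [f0|f0] := leP 0 (f k).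
  apply: (@le_lt_trans _ _ ((c + 1) * f k)); first by apply: ler_wpM2r => //; rewrite lerDl.
  by rewrite mulrC -ltr_pdivlMr // ltr_wpDl.
by apply: le_lt_trans a0; rewrite mulr_ge0_le0 // ltW.
Qed.

Lemma vanish_dist (W : normedModType R) T (G : set_system T) {GF : Filter G} (f : T -> W) l :
  f k @[k --> G] --> l -> vanish G (fun k => `|f k - l|).
Proof.
by move=> /cvgrPdist_lt h a a0; apply: filterS (h a a0) => k /=; rewrite distrC.
Qed.

Lemma vanish_clim T (G : set_system T) {GF : Filter G} p q (f : T -> 'M[R[i]]_(p, q)) l g :
  G [set k | nm (f k - l) <= g k] -> vanish G g -> clim G f l.
Proof. by move=> h1 h2; exact: clim_squeeze h1 h2. Qed.

Lemma no_bounded_solution_shift q p (A : R -> 'M[R[i]]_p) c :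
  no_bounded_solution q A -> no_bounded_solution q (fun t => A (c + t)).
Proof.
move=> hA w hw [M hM] x.
have -> : w x = w ((c + x) - c) by rewrite addrAC subrr add0r.
apply: (hA (fun t => w (t - c))); last by exists M.
by move=> t; apply: isDm_shift; have := hw (t - c); rewrite [c + _]addrC subrK.
Qed.

Lemma fold_centered P (x : R) : 0 < P -> exists k : int, `|x + k%:~R * P| <= P / 2.
Proof.
move=> P0; have [k /andP[h1 h2]] := fold_period (x + P / 2) P0; exists k.
by rewrite ler_norml; apply/andP; split; lra.
Qed.

(** A point of the central period cell is nearest to 0 among its translates. Hence moving x by
    periods loses at most |x - x0|, which the weight centred at x0 can pay for. *)
Lemma fold_dist P (x x0 : R) (k : int) : 0 < P -> `|x0| <= P / 2 ->
  `|x0| <= `|x + k%:~R * P| + `|x - x0|.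
Proof.
move=> P0 hx0.
suff h : `|x0| <= `|x0 + k%:~R * P|.
  apply: le_trans h _.
  have -> : x0 + k%:~R * P = (x + k%:~R * P) - (x - x0) by ring.
  exact: ler_normB.
have [->|k0] := eqVneq k 0; first by rewrite mul0r addr0.
have k1 : 1 <= `|k%:~R : R|.
  by rewrite -intr_norm -[1]/(1%:~R) ler_int -gtz0_ge1 normr_gt0.
have h1 : P <= `|k%:~R * P| by rewrite normrM (gtr0_norm P0) ler_peMl // ltW.
have := ler_normB (x0 + k%:~R * P) x0; rewrite addrAC subrr add0r; lra.
Qed.

End BoundedLipschitz.

Lemma ultra_lim_complex (R : realType) T (G : set_system T) (f : T -> R[i]) M :
  UltraFilter G -> G [set k | cn (f k) <= M] ->
  exists l, vanish G (fun k => cn (f k - l)).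
Proof.
move=> GU fM; pose F k : 'M[R[i]]_(1, 1) := const_mx (f k).
have nmF (z : 'M[R[i]]_(1, 1)) : nm z = cn (z 0 0) by rewrite /nm !big_ord1.
have [|l hl] := @ultra_clim R T G 1 1 F M GU.
  by apply: filterS fM => k; rewrite nmF mxE.
by exists (l 0 0) => a a0; apply: filterS (hl a a0) => k; rewrite nmF !mxE.
Qed.

(** * The periodic pulse compared with the homoclinic profile *)

Section PulseEstimates.
Variables (R : realType) (m n : nat) (S : rd_system R m n).
Variables (KU : set 'cV[R]_m) (KV : set 'cV[R]_n) (phi : R -> R -> state R m n).
Variables (Lc : R -> R) (L0 : R) (u0 p0 : 'cV[R]_m) (vh qh : R -> 'cV[R]_n).
Variables (e0 L B Ls b : R) (K : set (state R m n)).
Hypothesis hP : pulse_data S KU KV phi Lc L0 u0 p0 vh qh e0 L B Ls b K.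

Let D1u := pd_D1 hP.
Let D2u := pd_D2 hP.
Let hsb := pd_sb hP.
Let L0' := sb_L hsb.
Let B0 := pd_B hP.
Let Ls0 := pd_Ls hP.
Let b0 := pd_b hP.
Let e00 := pd_e0 hP.
Let hKK := pd_K hP.
Let KV0 := pd_KV0 hP.
Let KVh := pd_KVh hP.
Let hom := pd_hom hP.
Let L00 := pd_L0 hP.
Let good := good_parameter S KU KV phi Lc L0 u0 p0 vh qh e0 B Ls b K.
Let near_good : \forall e \near 0^'+, good e := pd_near hP.

Let KU0 : KU u0.
Proof. by have [z Kz <-] := pd_u0 hP; have [] := hKK Kz. Qed.

Lemma good_L e : good e -> 0 < Leps Lc e.
Proof.
move=> h; rewrite /Leps mulr_gt0 ?invr_gt0 ?(gp_pos h) //.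
by apply: lt_le_trans (gp_L h); rewrite divr_gt0.
Qed.

Lemma good_KU e x : good e -> KU (uof (phi e x)).
Proof. by move=> h; have [] := hKK (gp_K h x). Qed.

Lemma good_KV e x : good e -> KV (vof (phi e x)).
Proof. by move=> h; have [] := hKK (gp_K h x). Qed.

(** The known decay covers the period to the right of 0; negative x are shifted by one period. The
    sum of the two tails replaces the minimum because sums are easier to estimate. *)
Lemma vq_decay e x : good e -> `|x| <= 2 * Leps Lc e ->
  `|vof (phi e x)| <= Ls * (expR (- b * `|x|) + expR (- b * (2 * Leps Lc e - `|x|))) /\
  `|qof (phi e x)| <= Ls * (expR (- b * `|x|) + expR (- b * (2 * Leps Lc e - `|x|))).
Proof.
move=> h; set P := 2 * Leps Lc e => xP.
have mn (y z : R) : expR (- b * Num.min y z) <= expR (- b * y) + expR (- b * z).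
  by rewrite /Num.min; case: ifP => _; rewrite ?lerDl ?lerDr expR_ge0.
have fin (a : R) y z : a <= Ls * expR (- b * Num.min y z) ->
    a <= Ls * (expR (- b * y) + expR (- b * z)).
  by move=> ha; apply: le_trans ha _; apply: ler_wpM2l; [exact: ltW|exact: mn].
have [x0|x0] := leP 0 x.
  move: xP; rewrite (ger0_norm x0) => xP.
  by have [|h1 h2] := gp_decay h (x := x); [rewrite x0|split; exact: fin].
move: xP; rewrite (ltr0_norm x0) => xP.
have [|h1 h2] := gp_decay h (x := x + P).
  by rewrite -/P; apply/andP; split; lra.
rewrite -(gp_per h x) -/P; move: h1 h2; rewrite -/P.
have -> : P - (x + P) = - x by rewrite opprD addrCA subrr addr0.
by rewrite opprK [P + x]addrC => h1 h2; rewrite ![expR (- b * - x) + _]addrC; split; exact: fin.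
Qed.

Lemma pulse_derive e x : good e ->
  [/\ isDm (fun t => cmx (uof (phi e t))) x (cmx (e *: (invmx (D1 S) *m pof (phi e x)))),
      isDm (fun t => cmx (pof (phi e t))) x
        (cmx (e *: H1 S (uof (phi e x)) (vof (phi e x)) e + H2 S (uof (phi e x)) (vof (phi e x)))),
      isDm (fun t => cmx (vof (phi e t))) x (cmx (invmx (D2 S) *m qof (phi e x))) &
      isDm (fun t => cmx (qof (phi e t))) x (cmx (G S (uof (phi e x)) (vof (phi e x)) e))].
Proof.
move=> h; have [[d1 f1] [d2 f2] [d3 f3] [d4 f4]] := gp_ode h x; split.
- by apply: isDm_eq (isDm_cmx d1) _; rewrite scalemxAr -f1 mulKmx.
- by apply: isDm_eq (isDm_cmx d2) _; rewrite f2.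
- by apply: isDm_eq (isDm_cmx d3) _; rewrite -f3 mulKmx.
- by apply: isDm_eq (isDm_cmx d4) _; rewrite f4.
Qed.

Lemma vh_derive x : isDm (fun t => cmx (vh t)) x (cmx (invmx (D2 S) *m qh x)) /\
  isDm (fun t => cmx (qh t)) x (cmx (G S u0 (vh x) 0)).
Proof.
have [[d1 f1] [d2 f2]] := hom x; split.
  by apply: isDm_eq (isDm_cmx d1) _; rewrite -f1 mulKmx.
by apply: isDm_eq (isDm_cmx d2) _; rewrite f2.
Qed.

Lemma vh_continuous : continuous vh.
Proof.
by move=> x; apply: differentiable_continuous; apply/derivable1_diffP; case: (hom x) => -[].
Qed.

Let e00' : 0 <= (0 : R) <= e0.
Proof. by rewrite lexx ltW. Qed.

Let good_e e : good e -> 0 <= e <= e0.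
Proof. by move=> h; rewrite (ltW (gp_pos h)) (gp_le h). Qed.

Definition ph x : 'cV[R]_m := p0 + \col_(i < m) int0 (fun z => H2 S u0 (vh z) i 0) x.

Lemma ph_derive x : isDm (fun t => cmx (ph t)) x (cmx (H2 S u0 (vh x))).
Proof.
move=> i j; rewrite (ord1 j); split; last first.
  by under eq_fun do rewrite mxE /=; rewrite mxE /=; exact: der_cst.
under eq_fun do rewrite !mxE /=; rewrite mxE /=.
apply: der_eq (derD (der_cst _ _) (int0_derive _ x)) _; last by rewrite add0r.
move=> t; apply/cvgrPdist_lt => a a0.
have l1 : 0 < L + 1 by rewrite ltr_wpDl // (sb_L hsb).
have vc : {for t, continuous vh} by exact: vh_continuous.
move/cvgrPdist_lt : vc => /(_ (a / (L + 1))).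
rewrite divr_gt0 // => /(_ isT); apply: filterS => s hs.
have [_ h] := sb_H2 hsb KU0 KU0 (KVh t) (KVh s) e00' e00'.
move: h; rewrite !subrr !normr0 add0r addr0 => h.
have h2 : `|H2 S u0 (vh t) i 0 - H2 S u0 (vh s) i 0| <= L * `|vh t - vh s|.
  apply: le_trans h; rewrite cmxB -cnR; have := nm_entry (cmx (H2 S u0 (vh t) - H2 S u0 (vh s))) i 0.
  by rewrite !mxE.
apply: le_lt_trans h2 _; apply: (@le_lt_trans _ _ ((L + 1) * `|vh t - vh s|)).
  by apply: ler_wpM2r => //; rewrite lerDl.
by rewrite mulrC -ltr_pdivlMr.
Qed.

Lemma ph0 : ph 0 = p0.
Proof. by apply/matrixP => i j; rewrite !mxE int0_0 addr0. Qed.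

(** Gronwall for the difference from the profile, where the initial error and the defect of the
    equations are both O(e). The result is informative only for |x| up to a multiple of -ln e. *)
Lemma pulse_close : exists C c, [/\ 0 < C, 0 < c & forall e, good e -> forall x,
  [/\ `|uof (phi e x) - u0| <= C * e * expR (c * `|x|),
      `|pof (phi e x) - ph x| <= C * e * expR (c * `|x|),
      `|vof (phi e x) - vh x| <= C * e * expR (c * `|x|) &
      `|qof (phi e x) - qh x| <= C * e * expR (c * `|x|)]].
Proof.
pose d1 := nm (cmx (invmx (D1 S))); pose d2 := nm (cmx (invmx (D2 S))).
have d10 : 0 <= d1 := nm_ge0 _; have d20 : 0 <= d2 := nm_ge0 _.
pose k := 2 * L + d2; have k0 : 0 <= k by rewrite addr_ge0 // mulr_ge0.
pose c1 := d1 * (m%:R * B) + 2 * L.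
have c10 : 0 <= c1 by rewrite addr_ge0 ?mulr_ge0.
have [c [N [c0 N0 hN]]] := @gronwall_mx R ((m + m) + (n + n)) 1 k k0.
pose C0 := (m%:R + m%:R + (n%:R + n%:R)) * B.
have C00 : 0 <= C0 by rewrite mulr_ge0 // !addr_ge0.
exists (N * (C0 + c1) + 1), (c + 1); split.
- by rewrite ltr_wpDl // mulr_ge0 // addr_ge0.
- by rewrite ltr_wpDl.
move=> e ge x; have ep := gp_pos ge.
pose X t := col_mx (col_mx (cmx (uof (phi e t)) - cmx u0) (cmx (pof (phi e t)) - cmx (ph t)))
   (col_mx (cmx (vof (phi e t)) - cmx (vh t)) (cmx (qof (phi e t)) - cmx (qh t))).
pose D t := col_mx (col_mx (cmx (e *: (invmx (D1 S) *m pof (phi e t))) - 0)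
   (cmx (e *: H1 S (uof (phi e t)) (vof (phi e t)) e + H2 S (uof (phi e t)) (vof (phi e t))) - cmx (H2 S u0 (vh t))))
   (col_mx (cmx (invmx (D2 S) *m qof (phi e t)) - cmx (invmx (D2 S) *m qh t))
     (cmx (G S (uof (phi e t)) (vof (phi e t)) e) - cmx (G S u0 (vh t) 0))).
have hX t : isDm X t (D t).
  have [h1 h2 h3 h4] := pulse_derive t ge; have [h5 h6] := vh_derive t.
  apply: isDm_col_mx; apply: isDm_col_mx; apply: isDmB => //.
  - exact: isDm_cst.
  - exact: ph_derive.
have hD t : nm (D t) <= k * nm (X t) + e * c1.
  rewrite /D /X !nm_col_mx subr0.
  set nu := nm (cmx (uof (phi e t)) - cmx u0); set np := nm (cmx (pof _) - _).
  set nv := nm (cmx (vof (phi e t)) - cmx (vh t)); set nq := nm (cmx (qof _) - _).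
  have [a1 a2 a3 a4] : [/\ 0 <= nu, 0 <= np, 0 <= nv & 0 <= nq] by split; exact: nm_ge0.
  have hu : `|uof (phi e t) - u0| <= nu by rewrite /nu cmxB; exact: cV_norm_nm.
  have hv : `|vof (phi e t) - vh t| <= nv by rewrite /nv cmxB; exact: cV_norm_nm.
  have t1 : nm (cmx (e *: (invmx (D1 S) *m pof (phi e t)))) <= e * (d1 * (m%:R * B)).
    rewrite cmxZ nmZR gtr0_norm //; apply: ler_wpM2l; first exact: ltW.
    rewrite cmxM; apply: le_trans (nmM _ _) _; apply: ler_wpM2l => //.
    apply: le_trans (nm_cV_norm _) _; apply: ler_wpM2l => //.
    by have [_ + _ _] := state_norm_ge (phi e t) => /le_trans; apply; exact: gp_B ge t.
  have [hH1 _] := sb_H1 hsb (good_KU t ge) KU0 (good_KV t ge) (KVh t) (good_e ge) e00'.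
  have [_ hH2] := sb_H2 hsb (good_KU t ge) KU0 (good_KV t ge) (KVh t) e00' e00'.
  have [_ hG] := sb_G hsb (good_KU t ge) KU0 (good_KV t ge) (KVh t) (good_e ge) e00'.
  rewrite subrr normr0 addr0 in hH2; rewrite subr0 (gtr0_norm ep) in hG.
  have t2 : nm (cmx (e *: H1 S (uof (phi e t)) (vof (phi e t)) e + H2 S (uof (phi e t)) (vof (phi e t)))
      - cmx (H2 S u0 (vh t))) <= e * L + L * (nu + nv).
    rewrite cmxD -addrA; apply: le_trans (nmD _ _) _; apply: lerD.
      by rewrite cmxZ nmZR gtr0_norm //; apply: ler_wpM2l => //; exact: ltW.
    by apply: le_trans hH2 _; apply: ler_wpM2l => //; exact: lerD.
  have t3 : nm (cmx (invmx (D2 S) *m qof (phi e t)) - cmx (invmx (D2 S) *m qh t)) <= d2 * nq.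
    by rewrite !cmxM -mulmxBr; exact: nmM.
  have t4 : nm (cmx (G S (uof (phi e t)) (vof (phi e t)) e) - cmx (G S u0 (vh t) 0)) <= L * (nu + nv + e).
    apply: le_trans hG _; apply: ler_wpM2l => //; lra.
  have m1 : 0 <= L * np by exact: mulr_ge0.
  have m2 : 0 <= L * nq by exact: mulr_ge0.
  have m3 : 0 <= d2 * nu by exact: mulr_ge0.
  have m4 : 0 <= d2 * np by exact: mulr_ge0.
  have m5 : 0 <= d2 * nv by exact: mulr_ge0.
  rewrite /k /c1; lra.
have H := hN X D (e * c1) _ hX hD x; rewrite mulr_ge0 // ?(ltW ep) // in H.
have {}H := H isT.
have X0 : nm (X 0) <= C0 * e.
  rewrite /X ph0 !nm_col_mx !cmxB.
  have [s1 s2 s3 s4] := state_norm_ge (phi e 0 - ((u0, p0, vh 0, qh 0) : state R m n)).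
  have s5 := gp_0 ge.
  have bd p (z : 'cV[R]_p) : `|z| <= `|phi e 0 - ((u0, p0, vh 0, qh 0) : state R m n)| -> nm (cmx z) <= p%:R * (B * e).
    by move=> hz; apply: le_trans (nm_cV_norm _) _; apply: ler_wpM2l => //; exact: le_trans hz s5.
  have := bd _ _ s1; have := bd _ _ s2; have := bd _ _ s3; have := bd _ _ s4.
  rewrite /= /C0; lra.
have Hx : nm (X x) <= (N * (C0 + c1) + 1) * e * expR ((c + 1) * `|x|).
  apply: le_trans H _; apply: ler_pM.
  - by rewrite mulr_ge0 // addr_ge0 ?nm_ge0 // mulr_ge0 // ltW.
  - exact: expR_ge0.
  - apply: (@le_trans _ _ (N * ((C0 + c1) * e))).
      apply: ler_wpM2l => //; rewrite mulrDl; apply: lerD => //.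
      by rewrite mulrC.
    by rewrite mulrA; apply: ler_wpM2r; [exact: ltW|rewrite lerDl].
  - by rewrite ler_expR; apply: ler_wpM2r => //; rewrite lerDl.
have [n1 n2 n3 n4] : [/\ nm (cmx (uof (phi e x)) - cmx u0) <= nm (X x),
    nm (cmx (pof (phi e x)) - cmx (ph x)) <= nm (X x),
    nm (cmx (vof (phi e x)) - cmx (vh x)) <= nm (X x) &
    nm (cmx (qof (phi e x)) - cmx (qh x)) <= nm (X x)].
  rewrite /X !nm_col_mx; set w1 := nm _; set w2 := nm _; set w3 := nm _; set w4 := nm _.
  have [a1 a2 a3 a4] : [/\ 0 <= w1, 0 <= w2, 0 <= w3 & 0 <= w4] by split; exact: nm_ge0.
  by split; lra.
by split; apply: le_trans (cV_norm_nm _) _; rewrite -cmxB; [apply: le_trans n1 _|apply: le_trans n2 _|apply: le_trans n3 _|apply: le_trans n4 _].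
Qed.

(** Being homoclinic gives convergence to 0 without a rate. The rate is inherited from the pulse by
    letting e tend to 0 at fixed x; the factor 2 counts the two tails. *)
Lemma vh_decay x : `|vh x| <= 2 * Ls * expR (- b * `|x|) /\
  `|qh x| <= 2 * Ls * expR (- b * `|x|).
Proof.
have [C [c [C0 c0 hC]]] := pulse_close.
have key (y : R) :
    (forall e, good e -> `|x| <= Leps Lc e -> y <= 2 * Ls * expR (- b * `|x|) + C * e * expR (c * `|x|)) ->
    y <= 2 * Ls * expR (- b * `|x|).
  move=> h; apply/ler_addgt0Pr => a a0.
  have [e [ge he1 he2]] : exists e, [/\ good e, `|x| <= Leps Lc e & C * e * expR (c * `|x|) <= a].
    apply: (filter_ex (F := (0 : R)^'+)); near=> e.
    have ge : good e by near: e.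
    have ep := gp_pos ge.
    split=> //.
      rewrite /Leps ler_pdivlMl //; apply: le_trans (gp_L ge).
      rewrite mulrC; apply: (@le_trans _ _ ((`|x| + 1) * e)).
        by apply: ler_wpM2r; [exact: ltW|rewrite lerDl].
      rewrite mulrC -ler_pdivlMr ?ltr_wpDl //.
      by near: e; apply: nbhs_right_le; rewrite !divr_gt0 // ltr_wpDl.
    rewrite mulrAC mulrC -ler_pdivlMr ?mulr_gt0 ?expR_gt0 //.
    by near: e; apply: nbhs_right_le; rewrite divr_gt0 // mulr_gt0 ?expR_gt0.
  by apply: le_trans (h e ge he1) _; rewrite lerD2l.
have dec e : good e -> `|x| <= Leps Lc e ->
    Ls * (expR (- b * `|x|) + expR (- b * (2 * Leps Lc e - `|x|))) <= 2 * Ls * expR (- b * `|x|).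
  move=> ge xL.
  have h : expR (- b * (2 * Leps Lc e - `|x|)) <= expR (- b * `|x|).
    by rewrite ler_expR !mulNr lerN2; apply: ler_wpM2l; [exact: ltW|lra].
  have := ler_wpM2l (ltW Ls0) h; lra.
have xle e : good e -> `|x| <= Leps Lc e -> `|x| <= 2 * Leps Lc e.
  by move=> ge xL; have := good_L ge; lra.
split; apply: key => e ge xL; have [h1 h2] := vq_decay ge (xle e ge xL);
  have [_ _ h3 h4] := hC e ge x.
  have := ler_normB (vof (phi e x)) (vof (phi e x) - vh x); rewrite opprB addrC subrK.
  have := dec e ge xL; lra.
have := ler_normB (qof (phi e x)) (qof (phi e x) - qh x); rewrite opprB addrC subrK.
have := dec e ge xL; lra.
Unshelve. all: by end_near. Qed.

(** The slope of u carries a factor e: u is almost constant on lengths much smaller than 1/e. *)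
Lemma pulse_lipschitz : exists2 C, 0 <= C & forall x y,
  `|vh x - vh y| <= C * `|x - y| /\
  forall e, good e -> `|uof (phi e x) - uof (phi e y)| <= C * e * `|x - y| /\
                      `|vof (phi e x) - vof (phi e y)| <= C * `|x - y|.
Proof.
pose d1 := nm (cmx (invmx (D1 S))); pose d2 := nm (cmx (invmx (D2 S))).
have d10 : 0 <= d1 := nm_ge0 _; have d20 : 0 <= d2 := nm_ge0 _.
pose C := d1 * (m%:R * B) + d2 * (n%:R * B) + d2 * (n%:R * (2 * Ls)).
have [c1 c2 c3] : [/\ 0 <= d1 * (m%:R * B), 0 <= d2 * (n%:R * B) & 0 <= d2 * (n%:R * (2 * Ls))].
  by split; rewrite !mulr_ge0 // ltW.
exists C => [|x y]; first by rewrite !addr_ge0.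
have lipr k (f : R -> 'cV[R]_k) (D : R -> 'M[R[i]]_(k, 1)) M :
    (forall t, isDm (fun t => cmx (f t)) t (D t)) -> (forall t, nm (D t) <= M) ->
    M <= C -> `|f x - f y| <= M * `|x - y|.
  move=> hf hM MC; apply: le_trans (cV_norm_nm _) _; rewrite -cmxB.
  exact: isDm_lipschitz hf hM x y.
have inv k (A : 'M[R]_k) (z : 'cV[R]_k) M : `|z| <= M -> nm (cmx (A *m z)) <= nm (cmx A) * (k%:R * M).
  move=> zM; rewrite cmxM; apply: le_trans (nmM _ _) _; apply: ler_wpM2l; first exact: nm_ge0.
  by apply: le_trans (nm_cV_norm _) _; apply: ler_wpM2l.
have n0 : 0 <= `|x - y| by [].
split.
  apply: (@le_trans _ _ (d2 * (n%:R * (2 * Ls)) * `|x - y|)); last by apply: ler_wpM2r => //; rewrite /C; lra.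
  apply: (lipr _ _ _ _ (fun t => (vh_derive t).1)); last by rewrite /C; lra.
  move=> t; apply: inv; have [_ h] := vh_decay t; apply: le_trans h _.
  rewrite -[leRHS]mulr1; apply: ler_wpM2l; first by rewrite mulr_ge0 // ltW.
  by rewrite -expR0 ler_expR mulNr oppr_le0 mulr_ge0 // ltW.
move=> e ge; have ep := gp_pos ge.
have bd t := state_norm_ge (phi e t).
have hu t : isDm (fun t => cmx (uof (phi e t))) t (cmx (e *: (invmx (D1 S) *m pof (phi e t)))).
  by have [h _ _ _] := pulse_derive t ge.
have hv t : isDm (fun t => cmx (vof (phi e t))) t (cmx (invmx (D2 S) *m qof (phi e t))).
  by have [_ _ h _] := pulse_derive t ge.
split.
  apply: (@le_trans _ _ (e * (d1 * (m%:R * B)) * `|x - y|)); last first.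
    by apply: ler_wpM2r => //; rewrite mulrC; apply: ler_wpM2r; [exact: ltW|rewrite /C; lra].
  apply: (lipr _ _ _ _ hu).
    move=> t; rewrite cmxZ nmZR gtr0_norm //; apply: ler_wpM2l; first exact: ltW.
    by apply: inv; have [_ h _ _] := bd t; apply: le_trans h (gp_B ge t).
  apply: (@le_trans _ _ (1 * (d1 * (m%:R * B)))); last by rewrite /C; lra.
  by apply: ler_wpM2r => //; exact: gp_le1 ge.
apply: (@le_trans _ _ (d2 * (n%:R * B) * `|x - y|)); last by apply: ler_wpM2r => //; rewrite /C; lra.
apply: (lipr _ _ _ _ hv); last by rewrite /C; lra.
by move=> t; apply: inv; have [_ _ _ h] := bd t; apply: le_trans h (gp_B ge t).
Qed.

(* The distance to phi_h is bounded by e * expR (c * y), by Gronwall, and its fast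
   part by expR (- a * y); with l = - ln e, one of the two is a power of e. *)
Lemma interpolate (y l a c : R) : 0 < a -> 0 < c -> 0 <= l -> 0 <= y ->
  Num.min (expR (- l + c * y)) (expR (- a * y)) <= expR (- (a / (a + c) * l)).
Proof.
move=> a0 c0 l0 y0; have ac : 0 < a + c by exact: addr_gt0.
rewrite ge_min !ler_expR; have [h|h] := leP ((a + c) * y) l.
  apply/orP; left; have : y <= l / (a + c) by rewrite ler_pdivlMr // mulrC.
  rewrite -(ler_pM2l c0) => h2; apply: (@le_trans _ _ (- l + c * (l / (a + c)))); first by rewrite lerD2l.
  rewrite le_eqVlt; apply/orP; left; apply/eqP; field; exact: lt0r_neq0.
apply/orP; right; have : l / (a + c) <= y by rewrite ler_pdivrMr // mulrC ltW.
by rewrite -(ler_pM2l a0) mulNr lerN2 mulrA mulrAC.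
Qed.

(** The bound bf <= 1/2 lets sqrt e count as an error of order e^bf, and rho < 1 keeps the inner
    region inside one half-period. *)
Lemma pulse_approximation : exists bf rho C, [/\ 0 < bf, bf <= 2^-1, 0 < rho, rho < 1 & 0 <= C /\
  forall e, good e -> forall x, `|x| <= e `^ (- rho) -> `|x| <= Leps Lc e ->
    `|phi e x - phi_h S u0 p0 vh qh x| <= C * e `^ bf].
Proof.
have [C [c [C0 c0 hC]]] := pulse_close.
have [Cl Cl0 hl] := pulse_lipschitz.
pose th := b / (b + c).
have th0 : 0 < th by rewrite divr_gt0 // addr_gt0.
have th1 : th < 1 by rewrite ltr_pdivrMr ?addr_gt0 // mul1r ltrDl.
pose C2 := C + 4 * Ls.
have C20 : 0 <= C2 by rewrite addr_ge0 ?(ltW C0) // mulr_ge0 // ltW.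
pose C3 := B + Cl.
have C30 : 0 <= C3 by exact: addr_ge0.
pose C4 := B + (L + L * (2 * C3 + C2)).
have C40 : 0 <= C4.
  by rewrite addr_ge0 // addr_ge0 // mulr_ge0 // addr_ge0 // mulr_ge0.
(* On |x| <= e^(-th/4) the errors are e^th in v and q and e^(1 - th/4) in u, hence at most e^(3
   th/4) in the equation for p. Integration over that length leaves e^(th/2). *)
exists (th / 2), (th / 4), (C2 + 2 * C3 + C4); split; [lra|lra|lra|lra|split].
  by apply: addr_ge0 => //; apply: addr_ge0 => //; exact: mulr_ge0.
move=> e ge x xr xL; have ep := gp_pos ge; have e1 := gp_le1 ge.
pose r := e `^ (- (th / 4)).
have mono (s t : R) : s <= t -> e `^ t <= e `^ s.
  by move=> st; rewrite !powR_exp // ler_expR; apply: ler_wnM2r => //; rewrite ln_le0.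
have r1 : 1 <= r by rewrite -(powRr0 e) /r; apply: mono; lra.
have bfp : 0 < e `^ (th / 2) by exact: powR_gt0.
have eth : e `^ th <= e `^ (th / 2) by apply: mono; lra.
have ee : e <= e `^ (th / 2) by rewrite -{1}(powRr1 (ltW ep)); apply: mono; lra.
have el : e = expR (ln e) by rewrite lnK.
have vq (t : R) : `|t| <= Leps Lc e ->
    `|vof (phi e t) - vh t| <= C2 * e `^ th /\ `|qof (phi e t) - qh t| <= C2 * e `^ th.
  move=> tL.
  have tL2 : `|t| <= 2 * Leps Lc e by have := good_L ge; lra.
  have [a1 a2] := vq_decay ge tL2; have [a3 a4] := vh_decay t.
  have [_ _ a5 a6] := hC e ge t.
  have I := @interpolate `|t| (- ln e) b c b0 c0 _ (normr_ge0 _).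
  have {}I : Num.min (e * expR (c * `|t|)) (expR (- b * `|t|)) <= e `^ th.
    rewrite powR_exp // {1}el -expRD; have := I; rewrite oppr_ge0 ln_le0 // opprK mulrN opprK => H.
    exact: H.
  have a7 : expR (- b * (2 * Leps Lc e - `|t|)) <= expR (- b * `|t|).
    by rewrite ler_expR !mulNr lerN2; apply: ler_wpM2l; [exact: ltW|lra].
  have fin (y z : R) : y <= C * e * expR (c * `|t|) -> y <= 4 * Ls * expR (- b * `|t|) ->
      y <= C2 * e `^ th.
    move=> h1 h2; rewrite /C2; move: I; rewrite ge_min => /orP[] h.
      have := ler_wpM2l (ltW C0) h; rewrite mulrA => h3.
      have : 0 <= 4 * Ls * e `^ th by rewrite !mulr_ge0 ?powR_ge0 // ltW.
      lra.
    have h4 : 0 <= 4 * Ls by rewrite mulr_ge0 // ltW.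
    have := ler_wpM2l h4 h => h3.
    have : 0 <= C * e `^ th by rewrite mulr_ge0 ?powR_ge0 // ltW.
    lra.
  have a8 := ler_wpM2l (ltW Ls0) a7.
  split; apply: fin => //.
    apply: le_trans (ler_normB _ _) _; lra.
  apply: le_trans (ler_normB _ _) _; lra.
have uu (t : R) : `|t| <= r -> `|uof (phi e t) - u0| <= 2 * C3 * (e * r).
  move=> tr.
  have -> : uof (phi e t) - u0 = (uof (phi e t) - uof (phi e 0)) + (uof (phi e 0) - u0).
    by rewrite addrA subrK.
  apply: le_trans (ler_normD _ _) _.
  have [_ /(_ e ge) [h1 _]] := hl t 0; rewrite subr0 in h1.
  have [h2 _ _ _] := state_norm_ge (phi e 0 - ((u0, p0, vh 0, qh 0) : state R m n)).
  have h3 := le_trans h2 (gp_0 ge); rewrite /= in h3.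
  have h4 : Cl * e * `|t| <= C3 * (e * r).
    rewrite -mulrA; apply: ler_pM => //; first by rewrite mulr_ge0 // ltW.
      by rewrite /C3 lerDr.
    by apply: ler_wpM2l => //; exact: ltW.
  have h5 : B * e <= C3 * (e * r).
    apply: ler_pM => //; [exact: ltW|by rewrite /C3 lerDl|].
    by rewrite -{1}[e]mulr1; apply: ler_wpM2l => //; exact: ltW.
  lra.
have er : e * r <= e `^ (3 * th / 4).
  rewrite -{1}(powRr1 (ltW ep)) /r -powRD; last by apply/implyP => _; rewrite gt_eqF.
  apply: mono; lra.
have rth : r * e `^ (3 * th / 4) = e `^ (th / 2).
  rewrite /r -powRD; last by apply/implyP => _; rewrite gt_eqF.
  by congr (_ `^ _); field.
have e34 : e `^ (3 * th / 4) <= e `^ (th / 2) by apply: mono; lra.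
have et34 : e `^ th <= e `^ (3 * th / 4) by apply: mono; lra.
have ee34 : e <= e `^ (3 * th / 4) by rewrite -{1}(powRr1 (ltW ep)); apply: mono; lra.
have rr : 0 <= r by lra.
have C23 : 0 <= 2 * C3 by exact: mulr_ge0.
have pp : `|pof (phi e x) - ph x| <= C4 * e `^ (th / 2).
  pose Z t := cmx (pof (phi e t)) - cmx (ph t).
  pose D t := cmx (e *: H1 S (uof (phi e t)) (vof (phi e t)) e + H2 S (uof (phi e t)) (vof (phi e t))) - cmx (H2 S u0 (vh t)).
  have hZ t : isDm Z t (D t).
    by have [_ h _ _] := pulse_derive t ge; apply: isDmB => //; exact: ph_derive.
  have hD t : `|t - 0| <= `|x| -> nm (D t - 0) <= (L + L * (2 * C3 + C2)) * e `^ (3 * th / 4).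
    rewrite !subr0 => tx.
    have [h1 _] := sb_H1 hsb (good_KU t ge) KU0 (good_KV t ge) (KVh t) (good_e ge) e00'.
    have [_ h2] := sb_H2 hsb (good_KU t ge) KU0 (good_KV t ge) (KVh t) e00' e00'.
    rewrite subrr normr0 addr0 in h2.
    rewrite /D cmxD -addrA; apply: le_trans (nmD _ _) _; rewrite cmxZ nmZR gtr0_norm // mulrDl; apply: lerD.
      by rewrite mulrC; apply: ler_pM => //; [exact: nm_ge0|exact: ltW].
    apply: le_trans h2 _; rewrite -mulrA; apply: ler_wpM2l => //; rewrite mulrDl; apply: lerD.
      apply: le_trans (uu t (le_trans tx xr)) _.
      by apply: ler_wpM2l => //; rewrite mulr_ge0.
    have [h3 _] := vq t (le_trans tx xL).
    by apply: le_trans h3 _; apply: ler_wpM2l.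
  have H := @isDm_taylor R m 1 Z D 0 0 x _ hZ hD.
  rewrite add0r scaler0 subr0 in H.
  have -> : pof (phi e x) - ph x = (pof (phi e 0) - p0) +
      ((pof (phi e x) - ph x) - (pof (phi e 0) - ph 0)).
    by rewrite ph0 [RHS]addrC subrK.
  apply: le_trans (ler_normD _ _) _; rewrite /C4 mulrDl; apply: lerD.
    have [_ h2 _ _] := state_norm_ge (phi e 0 - ((u0, p0, vh 0, qh 0) : state R m n)).
    by apply: le_trans h2 (le_trans (gp_0 ge) _); apply: ler_wpM2l.
  apply: le_trans (cV_norm_nm _) _.
  have -> : cmx (pof (phi e x) - ph x - (pof (phi e 0) - ph 0)) = Z x - Z 0.
    by rewrite /Z !cmxB.
  apply: le_trans H _; rewrite -[leLHS]mulrA; apply: ler_wpM2l.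
    by apply: addr_ge0 => //; apply: mulr_ge0 => //; exact: addr_ge0.
  by rewrite -rth mulrC; apply: ler_wpM2r => //; exact: powR_ge0.
have fin (y M : R) : 0 <= M -> M <= C2 + 2 * C3 + C4 -> y <= M * e `^ (th / 2) ->
    y <= (C2 + 2 * C3 + C4) * e `^ (th / 2).
  by move=> M0 hM h; apply: le_trans h _; apply: ler_wpM2r => //; exact: ltW.
have [v1 v2] := vq x xL.
apply: state_norm_le.
- apply: (fin _ (2 * C3)) => //; first by lra.
  apply: le_trans (uu x xr) _; apply: ler_wpM2l => //; exact: le_trans er e34.
- by apply: (fin _ C4) => //; lra.
- apply: (fin _ C2) => //; first by lra.
  by apply: le_trans v1 _; apply: ler_wpM2l.
- apply: (fin _ C2) => //; first by lra.
  by apply: le_trans v2 _; apply: ler_wpM2l.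
Qed.

Lemma fast22_dist u v e l u' v' e' l' :
  KU u -> KU u' -> KV v -> KV v' -> 0 <= e <= e0 -> 0 <= e' <= e0 ->
  nm (fast22 S u v e l - fast22 S u' v' e' l') <=
  L * (`|u - u'| + `|v - v'| + `|e - e'|) + n%:R * n%:R * cn (l - l').
Proof.
move=> h1 h2 h3 h4 h5 h6; have [_ h] := sb_dvG hsb h1 h2 h3 h4 h5 h6.
rewrite opp_block_mx add_block_mx !subrr nm_block !nm0 !add0r addr0.
have -> : cmx (dvG S u v e) + l%:M - (cmx (dvG S u' v' e') + l'%:M) =
   (cmx (dvG S u v e) - cmx (dvG S u' v' e')) + (l - l')%:M.
  by rewrite opprD addrACA raddfB.
by apply: le_trans (nmD _ _) _; apply: lerD h _; exact: nm_scalar_mx.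
Qed.

Lemma fast21_dist u v e u' v' e' :
  KU u -> KU u' -> KV v -> KV v' -> 0 <= e <= e0 -> 0 <= e' <= e0 ->
  nm (fast21 S u v e - fast21 S u' v' e') <= L * (`|u - u'| + `|v - v'| + `|e - e'|).
Proof.
move=> h1 h2 h3 h4 h5 h6; have [_ h] := sb_duG hsb h1 h2 h3 h4 h5 h6.
by rewrite opp_block_mx add_block_mx !subr0 nm_block !nm0 !add0r addr0.
Qed.

Lemma fast21_le u v e : KU u -> KV v -> 0 <= e <= e0 -> nm (fast21 S u v e) <= L * `|v|.
Proof.
move=> h1 h2 h3; have := fast21_dist h1 h1 h2 KV0 h3 h3.
have -> : fast21 S u 0 e = 0.
  by apply: nm_eq0; rewrite nm_block (pd_duG0 hP h1 h3) /cmx map_mx0 !nm0 !addr0.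
by rewrite !subr0 !subrr !normr0 add0r addr0.
Qed.

Lemma vanish_exp T (G : set_system T) {GF : Filter G} (x : T -> R) c : 0 < c ->
  (forall M, G [set k | M < `|x k|]) -> vanish G (fun k => expR (- c * `|x k|)).
Proof.
move=> c0 hx a a0; apply: filterS (hx (- (ln a / c))) => k /= h.
rewrite -[ltRHS](lnK a0) ltr_expR mulNr ltrNl.
by move: h; rewrite -mulNr ltr_pdivrMr // mulrC.
Qed.

(** Decay is known in the central cell, but the localized estimate needs all x. The representative y
    carries the values of periodic functions, and the last clause compares exponential weights at y
    and at x. *)
Lemma fold_orbit e x : good e -> exists y, [/\ `|y| <= Leps Lc e,
  (forall T (f : R -> T), (forall t, f (t + 2 * Leps Lc e) = f t) -> f x = f y),
  (`|x| <= Leps Lc e -> y = x) &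
  forall x0, `|x0| <= Leps Lc e -> `|x0| <= `|y| + `|x - x0|].
Proof.
move=> ge; have Lp := good_L ge; have P0 : 0 < 2 * Leps Lc e by rewrite mulr_gt0.
have hP2 : 2 * Leps Lc e / 2 = Leps Lc e by field.
have [xL|xL] := leP `|x| (Leps Lc e).
  exists x; split=> // x0 _.
  by have := ler_normB x (x - x0); rewrite opprB addrC subrK.
have [k hk] := fold_centered x P0; rewrite hP2 in hk.
exists (x + k%:~R * (2 * Leps Lc e)); split=> //.
- by move=> T f pf; rewrite (periodic_int pf).
- by move=> x0 hx0; apply: fold_dist => //; rewrite hP2.
Qed.

Lemma A21_decay e x kappa : good e -> 0 <= kappa <= b -> `|x| <= Leps Lc e ->
  nm (A21 S e (phi e) x) <= 2 * L * Ls * expR (- kappa * `|x|).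
Proof.
move=> ge /andP[k0 kb] xL.
apply: le_trans (fast21_le (good_KU x ge) (good_KV x ge) (good_e ge)) _.
rewrite [2 * L]mulrC -!mulrA; apply: ler_wpM2l => //.
have [|h _] := vq_decay (x := x) ge; first by have := good_L ge; lra.
apply: le_trans h _; rewrite [leRHS]mulrCA; apply: ler_wpM2l; first exact: ltW.
have e1 : expR (- b * `|x|) <= expR (- kappa * `|x|).
  by rewrite ler_expR !mulNr lerN2; apply: ler_wpM2r.
have e2 : expR (- b * (2 * Leps Lc e - `|x|)) <= expR (- kappa * `|x|).
  rewrite ler_expR !mulNr lerN2; apply: ler_pM => //; lra.
lra.
Qed.

Lemma A21_0_decay x kappa : 0 <= kappa <= b ->
  nm (A21_0 S u0 vh x) <= 2 * L * Ls * expR (- kappa * `|x|).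
Proof.
move=> /andP[k0 kb].
apply: le_trans (fast21_le KU0 (KVh x) e00') _.
rewrite [2 * L]mulrC -!mulrA; apply: ler_wpM2l => //.
have [h _] := vh_decay x; apply: le_trans h _; rewrite mulrA.
apply: ler_wpM2l; first by rewrite mulr_ge0 // ltW.
by rewrite ler_expR !mulNr lerN2; apply: ler_wpM2r.
Qed.

(** * A priori estimates uniform in e and lambda *)

Section UniformFamily.
Variables (Sig : set R[i]) (Ml : R).
Hypothesis hSig : forall l, Sig l -> cn l <= Ml.

Lemma coefficients_bl : exists2 M, 0 < M &
  (forall e l, good e -> Sig l ->
    [/\ bl M (fun x => A11 S e (phi e) x l), bl M (A12 S e (phi e)),
        bl M (A21 S e (phi e)) & bl M (fun x => A22 S e (phi e) x l)]) /\
  forall l, Sig l -> bl M (A22_0 S u0 vh l).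
Proof.
have [Cl Cl0 hl] := pulse_lipschitz.
pose d1 := nm (cmx (invmx (D1 S))); pose d2 := nm (cmx (invmx (D2 S))).
have d10 : 0 <= d1 := nm_ge0 _; have d20 : 0 <= d2 := nm_ge0 _.
pose M0 := L * (2 * Cl + 1).
have M00 : 0 <= M0 by rewrite mulr_ge0 // addr_ge0 // mulr_ge0.
pose ml := m%:R * m%:R * `|Ml|; pose nl := n%:R * n%:R * `|Ml|.
have [ml0 nl0] : 0 <= ml /\ 0 <= nl by rewrite !mulr_ge0.
have orbit p q (g : 'cV[R]_m -> 'cV[R]_n -> R -> 'M[R]_(p, q)) e :
    lipb KU KV e0 g L -> good e -> bl M0 (fun x => cmx (g (uof (phi e x)) (vof (phi e x)) e)).
  move=> hg ge; have ku x := good_KU x ge; have kv x := good_KV x ge.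
  split=> [t|x y].
    have [h _] := hg _ _ _ _ _ _ (ku t) (ku t) (kv t) (kv t) (good_e ge) (good_e ge).
    apply: le_trans h _; rewrite /M0 mulrDr mulr1 lerDr mulr_ge0 // mulr_ge0 //.
  have [_ h] := hg _ _ _ _ _ _ (ku x) (ku y) (kv x) (kv y) (good_e ge) (good_e ge).
  apply: le_trans h _; rewrite subrr normr0 addr0 -mulrA; apply: ler_wpM2l => //.
  have [_ /(_ e ge) [h1 h2]] := hl x y.
  have h3 : Cl * e * `|x - y| <= Cl * `|x - y|.
    apply: ler_wpM2r => //; rewrite -[leRHS]mulr1; apply: ler_wpM2l => //; exact: gp_le1 ge.
  have := normr_ge0 (x - y); lra.
have sc p l : Sig l -> nm (l%:M : 'M[R[i]]_p) <= p%:R * p%:R * `|Ml|.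
  move=> sl; apply: le_trans (nm_scalar_mx _ _) _; apply: ler_wpM2l; first by rewrite mulr_ge0.
  exact: le_trans (hSig sl) (ler_norm _).
have blsc p l : Sig l -> bl (p%:R * p%:R * `|Ml|) (fun=> l%:M : 'M[R[i]]_p).
  by move=> sl; apply: bl_weaken (sc p l sl) (bl_cst _).
have ble p q (X : R -> 'M[R[i]]_(p, q)) N e : good e -> bl N X -> bl N (fun t => e%:C *: X t).
  move=> ge hX; apply: bl_weaken (blZ e hX); rewrite gtr0_norm ?(gp_pos ge) //.
  by rewrite -[leRHS]mul1r; apply: ler_wpM2r; [exact: bl_ge0 hX|exact: gp_le1 ge].
exists (d1 + d2 + ml + nl + 2 * M0 + 1); first by rewrite ltr_wpDl // !addr_ge0 // mulr_ge0.
split=> [e l ge sl|l sl].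
  split.
  - apply: bl_weaken (bl_antidiag (cmx (invmx (D1 S))) (blD (ble _ _ _ _ _ ge (blD (orbit _ _ _ e (sb_duH1 hsb) ge) (blsc m l sl))) (orbit _ _ _ e (sb_duH2 hsb) ge))).
    rewrite -/d1 -/ml; lra.
  - have -> : A12 S e (phi e) = (fun x => block_mx 0 0 (e%:C *: cmx (dvH1 S (uof (phi e x)) (vof (phi e x)) e) + cmx (dvH2 S (uof (phi e x)) (vof (phi e x)))) 0).
      by apply/funext => x; rewrite /A12 cmxD cmxZ.
    apply: bl_weaken (bl_antidiag 0 (blD (ble _ _ _ _ _ ge (orbit _ _ _ e (sb_dvH1 hsb) ge)) (orbit _ _ _ e (sb_dvH2 hsb) ge))).
    rewrite nm0; lra.
  - apply: bl_weaken (bl_antidiag 0 (orbit _ _ _ e (sb_duG hsb) ge)).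
    rewrite nm0; lra.
  - apply: bl_weaken (bl_antidiag (cmx (invmx (D2 S))) (blD (orbit _ _ _ e (sb_dvG hsb) ge) (blsc n l sl))).
    rewrite -/d2 -/nl; lra.
have hv : bl M0 (fun x => cmx (dvG S u0 (vh x) 0)).
  have kv := pd_KVh hP.
  split=> [t|x y].
    have [h _] := sb_dvG hsb KU0 KU0 (kv t) (kv t) e00' e00'.
    by apply: le_trans h _; rewrite /M0 mulrDr mulr1 lerDr mulr_ge0 // mulr_ge0.
  have [_ h] := sb_dvG hsb KU0 KU0 (kv x) (kv y) e00' e00'.
  apply: le_trans h _; rewrite !subrr !normr0 addr0 add0r -mulrA; apply: ler_wpM2l => //.
  have [h1 _] := hl x y.
  have := normr_ge0 (x - y); have : 0 <= Cl * `|x - y| by exact: mulr_ge0.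
  lra.
apply: bl_weaken (bl_antidiag (cmx (invmx (D2 S))) (blD hv (blsc n l sl))).
rewrite -/d2 -/nl; lra.
Qed.

Variable q : nat.
(** Required at all limit points of [Sig], since the compactness argument passes to limits of the
    parameter. *)
Hypothesis hlim : forall l, (forall a : R, 0 < a -> exists2 k, Sig k & cn (k - l) < a) ->
  no_bounded_solution q (A22_0 S u0 vh l) /\
  forall z, K z -> no_bounded_solution q (fun=> fast22 S (uof z) 0 0 l).

Lemma hlim_ultra T (G : set_system T) (f : T -> R[i]) l : UltraFilter G ->
  G [set k | Sig (f k)] -> vanish G (fun k => cn (f k - l)) ->
  no_bounded_solution q (A22_0 S u0 vh l) /\
  forall z, K z -> no_bounded_solution q (fun=> fast22 S (uof z) 0 0 l).
Proof.
move=> GU GS Gl; apply: hlim => a a0.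
by have [k [h1 h2]] := filter_ex (filterI GS (Gl a a0)); exists (f k).
Qed.

Lemma apriori_fast_limit : exists C, 0 < C /\
  forall l, Sig l -> apriori q (A22_0 S u0 vh l) C.
Proof.
have [M M0 [_ hM]] := coefficients_bl.
have [Cl Cl0 hl] := pulse_lipschitz.
(* The principal filter of [Sig]: eventual then means for all of [Sig], and no parameter e is
   involved. *)
pose F : set_system R[i] := [set P | forall l, Sig l -> P l].
have FF : Filter F.
  split=> [l //|P Q hp hq l sl|P Q PQ hp l sl]; last exact: PQ (hp l sl).
  by split; [exact: hp|exact: hq].
have [||C [C0 hC]] := @apriori_of_limits R R[i] F FF q (n + n)
    (fun l => A22_0 S u0 vh l) M; last by exists C; split.
  exact: hM.
move=> G Ai GU GF hA.
have GS : G [set k | Sig k.1] by apply: GF.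
have [l0 hl0] : exists l0, vanish G (fun k => cn (k.1 - l0)).
  by apply: (ultra_lim_complex (M := Ml)); apply: filterS GS => k /=; exact: hSig.
have [NB1 NB2] := hlim_ultra GU GS hl0.
(* Bounded translations converge and give a translate of the limit problem. Unbounded ones push vh
   to 0 and leave the constant matrix at u0. *)
have [[M1 hM1]|nM] := pselect (exists M1, G [set k | `|k.2| <= M1]).
  have [x0 _ hx0] := ultra_lim_real GU hM1.
  suff -> : Ai = (fun t => A22_0 S u0 vh l0 (x0 + t)) by exact: no_bounded_solution_shift.
  apply/funext => t; apply: (clim_unique (hA t)).
  apply: (vanish_clim (g := fun k => L * (Cl * `|k.2 - x0|) + n%:R * n%:R * cn (k.1 - l0))).
    apply: nearW => k /=.
    apply: le_trans (fast22_dist _ _ KU0 KU0 (KVh _) (KVh _) e00' e00') _.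
    rewrite !subrr !normr0 addr0 add0r lerD2r; apply: ler_wpM2l => //.
    have [h _] := hl (k.2 + t) (x0 + t); apply: le_trans h _.
    by rewrite [k.2 + t]addrC [x0 + t]addrC opprD addrACA subrr add0r.
  apply: vanishD; apply: vanishZ; rewrite ?mulr_ge0 //.
  by apply: vanishZ => //; exact: vanish_dist.
have hx M1 : G [set k | M1 < `|k.2|].
  have [h|h] := in_ultra_setVsetC [set k | `|k.2| <= M1] GU; first by case: nM; exists M1.
  by apply: filterS h => k /= /negP; rewrite -ltNge.
have [z Kz zu] := pd_u0 hP.
suff -> : Ai = (fun=> fast22 S (uof z) 0 0 l0) by exact: NB2.
apply/funext => t; apply: (clim_unique (hA t)).
apply: (vanish_clim (g := fun k => L * (2 * Ls * expR (b * `|t|) * expR (- b * `|k.2|)) + n%:R * n%:R * cn (k.1 - l0))).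
  apply: nearW => k /=; rewrite zu.
  apply: le_trans (fast22_dist _ _ KU0 KU0 (KVh _) KV0 e00' e00') _.
  rewrite !subrr !normr0 subr0 addr0 add0r lerD2r; apply: ler_wpM2l => //.
  have [h _] := vh_decay (k.2 + t); apply: le_trans h _; rewrite -[leRHS]mulrA.
  apply: ler_wpM2l; first by rewrite mulr_ge0 // ltW.
  rewrite -expRD ler_expR !mulNr -mulrN -mulrN -mulrDr; apply: ler_wpM2l; first exact: ltW.
  have := ler_normB (k.2 + t) t; rewrite addrK; lra.
apply: vanishD; apply: vanishZ; rewrite ?mulr_ge0 //.
apply: vanishZ; first by rewrite !mulr_ge0 ?expR_ge0 // ltW.
exact: vanish_exp.
Qed.

(* Translated by y, the coefficient matrix converges as e tends to 0 to a translate
   of A22_0 if y stays bounded modulo the period, and to a constant hyperbolic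
   matrix otherwise. *)
Lemma apriori_fast : exists C, 0 < C /\
  \forall e \near 0^'+, forall l, Sig l -> apriori q (fun x => A22 S e (phi e) x l) C.
Proof.
have [M M0 [hM _]] := coefficients_bl.
have [Cl Cl0 hl] := pulse_lipschitz.
have [Cc [cc [Cc0 cc0 hcl]]] := pulse_close.
(* Sets containing all pairs (e, l) with e small and l in [Sig], so that smallness of e does not
   depend on l. *)
pose F : set_system (R * R[i]) :=
  [set P | \forall e \near 0^'+, forall l, Sig l -> P (e, l)].
have FF : Filter F.
  split=> [|P Q hp hq|P Q PQ hp].
  - exact: nearW.
  - have {}hp : \forall e \near (0 : R)^'+, forall l, Sig l -> P (e, l) := hp.
    have {}hq : \forall e \near (0 : R)^'+, forall l, Sig l -> Q (e, l) := hq.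
    by apply: filterS2 hp hq => e hp hq l sl; split; [exact: hp|exact: hq].
  - have {}hp : \forall e \near (0 : R)^'+, forall l, Sig l -> P (e, l) := hp.
    by apply: filterS hp => e hp l sl; exact: PQ (hp l sl).
have [||C [C0 hC]] := @apriori_of_limits R (R * R[i])%type F FF q (n + n)
    (fun k x => A22 S k.1 (phi k.1) x k.2) M; last by exists C; split.
  by apply: filterS (pd_near hP) => e ge l sl; have [] := hM e l ge sl.
move=> G Ai GU GF hA.
have Gg : G [set k | good k.1.1 /\ Sig k.1.2].
  by apply: (GF [set k | good k.1 /\ Sig k.2]); apply: filterS (pd_near hP) => e ge l sl.
have Ge : vanish G (fun k => k.1.1).
  move=> a a0; apply: (GF [set k | k.1 < a]).
  by have := nbhs_right_lt a0; apply: filterS => e ea l sl.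
have GS : G [set k | Sig k.1.2] by apply: filterS Gg => k [].
have [l0 hl0] : exists l0, vanish G (fun k => cn (k.1.2 - l0)).
  by apply: (ultra_lim_complex (M := Ml)); apply: filterS GS => k /=; exact: hSig.
have [NB1 NB2] := hlim_ultra GU GS hl0.
have fold (k : R * R[i] * R) : exists y, good k.1.1 -> `|y| <= Leps Lc k.1.1 /\
    forall t, phi k.1.1 (k.2 + t) = phi k.1.1 (y + t).
  have [ge|] := pselect (good k.1.1); last by exists 0.
  have [y [yL yp _ _]] := fold_orbit k.2 ge; exists y => _; split=> // t.
  by apply: (yp _ (fun s => phi k.1.1 (s + t))) => s /=; rewrite addrAC (gp_per ge).
have [y hy] := choice fold.
(* The half-period exceeds every bound, so a base point of the central cell translated by a fixed t
   stays where [vq_decay] applies. *)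
have GL M1 : G [set k | M1 <= Leps Lc k.1.1].
  have M1p : 0 < L0 / 2 / (`|M1| + 1) by rewrite !divr_gt0 // ?(pd_L0 hP) // ltr_wpDl.
  apply: filterS2 Gg (Ge _ M1p) => k [ge _] /= h.
  rewrite /Leps ler_pdivlMl ?(gp_pos ge) //; apply: le_trans (gp_L ge).
  apply: (@le_trans _ _ (k.1.1 * (`|M1| + 1))).
    apply: ler_wpM2l; first exact: ltW (gp_pos ge).
    by apply: le_trans (ler_norm _) _; rewrite lerDl.
  by rewrite -ler_pdivlMr ?ltr_wpDl // ltW.
have KUg e x (ge : good e) : KU (uof (phi e x)) := good_KU x ge.
have KVg e x (ge : good e) : KV (vof (phi e x)) := good_KV x ge.
have [[M1 hM1]|nM] := pselect (exists M1, G [set k | `|y k| <= M1]).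
  have [x0 _ hx0] := ultra_lim_real GU hM1.
  suff -> : Ai = (fun t => A22_0 S u0 vh l0 (x0 + t)) by exact: no_bounded_solution_shift.
  apply/funext => t; apply: (clim_unique (hA t)).
  apply: (vanish_clim (g := fun k => L * ((2 * Cc * expR (cc * (M1 + `|t|)) + 1) * k.1.1 + Cl * `|y k - x0|) + n%:R * n%:R * cn (k.1.2 - l0))).
    apply: filterS2 Gg hM1 => k [ge sl] /= yM.
    have [yL yp] := hy k ge; have ep := gp_pos ge.
    rewrite /A22 yp.
    apply: le_trans (fast22_dist _ _ (KUg _ _ ge) KU0 (KVg _ _ ge) (KVh _) (good_e ge) e00') _.
    rewrite lerD2r; apply: ler_wpM2l => //; rewrite subr0 (gtr0_norm ep).
    have [h1 _ h2 _] := hcl _ ge (y k + t).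
    have [h3 _] := hl (y k + t) (x0 + t).
    have h4 : expR (cc * `|y k + t|) <= expR (cc * (M1 + `|t|)).
      rewrite ler_expR; apply: ler_wpM2l; first exact: ltW.
      by apply: le_trans (ler_normD _ _) _; rewrite lerD2r.
    have h5 : Cc * k.1.1 * expR (cc * `|y k + t|) <= Cc * k.1.1 * expR (cc * (M1 + `|t|)).
      by apply: ler_wpM2l => //; rewrite mulr_ge0 // ltW.
    have h6 : `|vof (phi k.1.1 (y k + t)) - vh (x0 + t)| <=
       `|vof (phi k.1.1 (y k + t)) - vh (y k + t)| + `|vh (y k + t) - vh (x0 + t)|.
      by apply: le_trans (ler_normD _ _); rewrite addrA subrK.
    have e6 : y k + t - (x0 + t) = y k - x0 by ring.
    rewrite e6 in h3; lra.
  apply: vanishD; apply: vanishZ; rewrite ?mulr_ge0 //.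
  apply: vanishD; apply: vanishZ => //; last exact: vanish_dist.
  by rewrite addr_ge0 // !mulr_ge0 ?expR_ge0 // ltW.
have hx M1 : G [set k | M1 < `|y k|].
  have [h|h] := in_ultra_setVsetC [set k | `|y k| <= M1] GU; first by case: nM; exists M1.
  by apply: filterS h => k /= /negP; rewrite -ltNge.
(* Far from the pulse v is small, while u may be anywhere in K. Compactness selects its limit, and
   translating by t changes u only by O(e |t|). *)
have [z Kz hz] : exists2 z, K z & phi k.1.1 (y k) @[k --> G] --> z.
  apply: ultra_lim_compact => //; first exact: pd_compact hP.
  by apply: filterS Gg => k [ge _]; exact: gp_K ge _.
suff -> : Ai = (fun=> fast22 S (uof z) 0 0 l0) by exact: NB2.
apply/funext => t; apply: (clim_unique (hA t)).
apply: (vanish_clim (g := fun k => L * ((Cl * `|t| + 1) * k.1.1 + `|phi k.1.1 (y k) - z| +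
   2 * Ls * expR (b * `|t|) * expR (- b * `|y k|)) + n%:R * n%:R * cn (k.1.2 - l0))).
  apply: filterS2 Gg (GL `|t|) => k [ge sl] /= tL.
  have [yL yp] := hy k ge; have ep := gp_pos ge.
  rewrite /A22 yp.
  have [KUz _] := pd_K hP Kz.
  apply: le_trans (fast22_dist _ _ (KUg _ _ ge) KUz (KVg _ _ ge) KV0 (good_e ge) e00') _.
  rewrite lerD2r; apply: ler_wpM2l => //; rewrite !subr0 (gtr0_norm ep).
  have h1 : `|uof (phi k.1.1 (y k + t)) - uof z| <= Cl * k.1.1 * `|t| + `|phi k.1.1 (y k) - z|.
    have -> : uof (phi k.1.1 (y k + t)) - uof z =
      (uof (phi k.1.1 (y k + t)) - uof (phi k.1.1 (y k))) + (uof (phi k.1.1 (y k)) - uof z).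
      by rewrite addrA subrK.
    apply: le_trans (ler_normD _ _) _; apply: lerD.
      by have [_ /(_ _ ge) [h _]] := hl (y k + t) (y k); rewrite addrAC subrr add0r in h.
    by have [h _ _ _] := state_norm_ge (phi k.1.1 (y k) - z).
  have ny : `|y k| <= `|y k + t| + `|t| by have := ler_normB (y k + t) t; rewrite addrK.
  have ny2 : `|y k + t| <= `|y k| + `|t| by exact: ler_normD.
  have h2 : `|y k + t| <= 2 * Leps Lc k.1.1 by lra.
  have [h3 _] := vq_decay ge h2.
  have ex (w : R) : `|y k| - `|t| <= w -> expR (- b * w) <= expR (b * `|t|) * expR (- b * `|y k|).
    move=> hw; rewrite -expRD ler_expR.
    have := ler_wpM2l (ltW b0) hw; lra.
  have h4 := ex _ (_ : `|y k| - `|t| <= `|y k + t|).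
  have h5 := ex _ (_ : `|y k| - `|t| <= 2 * Leps Lc k.1.1 - `|y k + t|).
  have {}h4 := h4 ltac:(lra); have {}h5 := h5 ltac:(lra).
  have := ler_wpM2l (ltW Ls0) (lerD h4 h5); lra.
apply: vanishD; apply: vanishZ; rewrite ?mulr_ge0 //.
apply: vanishD; last first.
  apply: vanishZ; first by rewrite !mulr_ge0 ?expR_ge0 // ltW.
  exact: vanish_exp.
apply: vanishD; last exact: vanish_dist.
by apply: vanishZ => //; rewrite addr_ge0 // mulr_ge0.
Qed.

End UniformFamily.

End PulseEstimates.

(** * The invariant graph *)

(** The difference is measured against the limit matrix a0, since the estimate for a0 is applied to
    it; the remaining terms form the source. *)
Lemma linear_defect (R : comPzRingType) p q (a a0 : 'M[R]_p) (u x f f0 g : 'M[R]_(p, q)) :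
  a *m u + (f - g) - (a0 *m x + f0) - a0 *m (u - x) = (a - a0) *m u + (f - f0) - g.
Proof.
rewrite mulmxBl mulmxBr; move: (a *m u) (a0 *m u) (a0 *m x) => a1 a2 a3.
by apply/matrixP => i j; rewrite !mxE; ring.
Qed.

Lemma riccati_solution (R : realType) (m n : nat) (S : rd_system R m n)
    (KU : set 'cV[R]_m) (KV : set 'cV[R]_n) (phi : R -> R -> state R m n)
    (Lc : R -> R) (L0 : R) (u0 p0 : 'cV[R]_m) (vh qh : R -> 'cV[R]_n)
    (e0 L B Ls b : R) (K : set (state R m n))
    (hP : pulse_data S KU KV phi Lc L0 u0 p0 vh qh e0 L B Ls b K)
    (Sig : set R[i]) (Ml : R) (X : R[i] -> R -> 'M[R[i]]_(n + n, m + m))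
    (bf rho Cf : R) : (0 < m)%N -> (forall l, Sig l -> cn l <= Ml) ->
  (forall l, (forall a : R, 0 < a -> exists2 k, Sig k & cn (k - l) < a) ->
    no_bounded_solution (m + m) (A22_0 S u0 vh l) /\
    forall z, K z -> no_bounded_solution (m + m) (fun=> fast22 S (uof z) 0 0 l)) ->
  (forall l, Sig l ->
    (forall x, isDm (X l) x (A22_0 S u0 vh l x *m X l x + A21_0 S u0 vh x)) /\
    exists M, forall x, nm (X l x) <= M) ->
  bf <= 2^-1 -> 0 < rho -> 0 <= Cf ->
  (forall e, good_parameter S KU KV phi Lc L0 u0 p0 vh qh e0 B Ls b K e ->
    forall x, `|x| <= e `^ (- rho) -> `|x| <= Leps Lc e ->
    `|phi e x - phi_h S u0 p0 vh qh x| <= Cf * e `^ bf) ->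
  (\forall e \near (0 : R)^'+, 2 * e `^ (- rho) <= Leps Lc e) ->
  exists C,
  \forall e \near 0^'+, forall l, Sig l -> exists U Lu,
    [/\ bl Lu U, (forall x, U (x + 2 * Leps Lc e) = U x), (forall x, nm (U x) <= C),
      (forall x, isDm U x (A22 S e (phi e) x l *m U x + (A21 S e (phi e) x -
         (Num.sqrt e)%:C *: (U x *m A11 S e (phi e) x l + U x *m A12 S e (phi e) x *m U x)))) &
      forall x, `|x| <= Leps Lc e -> nm (U x - X l x) <= C * e `^ bf /\
        (e `^ (- rho) < `|x| -> nm (U x) <= C * e ^+ 3)].
Proof.
move=> m_gt0 hSig hlim hX bf1 rho0 Cf0 hf hrho.
pose good := good_parameter S KU KV phi Lc L0 u0 p0 vh qh e0 B Ls b K.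
have L0' : 0 <= L by exact: sb_L (pd_sb hP).
have KU0 : KU u0 by have [z Kz <-] := pd_u0 hP; have [] := pd_K hP Kz.
have e00' : 0 <= (0 : R) <= e0 by rewrite lexx ltW // (pd_e0 hP).
have good_e e : good e -> 0 <= e <= e0.
  by move=> h; rewrite (ltW (gp_pos h)) (gp_le h).
have [C1 [C10 hC1]] := apriori_fast hP hSig hlim.
have [C2 [C20 hC2]] := apriori_fast_limit hP hSig hlim.
have [M M0 [hM hM0]] := coefficients_bl hP hSig.
pose C := Num.max C1 C2.
have C0 : 0 < C by rewrite lt_max C10.
have mono p (A : R -> 'M[R[i]]_p) c : c <= C -> apriori (m + m) A c -> apriori (m + m) A C.
  move=> cC h w D N h1 h2 h3 x; apply: le_trans (h w D N h1 h2 h3 x) _.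
  by apply: ler_wpM2r => //; exact: le_trans (nm_ge0 _) (h3 0).
(* Twice the bound C M of the problem without coupling, which leaves room for the quadratic term. *)
pose r := 2 * C * M.
have r0 : 0 < r by rewrite !mulr_gt0.
have b0 := pd_b hP; have Ls0 := pd_Ls hP.
(* No faster than the decay of A21, and with C kappa <= 1/4, so that another quarter remains for the
   coupling. *)
pose kappa := Num.min b (4 * C)^-1.
have kp : 0 < kappa by rewrite lt_min b0 invr_gt0 mulr_gt0.
have kb : 0 <= kappa <= b by rewrite (ltW kp) ge_min lexx.
have kC : C * kappa <= 4^-1.
  have h : kappa <= (4 * C)^-1 by rewrite ge_min lexx orbT.
  apply: le_trans (ler_wpM2l (ltW C0) h) _.
  by rewrite invfM mulrCA mulfV ?gt_eqF // mulr1.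
have [Ce Ce0 hCe] := @exp_small R kappa rho 3 kp rho0.
pose N1 := 2 * L * Ls.
have N10 : 0 <= N1 by rewrite !mulr_ge0 // ltW.
pose Cu := 4 * C * N1.
have Cu0 : 0 <= Cu by rewrite !mulr_ge0 // ltW.
pose N2 := L * (2 * Cf + 1) * (r + 1) + M * r * (1 + r).
have N20 : 0 <= N2 by rewrite addr_ge0 // !mulr_ge0 ?addr_ge0 ?mulr_ge0 // ltW.
pose N3 := (3 * M + M * r) * Cu + 2 * N1.
have N30 : 0 <= N3.
  have h1 : 0 <= M * r by rewrite mulr_ge0 // ltW.
  by apply: addr_ge0; apply: mulr_ge0 => //; lra.
pose Cz := 4 * C * (N2 + N3 * Ce).
have Cz0 : 0 <= Cz.
  by apply: mulr_ge0; [lra|apply: addr_ge0 => //; exact: mulr_ge0].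
have CuCe : 0 <= Cu * Ce by exact: mulr_ge0.
exists (r + Cz + Cu * Ce).
(* The single condition s Ds <= 1 with s = sqrt e contains every smallness requirement on s
   below. *)
pose Ds := 1 + r + r * r + 4 * C * (M * (1 + 2 * r)).
have Ds1 : 0 <= 4 * C * (M * (1 + 2 * r)).
  by rewrite !mulr_ge0 ?addr_ge0 ?mulr_ge0 // ltW.
have rr0 : 0 <= r * r by rewrite mulr_ge0 // ltW.
have Ds0 : 0 < Ds by rewrite /Ds; lra.
near=> e.
have ge : good e by near: e; exact: pd_near hP.
have ep := gp_pos ge; have e1 := gp_le1 ge.
move=> l sl.
pose s := Num.sqrt e.
have s0 : 0 <= s by exact: sqrtr_ge0.
have sE : s = e `^ 2^-1 by rewrite powR12_sqrt // ltW.
have sD : s * Ds <= 1.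
  rewrite -ler_pdivlMr // mul1r sE; near: e; apply: powR_small; rewrite ?invr_gt0 //.
have s1 : s <= 1 by rewrite /s -sqrtr1; apply: ler_wsqrtr.
have sr : 0 <= s * r by rewrite mulr_ge0 // ltW.
have srr : 0 <= s * (r * r) by rewrite mulr_ge0.
have sDs1 : 0 <= s * (4 * C * (M * (1 + 2 * r))) by rewrite mulr_ge0.
have hrr : 2 * e `^ (- rho) <= Leps Lc e by near: e.
have aC1 : apriori (m + m) (fun x => A22 S e (phi e) x l) C.
  apply: (mono _ _ C1); first by rewrite le_max lexx.
  by move: l sl; near: e.
have aC2 : apriori (m + m) (A22_0 S u0 vh l) C.
  by apply: (mono _ _ C2 _ (hC2 l sl)); rewrite le_max lexx orbT.
have [b11 b12 b21 b22] := hM e l ge sl.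
have b220 := hM0 l sl.
have Lp := good_L hP ge.
have P0 : 0 < 2 * Leps Lc e by rewrite mulr_gt0.
have per := gp_per ge.
have cond1 : C * (M + s * (M * r + M * r * r)) <= r.
  have : s * (r + r * r) <= 1 by rewrite /Ds in sD; clear -sD s0 sDs1; lra.
  move=> h; have := ler_wpM2l (ltW (mulr_gt0 C0 M0)) h; rewrite /r; clear; lra.
have cond2 : C * (s * (M * (1 + 2 * r))) <= 2^-1.
  by rewrite /Ds in sD; clear -sD s0 sr srr; lra.
have q0 : (0 < m + m)%N by rewrite addn_gt0 m_gt0.
have p22 x : A22 S e (phi e) (x + 2 * Leps Lc e) l = A22 S e (phi e) x l by rewrite /A22 per.
have p21 x : A21 S e (phi e) (x + 2 * Leps Lc e) = A21 S e (phi e) x by rewrite /A21 per.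
have p11 x : A11 S e (phi e) (x + 2 * Leps Lc e) l = A11 S e (phi e) x l by rewrite /A11 per.
have p12 x : A12 S e (phi e) (x + 2 * Leps Lc e) = A12 S e (phi e) x by rewrite /A12 per.
have [U [Lu [hU PU Ur DU]]] := riccati_exists q0 P0 C0 s0 (ltW r0) b22 b21 b11 b12
  p22 p21 p11 p12 aC1 cond1 cond2.
have fU y : nm (U y) <= r + Cz + Cu * Ce by apply: le_trans (Ur y) _; clear -r0 Cz0 CuCe; lra.
exists U, Lu; split=> // x0 x0L.
pose Q x := s%:C *: (U x *m A11 S e (phi e) x l + U x *m A12 S e (phi e) x *m U x).
have nQ x : nm (Q x) <= s * (M * (1 + r)) * nm (U x).
  rewrite /Q nmZR (ger0_norm s0) -mulrA; apply: ler_wpM2l => //.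
  apply: le_trans (nmD _ _) _; rewrite mulrDr mulr1 mulrDl; apply: lerD.
    by apply: le_trans (nmM _ _) _; rewrite mulrC; apply: ler_wpM2r; [exact: nm_ge0|exact: b11.1].
  apply: le_trans (nmM _ _) _; apply: ler_wpM2r; first exact: nm_ge0.
  apply: le_trans (nmM _ _) _; rewrite mulrC; apply: ler_pM (nm_ge0 _) (nm_ge0 _) (b12.1 _) (Ur _).
have sMr : 0 <= s * (M * (1 + r)) by rewrite !mulr_ge0 ?addr_ge0 // ltW.
have sMr' : C * (s * (M * (1 + r))) <= 4^-1.
  have : 0 <= s * C * (M * r) by rewrite !mulr_ge0 // ltW.
  by rewrite /Ds in sD; clear -sD s0 sr srr; lra.
(* One factor U of the quadratic term is bounded by r, so the coupling is at most a small multiple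
   of nm (U x) and counts as a perturbation. Only A21 remains as a source. *)
have Uex (x1 : R) : `|x1| <= Leps Lc e -> nm (U x1) <= Cu * expR (- kappa * `|x1|).
  move=> x1L; rewrite /Cu -mulrA.
  apply: (apriori_pointwise (eta := s * (M * (1 + r))) (kappa := kappa) aC1 C0 _ sMr _ _ DU).
  - exact: ltW.
  - by rewrite mulr_ge0 // expR_ge0.
  - by rewrite mulrDr; clear -kC sMr'; lra.
  - by exists r.
  move=> x; rewrite addrAC subrr add0r -/s -/(Q x).
  apply: le_trans (nmB _ _) _; rewrite addrC; apply: lerD; first exact: nQ.
  have [y [yL yp _ yd]] := fold_orbit hP x ge.
  rewrite (yp _ (A21 S e (phi e)) p21).
  apply: le_trans (A21_decay hP ge kb yL) _; rewrite -[leRHS]mulrA; apply: ler_wpM2l => //.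
  rewrite -expRD ler_expR.
  have := ler_wpM2l (ltW kp) (yd x1 x1L); clear; lra.
have [DX bX] := hX l sl.
have Xb x : nm (X l x) <= Cu * expR (- kappa * `|x|).
  rewrite /Cu -mulrA.
  apply: (apriori_pointwise (eta := 0) (kappa := kappa) aC2 C0 _ (lexx 0) _ _ DX bX).
  - exact: ltW.
  - by rewrite mulr_ge0 // expR_ge0.
  - by rewrite addr0; clear -kC; lra.
  move=> x1; rewrite addrAC subrr add0r mul0r add0r.
  apply: le_trans (A21_0_decay hP x1 kb) _; rewrite -[leRHS]mulrA; apply: ler_wpM2l => //.
  rewrite -expRD ler_expR.
  have h : `|x| <= `|x1| + `|x1 - x| by have := ler_normB x1 (x1 - x); rewrite opprB addrC subrK.
  have := ler_wpM2l (ltW kp) h; clear; lra.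
pose rr := e `^ (- rho).
have rrp : 0 < rr by exact: powR_gt0.
have ebf : e <= e `^ bf.
  rewrite -{1}(powRr1 (ltW ep)) !powR_exp // ler_expR; apply: ler_wnM2r; first by rewrite ln_le0.
  by move: bf1; clear; lra.
have sbf : s <= e `^ bf.
  rewrite sE !powR_exp // ler_expR; apply: ler_wnM2r => //.
  by rewrite ln_le0.
have e3bf : e `^ 3 <= e `^ bf.
  rewrite !powR_exp // ler_expR; apply: ler_wnM2r; first by rewrite ln_le0.
  by move: bf1; clear; lra.
have bfp : 0 < e `^ bf by exact: powR_gt0.
have krr : expR (- kappa * rr) <= Ce * e `^ 3 by exact: hCe.
have eN : 0 <= expR (- kappa * rr) by exact: expR_ge0.
split; last first.
  move=> rx; apply: le_trans (Uex x0 x0L) _.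
  apply: (@le_trans _ _ (Cu * (Ce * e `^ 3))).
    apply: ler_wpM2l => //; apply: le_trans krr.
    by rewrite ler_expR !mulNr lerN2; apply: ler_wpM2l; [exact: ltW|exact: ltW].
  rewrite powR_mulrn ?(ltW ep) // mulrA; apply: ler_wpM2r; first by rewrite exprn_ge0 // ltW.
  by clear -r0 Cz0; lra.
(* Now that U is controlled, the coupling can be treated as part of the source, of size sqrt e <=
   e^bf. *)
pose src x := (A22 S e (phi e) x l - A22_0 S u0 vh l x) *m U x +
  (A21 S e (phi e) x - A21_0 S u0 vh x) - Q x.
have hsrc x : nm (src x) <= ((N2 + N3 * Ce) * e `^ bf) * expR (kappa * `|x - x0|).
  have E1 : 1 <= expR (kappa * `|x - x0|) by rewrite -expR0 ler_expR mulr_ge0 // ltW.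
  have nsrc : nm (src x) <= nm (A22 S e (phi e) x l - A22_0 S u0 vh l x) * nm (U x) +
     nm (A21 S e (phi e) x - A21_0 S u0 vh x) + s * (M * (1 + r)) * nm (U x).
    apply: le_trans (nmB _ _) _; apply: lerD => //; apply: le_trans (nmD _ _) _.
    by apply: lerD => //; exact: nmM.
  have [xr|xr] := leP `|x| rr.
    have xL : `|x| <= Leps Lc e by move: xr hrr rrp; rewrite /rr; clear; lra.
    have hphi := hf e ge x xr xL.
    have [d1 _ d2 _] := state_norm_ge (phi e x - phi_h S u0 p0 vh qh x).
    have {}d1 := le_trans d1 hphi; have {}d2 := le_trans d2 hphi.
    rewrite /= in d1 d2.
    have D : `|uof (phi e x) - u0| + `|vof (phi e x) - vh x| + `|e - 0| <= (2 * Cf + 1) * e `^ bf.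
      by rewrite subr0 (gtr0_norm ep); move: d1 d2 ebf; clear; lra.
    have h1 : nm (A22 S e (phi e) x l - A22_0 S u0 vh l x) <= L * ((2 * Cf + 1) * e `^ bf).
      apply: le_trans (fast22_dist hP l l (good_KU hP x ge) KU0 (good_KV hP x ge) (pd_KVh hP x) (good_e e ge) e00') _.
      by rewrite subrr cn0 mulr0 addr0; apply: ler_wpM2l.
    have h2 : nm (A21 S e (phi e) x - A21_0 S u0 vh x) <= L * ((2 * Cf + 1) * e `^ bf).
      apply: le_trans (fast21_dist hP (good_KU hP x ge) KU0 (good_KV hP x ge) (pd_KVh hP x) (good_e e ge) e00') _.
      by apply: ler_wpM2l.
    have h3 : nm (A22 S e (phi e) x l - A22_0 S u0 vh l x) * nm (U x) <= L * ((2 * Cf + 1) * e `^ bf) * r.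
      exact: ler_pM (nm_ge0 _) (nm_ge0 _) h1 (Ur x).
    have h4 : s * (M * (1 + r)) * nm (U x) <= (e `^ bf * (M * (1 + r))) * r.
      apply: ler_pM => //; [exact: nm_ge0|].
      by apply: ler_wpM2r => //; rewrite mulr_ge0 ?addr_ge0 // ltW.
    apply: (@le_trans _ _ (N2 * e `^ bf)); first by apply: le_trans nsrc (le_trans (lerD (lerD h3 h2) h4) _); rewrite /N2; clear; lra.
    rewrite -[leLHS]mulr1; apply: ler_pM => //; first by rewrite mulr_ge0 // ltW.
    by apply: ler_wpM2r; [exact: ltW|rewrite lerDl mulr_ge0].
  have [y [yL yp yx yd]] := fold_orbit hP x ge.
  (* Inside the cell y = x. For x outside it, either |x0| >= rr and folding loses at most |x - x0|,
     or |x - x0| is at least L - rr >= rr; this is where 2 rr <= L enters. *)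
  have rry : rr <= `|y| + `|x - x0|.
    have [xL|xL] := leP `|x| (Leps Lc e); first by rewrite (yx xL); have := normr_ge0 (x - x0); move: xr; clear; lra.
    have := yd x0 x0L; have := ler_normB x (x - x0); rewrite opprB addrC subrK.
    have := normr_ge0 y; have [h|h] := leP rr `|x0|; first by move: h; clear; lra.
    have hrr' : 2 * rr <= Leps Lc e := hrr.
    have h' : `|x| <= `|x0| + `|x - x0| by have := ler_normD x0 (x - x0); rewrite addrC subrK.
    by move: hrr' h' h xL; clear; lra.
  set Ek := expR (- kappa * rr) * expR (kappa * `|x - x0|).
  have Ek0 : 0 <= Ek by rewrite mulr_ge0 ?expR_ge0.
  have ey : expR (- kappa * `|y|) <= Ek.
    by rewrite /Ek -expRD ler_expR; have := ler_wpM2l (ltW kp) rry; clear; lra.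
  have ex : expR (- kappa * `|x|) <= Ek.
    rewrite /Ek -expRD ler_expR; have h : rr <= `|x| + `|x - x0| by have := normr_ge0 (x - x0); move: xr; clear; lra.
    by have := ler_wpM2l (ltW kp) h; clear; lra.
  have h1 : nm (U x) <= Cu * Ek.
    rewrite (yp _ U PU); apply: le_trans (Uex y yL) _; exact: ler_wpM2l.
  have h2 : nm (A21 S e (phi e) x) <= N1 * Ek.
    rewrite (yp _ (A21 S e (phi e)) p21); apply: le_trans (A21_decay hP ge kb yL) _; exact: ler_wpM2l.
  have h3 : nm (A21_0 S u0 vh x) <= N1 * Ek.
    by apply: le_trans (A21_0_decay hP x kb) _; exact: ler_wpM2l.
  have h4 : nm (A22 S e (phi e) x l - A22_0 S u0 vh l x) <= 2 * M.
    apply: le_trans (nmB _ _) _; rewrite [2 * M]mulr_natl mulr2n.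
    exact: lerD (b22.1 x) (b220.1 x).
  have h5 : nm (A22 S e (phi e) x l - A22_0 S u0 vh l x) * nm (U x) <= 2 * M * (Cu * Ek).
    exact: ler_pM (nm_ge0 _) (nm_ge0 _) h4 h1.
  have h6 : s * (M * (1 + r)) * nm (U x) <= (M * (1 + r)) * (Cu * Ek).
    apply: ler_pM => //; [exact: nm_ge0|].
    by rewrite -[leRHS]mul1r; apply: ler_wpM2r => //; rewrite mulr_ge0 ?addr_ge0 // ltW.
  have h7 : nm (A21 S e (phi e) x - A21_0 S u0 vh x) <= N1 * Ek + N1 * Ek.
    exact: le_trans (nmB _ _) (lerD h2 h3).
  apply: (@le_trans _ _ (N3 * Ek)); first by apply: le_trans nsrc (le_trans (lerD (lerD h5 h7) h6) _); rewrite /N3; clear; lra.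
  rewrite /Ek mulrA; apply: ler_wpM2r; first exact: expR_ge0.
  apply: (@le_trans _ _ (N3 * (Ce * e `^ bf))).
    by apply: ler_wpM2l => //; apply: le_trans krr _; exact: ler_wpM2l.
  by rewrite mulrA; apply: ler_wpM2r; [exact: ltW|rewrite lerDr].
have bZ : exists B1, forall x, nm (U x - X l x) <= B1.
  have [MX hMX] := bX; exists (r + MX) => x.
  by apply: le_trans (nmB _ _) _; exact: lerD.
have := @apriori_pointwise R (m + m) (n + n) (A22_0 S u0 vh l) C kappa 0 ((N2 + N3 * Ce) * e `^ bf) x0
  (fun x => U x - X l x) _ aC2 C0 (ltW kp) (lexx 0) _ _ (fun x => isDmB (DU x) (DX x)) bZ _.
move=> H; apply: (@le_trans _ _ (4 * C * ((N2 + N3 * Ce) * e `^ bf))); last first.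
  rewrite mulrA -/Cz; apply: ler_wpM2r; [exact: ltW|clear -r0 CuCe; lra].
apply: H.
- apply: mulr_ge0; last exact: ltW.
  by apply: addr_ge0 => //; exact: mulr_ge0.
- by rewrite addr0; clear -kC; lra.
move=> x; rewrite mul0r add0r; apply: le_trans (hsrc x).
rewrite le_eqVlt; apply/orP; left; apply/eqP; congr nm.
exact: (linear_defect (A22 S e (phi e) x l) (A22_0 S u0 vh l x) (U x) (X l x)
  (A21 S e (phi e) x) (A21_0 S u0 vh x) (Q x)).
Unshelve. all: by end_near. Qed.

(** * The spectral region *)

(** With z = om - l the angle condition gives |z| cos (pi - varpi) < Re z < om - Lam, and the cosine
    is positive because varpi > pi/2. *)
Lemma sector_bounded (R : realType) (om varpi Lam : R) : pi / 2 < varpi < pi ->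
  exists Ml, forall l, Sigma0 om varpi Lam l -> cn l <= Ml.
Proof.
move=> /andP[v1 v2]; have cp : 0 < cos (pi - varpi).
  by apply: cos_gt0_pihalf; apply/andP; split; lra.
exists (`|om| + 2 * ((om - Lam) / cos (pi - varpi))) => l [/andP[l1 l2] hc].
set z := om%:C - l in hc.
have zR : Re z = om - Re l by rewrite /z Re_add Re_opp.
have z0 : 0 < Re z by rewrite zR subr_gt0.
have zn : Re z <= Normc.normc z.
  rewrite /z; case: (om%:C - l) => a b /=.
  by apply: le_trans (ler_norm _) _; rewrite -sqrtr_sqr; apply: ler_wsqrtr; rewrite lerDl sqr_ge0.
have n0 : 0 < Normc.normc z by exact: lt_le_trans zn.
have t1 : -1 <= Re z / Normc.normc z <= 1.
  rewrite ler_pdivrMr // mul1r zn andbT; apply: (@le_trans _ _ 0); first by rewrite lerN10.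
  by rewrite divr_ge0 // ltW.
have [/andP[a0 ap] ca] := acos_def t1.
have ac : acos (Re z / Normc.normc z) < pi - varpi.
  apply: le_lt_trans hc; rewrite /carg; case: ifP => _; last rewrite normrN; exact: ler_norm.
have ct : cos (pi - varpi) < Re z / Normc.normc z.
  by rewrite -ca ltr_cos // in_itv /=; apply/andP; split; lra.
have nz : Normc.normc z <= (om - Lam) / cos (pi - varpi).
  rewrite ler_pdivlMr // mulrC; rewrite ltr_pdivlMr // in ct.
  by move: ct; rewrite zR; lra.
have -> : l = om%:C - z by rewrite /z opprB addrC subrK.
apply: le_trans (cnD _ _) _; rewrite cnN cnR lerD2l.
by apply: le_trans (cn_le_normc _) _; apply: ler_wpM2l.
Qed.

(** Adding a bounded homogeneous solution to X would give a second bounded solution of the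
    inhomogeneous problem. *)
Lemma unique_no_bounded_solution (R : realType) (m n : nat) (S : rd_system R m n)
    (u0 : 'cV[R]_m) (vh : R -> 'cV[R]_n) (l : R[i]) (X : R -> 'M[R[i]]_(n + n, m + m)) :
  unique (inhom_solution S u0 vh l) X -> no_bounded_solution (m + m) (A22_0 S u0 vh l).
Proof.
move=> [[oX [M hM]] uX] w hw [N hN] x.
have [/lin_odeP dX] : inhom_solution S u0 vh l (fun t => X t + w t).
  split.
    apply/lin_odeP => t; apply: isDm_eq (isDmD (proj1 (lin_odeP _ _ _) oX t) (hw t)) _.
    by rewrite mulmxDr addrAC.
  exists ((n + n)%:R * (m + m)%:R * 2 * M + N) => t _.
  apply: le_trans (normc_mx_le _) _; rewrite lecR; apply: le_trans (nmD _ _) _.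
  by apply: lerD => //; apply: nm_le_normc; exact: hM.
move=> bX; have := uX (fun t => X t + w t) (conj (proj2 (lin_odeP _ _ _) dX) bX).
move=> /(congr1 (fun f => f x)) /= E.
by apply: (@addrI _ (X x)); rewrite addr0 -E.
Qed.

Section Closure.
Variables (R : realType) (m n : nat) (S : rd_system R m n).
Variables (om varpi Lam0 Lam delta : R) (Bu Bs : R[i] -> 'M[R[i]]_(n + n, n)).
Variables (u0 : 'cV[R]_m) (vh : R -> 'cV[R]_n) (K : set (state R m n)).
Hypotheses (hLam : - Lam0 < Lam < 0) (delta0 : 0 < delta).

(** A limit point may lie on the line Re l = Lam. Discs about zeros on that line are removed too,
    and a limit point that were a zero would have points of the region in its own disc. *)
Lemma sigmad_closure l :
  (forall a : R, 0 < a -> exists2 k, Sigmad om varpi Bu Bs Lam delta k & cn (k - l) < a) ->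
  Lam <= Re l /\ Ef0 Bu Bs l <> 0.
Proof.
move=> hl; have lR : Lam <= Re l.
  rewrite leNgt; apply/negP => h; have [|k [[/andP[k1 _] _] _] kl] := hl (Lam - Re l).
    by rewrite subr_gt0.
  have := le_lt_trans (Re_le_cn _) kl; rewrite Re_add Re_opp => /(le_lt_trans (ler_norm _)).
  by move: k1; lra.
split=> // E; have [k [_ hk] kl] := hl delta delta0.
by apply: (hk l lR E); exact: le_lt_trans (normc_le_cn _) kl.
Qed.

Lemma sigmad_limit_no_bounded_solution (Xin : R[i] -> R -> 'M[R[i]]_(n + n, m + m)) :
  uniformly_hyperbolic S K Lam0 ->
  (forall lam, half_plane (- Lam0) lam -> Ef0 Bu Bs lam <> 0 ->
     unique (inhom_solution S u0 vh lam) (Xin lam)) ->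
  forall l, (forall a : R, 0 < a ->
      exists2 k, Sigmad om varpi Bu Bs Lam delta k & cn (k - l) < a) ->
  no_bounded_solution (m + m) (A22_0 S u0 vh l) /\
  forall z, K z -> no_bounded_solution (m + m) (fun=> fast22 S (uof z) 0 0 l).
Proof.
move=> hh hX l /sigmad_closure[lR E]; have /andP[L1 L2] := hLam; split.
  by apply: unique_no_bounded_solution (hX l _ E); exact: lt_le_trans lR.
move=> z Kz; apply: hyperbolic_no_bounded_solution => nu hnu.
(* The midpoint of -Lam0 and Lam: a limit point with Re l = Lam lies outside the open half-plane of
   Lam but inside this one. *)
have [|mu mu0 hmu] := hh ((Lam - Lam0) / 2); first by apply/andP; split; lra.
have := hmu z l nu Kz _ hnu; rewrite -normr_gt0 => h; apply: lt_le_trans mu0 _; apply: h.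
by rewrite /half_plane /=; lra.
Qed.

End Closure.

(** The half-period has order 1/e and rho < 1. The factor 2 leaves a margin of at least e^(-rho)
    between the inner region and the end of the cell. *)
Lemma inner_region_small (R : realType) (Lc : R -> R) (L0 rho : R) : 0 < L0 -> rho < 1 ->
  (\forall e \near 0^'+, L0 / 2 <= Lc e) ->
  \forall e \near (0 : R)^'+, 2 * e `^ (- rho) <= Leps Lc e.
Proof.
move=> L00 rho1 hL.
have h : \forall e \near (0 : R)^'+, e `^ (1 - rho) <= L0 / 4.
  by apply: powR_small; [rewrite subr_gt0|rewrite divr_gt0].
near=> e.
have ep : 0 < e by near: e; exact: nbhs_right_gt.
have h1 : e `^ (1 - rho) <= L0 / 4 by near: e.
have h2 : L0 / 2 <= Lc e by near: e.
rewrite /Leps ler_pdivlMl // mulrCA.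
have -> : e * e `^ (- rho) = e `^ (1 - rho).
  by rewrite -{1}(powRr1 (ltW ep)) -powRD ?(gt_eqF ep) ?implybT.
by move: h1 h2; clear; lra.
Unshelve. all: by end_near. Qed.

(** * Assembly of the factorization and the bounds *)

Lemma block_factorization (R : realType) q p (A1 : R -> 'M[R[i]]_q) (A2 : R -> 'M[R[i]]_(q, p))
    (B : R -> 'M[R[i]]_(p, q)) (A : R -> 'M[R[i]]_p) (U : R -> 'M[R[i]]_(p, q))
    T (s M Lu L : R) :
  is_evolution (fun x => block_mx (s%:C *: A1 x) (s%:C *: A2 x) (B x) (A x)) T ->
  bl M A1 -> bl M A2 -> bl M A -> bl Lu U ->
  (forall x, isDm U x (A x *m U x + (B x - s%:C *: (U x *m A1 x + U x *m A2 x *m U x)))) ->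
  U L = U (- L) ->
  exists Ts Tf, [/\ is_evolution (fun x => s%:C *: (A1 x + A2 x *m U x)) Ts,
    is_evolution (fun x => A x - s%:C *: (U x *m A2 x)) Tf &
    forall g, evans T L g = evans Ts L g * evans Tf L g].
Proof.
move=> hT h1 h2 h hU DU UL.
have bs := blZ s (blD h1 (blM h2 hU)); have bf := blD h (blN (blZ s (blM hU h2))).
have [Ts hTs] := evolution_exists bs; have [Tf hTf] := evolution_exists bf.
exists Ts, Tf; split=> //; set Ms := `|s| * _ in bs; set Mf := M + _ in bf.
apply: (evans_factorization (M := Num.max Ms Mf) hT hTs hTf) => // x.
  by rewrite le_max bs.1.
by rewrite le_max bf.1 orbT.
Qed.

Theorem theorem6p17 (R : realType) (m n : nat) (hm : (1 <= m)%N) (hn : (1 <= n)%N)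
  (S : rd_system R m n) (hD1 : diag_pos (D1 S)) (hD2 : diag_pos (D2 S))
  (U : set 'cV[R]_m) (V : set 'cV[R]_n) (I : set R)
  (hS1 : assumption_S1 S U V I)
  (hS2 : assumption_S2 S U)
  (phi : R -> R -> state R m n) (Lc : R -> R) (L0 : R)
  (u0 p0 : 'cV[R]_m) (vh qh : R -> 'cV[R]_n)
  (hS3 : assumption_S3 S U V phi Lc L0 u0 p0 vh qh)
  (T : R -> R[i] -> R -> R -> 'M[R[i]]_((m + m) + (n + n)))
  (hT : \forall e \near 0^'+, forall lam,
     is_evolution (eigenvalue_matrix S e (phi e) lam) (T e lam))
  (om varpi : R) (hsector : sector_in_resolvent S phi om varpi)
  (K : set (state R m n)) (hK : compact_enclosure U V phi u0 K)
  (Lam0 : R) (hLam0 : 0 < Lam0) (hhyp : uniformly_hyperbolic S K Lam0)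
  (Bu Bs : R[i] -> 'M[R[i]]_(n + n, n))
  (hB : fast_bases S u0 vh (half_plane (- Lam0)) Bu Bs)
  (Xin : R[i] -> R -> 'M[R[i]]_(n + n, m + m))
  (hXin : forall lam, half_plane (- Lam0) lam -> Ef0 Bu Bs lam <> 0 ->
     unique (inhom_solution S u0 vh lam) (Xin lam)) :
  exists bf rho : R,
  [/\ 0 < bf, 0 < rho, fast_approximation S phi u0 p0 vh qh bf rho &
  forall Lam delta : R, - Lam0 < Lam < 0 -> 0 < delta ->
  exists (Ueps : R -> R -> R[i] -> 'M[R[i]]_(n + n, m + m))
         (Tsd : R -> R[i] -> R -> R -> 'M[R[i]]_(m + m))
         (Tfd : R -> R[i] -> R -> R -> 'M[R[i]]_(n + n))
         (C : R),
  \forall e \near 0^'+,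
  forall lam, Sigmad om varpi Bu Bs Lam delta lam ->
  let L := Leps Lc e in
  [/\ is_evolution
        (fun x => (Num.sqrt e)%:C *:
           (A11 S e (phi e) x lam + A12 S e (phi e) x *m Ueps e x lam))
        (Tsd e lam) /\
      is_evolution
        (fun x => A22 S e (phi e) x lam
           - (Num.sqrt e)%:C *: (Ueps e x lam *m A12 S e (phi e) x))
        (Tfd e lam),
      forall g : R[i],
        evans (T e lam) L g = evans (Tsd e lam) L g * evans (Tfd e lam) L g,
      (forall x : R, `|Ueps e x lam| <= C%:C) /\
      (forall x : R, Ueps e (x + 2 * L) lam = Ueps e x lam),
      forall x : R, - L <= x <= L ->
        `|Ueps e x lam - Xin lam x| <= (C * e `^ bf)%:C &
      forall x : R, - L <= x <= L -> e `^ (- rho) < `|x| ->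
        `|Ueps e x lam| <= (C * e ^+ 3)%:C]].
Proof.
have [KU [KV [e0 [Lb [B [Ls [b hP]]]]]]] := pulse_data_exist hD1 hD2 hS1 hS3 hK.
have [bf [rho [Cf [bf0 bf1 rho0 rho1 [Cf0 hf]]]]] := pulse_approximation hP.
have hrho : \forall e \near (0 : R)^'+, 2 * e `^ (- rho) <= Leps Lc e.
  apply: (inner_region_small (pd_L0 hP)) => //.
  by apply: filterS (pd_near hP) => e /gp_L.
exists bf, rho; split=> //.
  exists Cf; near=> e => x xr.
  have ge : good_parameter S KU KV phi Lc L0 u0 p0 vh qh e0 B Ls b K e by near: e; exact: pd_near hP.
  apply: hf => //; apply: le_trans xr _.
  have : 2 * e `^ (- rho) <= Leps Lc e by near: e.
  by have := powR_ge0 e (- rho); clear; lra.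
move=> Lam delta hLam delta0.
have [_ hv _] := hsector.
have [Ml hMl] := sector_bounded om Lam hv.
pose Sig := Sigmad om varpi Bu Bs Lam delta.
have hSig l : Sig l -> cn l <= Ml by move=> [/hMl].
have hX l : Sig l ->
    (forall x, isDm (Xin l) x (A22_0 S u0 vh l x *m Xin l x + A21_0 S u0 vh x)) /\
    exists M, forall x, nm (Xin l x) <= M.
  (* A point of the region is a limit point of it, so the closure lemma already gives what the
     uniqueness of Xin requires. *)
  move=> sl; have [|lR E] := @sigmad_closure R n om varpi Lam delta Bu Bs delta0 l.
    by move=> a a0; exists l => //; rewrite subrr cn0.
  have [|[/lin_odeP oX [M bX]] _] := hXin l _ E.
    by rewrite /half_plane /=; apply: lt_le_trans lR; case/andP: hLam.
  split=> //; exists ((n + n)%:R * (m + m)%:R * 2 * M) => x.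
  by apply: nm_le_normc; exact: bX.
have hlim := sigmad_limit_no_bounded_solution (om := om) (varpi := varpi) hLam delta0 hhyp hXin.
have [C hC] := riccati_solution hP hm hSig hlim hX bf1 rho0 Cf0 hf hrho.
have [M _ [hM _]] := coefficients_bl hP hSig.
pose triple : Type := (R -> 'M[R[i]]_(n + n, m + m)) * (R -> R -> 'M[R[i]]_(m + m)) *
  (R -> R -> 'M[R[i]]_(n + n)).
pose Pr (z : R * R[i]) (t : triple) : Prop := let e := z.1 in let l := z.2 in let U := t.1.1 in
  [/\ is_evolution (fun x => (Num.sqrt e)%:C *: (A11 S e (phi e) x l + A12 S e (phi e) x *m U x)) t.1.2 /\
      is_evolution (fun x => A22 S e (phi e) x l - (Num.sqrt e)%:C *: (U x *m A12 S e (phi e) x)) t.2,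
      forall g, evans (T e l) (Leps Lc e) g = evans t.1.2 (Leps Lc e) g * evans t.2 (Leps Lc e) g,
      (forall x, U (x + 2 * Leps Lc e) = U x), (forall x, nm (U x) <= C) &
      forall x, `|x| <= Leps Lc e -> nm (U x - Xin l x) <= C * e `^ bf /\
        (e `^ (- rho) < `|x| -> nm (U x) <= C * e ^+ 3)].
(* Solutions are found for one (e, l) at a time, but the theorem asks for functions fixed
   beforehand: [choice] selects them, with the value 0 where none exists. *)
have [F hF] : {F : R * R[i] -> triple & forall z, (exists t, Pr z t) -> Pr z (F z)}.
  apply: (@choice _ _ (fun z t => (exists t, Pr z t) -> Pr z t)) => z.
  have [[t ht]|nt] := pselect (exists t, Pr z t); first by exists t.
  by exists (fun=> 0, fun _ _ => 0, fun _ _ => 0) => /nt.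
exists (fun e x l => (F (e, l)).1.1 x), (fun e l => (F (e, l)).1.2), (fun e l => (F (e, l)).2), C.
apply: filterS3 (pd_near hP) hC hT => e ge hU hTe l sl /=.
have [|[hTs hTf] hE per bU hx] := hF (e, l).
  have [W [Lu [blU PU rU DU hU1]]] := hU l sl.
  have [b11 b12 _ b22] := hM e l ge sl.
  have UL : W (Leps Lc e) = W (- Leps Lc e) by rewrite -(PU (- _)) mulr_natl mulr2n addKr.
  have [Ts [Tf [h1 h2 h3]]] := block_factorization (hTe l) b11 b12 b22 blU DU UL.
  by exists (W, Ts, Tf).
split=> //.
- split=> // x; apply: le_trans (normc_mx_le _) _; rewrite lecR; exact: bU.
- move=> x; rewrite -ler_norml => xL; apply: le_trans (normc_mx_le _) _; rewrite lecR.
  by case: (hx x xL).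
move=> x; rewrite -ler_norml => xL xr; apply: le_trans (normc_mx_le _) _; rewrite lecR.
by case: (hx x xL) => _; apply.
Unshelve. all: by end_near. Qed.
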